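(* Let $x_0\in\mathbb{R}^n$, $1<p<\infty$, and let $\Omega\in L_s(S^{n-1})$, $1<s\le\infty$, be $A_t$-homogeneous of degree zero. Let $T_\Omega^P$ be a parabolic linear operator satisfying the size condition $(\ast)$ of the context and bounded on $L_q(\mathbb{R}^n)$ for $1<q<\infty$. Let $1<p_1,p_2<\infty$ with $\frac1p=\frac1{p_1}+\frac1{p_2}$, $0\le\lambda<\frac1\gamma$ and $b\in LC_{p_2,\lambda,P}^{\{x_0\}}(\mathbb{R}^n)$. Let $\varphi_1,\varphi_2$ be positive measurable functions on $\mathbb{R}^n\times(0,\infty)$, and assume one of the following, with a constant $C$ not depending on $r$, for all $r>0$: (a) $s'\le p$ and $$\int_r^\infty\Bigl(1+\ln\frac tr\Bigr)\frac{\operatorname*{ess\,inf}_{t<\tau<\infty}\varphi_1(x_0,\tau)\,\tau^{\gamma/p_1}}{t^{\gamma/p_1+1-\gamma\lambda}}\,dt\le C\,\varphi_2(x_0,r);$$ (b) $p_1<s$ and $$\int_r^\infty\Bigl(1+\ln\frac tr\Bigr)\frac{\operatorname*{ess\,inf}_{t<\tau<\infty}\varphi_1(x_0,\tau)\,\tau^{\gamma/p_1}}{t^{\gamma/p_1-\gamma/s+1-\gamma\lambda}}\,dt\le C\,\varphi_2(x_0,r)\,r^{\gamma/s}.$$ Then the commutator $[b,T_\Omega^P]$ is bounded from $LM_{p_1,\varphi_1,P}^{\{x_0\}}$ to $LM_{p,\varphi_2,P}^{\{x_0\}}$. Moreover, $$\|[b,T_\Omega^P]f\|_{LM_{p,\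varphi_2,P}^{\{x_0\}}}\lesssim\|b\|_{LC_{p_2,\lambda,P}^{\{x_0\}}}\|f\|_{LM_{p_1,\varphi_1,P}^{\{x_0\}}}.$$
   Context: Setting: $n\ge2$; $P$ is a real $n\times n$ matrix all of whose eigenvalues have positive real part; $A_t=t^P$ ($t>0$); $\gamma=\operatorname{tr}P$. $\rho$ is a quasi-distance associated with $P$, i.e. $\rho(A_tx)=t\rho(x)$ for all $t>0$, $x\in\mathbb{R}^n$; $\rho(0)=0$, $\rho(x-y)=\rho(y-x)\ge0$ and $\rho(x-y)\le k(\rho(x-z)+\rho(y-z))$ with a constant $k\ge1$; $dx=\rho^{\gamma-1}d\sigma(w)\,d\rho$, where $\rho=\rho(x)$, $w=A_{\rho^{-1}}x$ and $d\sigma(w)$ is a measure on $\{w:\rho(w)=1\}$; there are positive constants $c_i,\alpha_i$ ($i=1,\dots,4$) with $c_1|x|^{\alpha_1}\le\rho(x)\le c_2|x|^{\alpha_2}$ if $\rho(x)\ge1$, $c_3|x|^{\alpha_3}\le\rho(x)\le c_4|x|^{\alpha_4}$ if $\rho(x)\le1$, and $\rho(\theta x)\le\rho(x)$ for $0<\theta<1$; similar properties are assumed for the quasi-distance $\rho^*$ associated with the adjoint $P^*$. $E(x,r)=\{y\in\mathbb{R}^n:\rho(x-y)<r\}$ is the ellipsoid with center $x$ and radius $r$; its Lebesgue measure is $|E(x,r)|=\upsilon_\rho r^\gamma$, where $\upsilon_\rho=|E(0,1)|$. $S^{n-1}$ is the Euclidean unit sphere of $\mathbb{R}^n$ with normalized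 surface measure. $\Omega$ is a real-valued measurable function on $\mathbb{R}^n$; it is $A_t$-homogeneous of degree zero if $\Omega(A_tx)=\Omega(x)$ for all $t>0$ and $x$. $s'=s/(s-1)$ ($s'=1$ if $s=\infty$). Size condition $(\ast)$: for every $f\in L_1(\mathbb{R}^n)$ with compact support and every $x\notin\operatorname{supp}f$, $$|T_\Omega^Pf(x)|\le c_0\int_{\mathbb{R}^n}\frac{|\Omega(x-y)|}{\rho(x-y)^\gamma}|f(y)|\,dy,$$ with $c_0$ independent of $f$ and $x$. The commutator is $[b,T]f(x)=b(x)Tf(x)-T(bf)(x)$. For a positive measurable $\varphi$ on $\mathbb{R}^n\times(0,\infty)$ and $1\le p<\infty$, the parabolic generalized local Morrey space $LM_{p,\varphi,P}^{\{x_0\}}$ consists of $f\in L_p^{loc}(\mathbb{R}^n)$ with $\|f\|_{LM_{p,\varphi,P}^{\{x_0\}}}=\sup_{r>0}\varphi(x_0,r)^{-1}|E(x_0,r)|^{-1/p}\|f\|_{L_p(E(x_0,r))}<\infty$. For $1\le q<\infty$ and $0\le\lambda<1/\gamma$, the parabolic local Campanato space $LC_{q,\lambda,P}^{\{x_0\}}(\mathbb{R}^n)$ consists of $f\in L_q^{loc}(\mathbb{R}^n)$ with $$\|f\|_{LC_{q,\lambda,P}^{\{x_0\}}}=\sup_{r>0}\Bigl(\frac1{|E(x_0,r)|^{1+\lambda q}}\int_{E(x_0,r)}|f(y)-f_{E(x_0,r)}|^q\,dy\Bigr)^{1/q}<\infty,$$ where $f_{E(x_0,r)}=|E(x_0,r)|^{-1}\int_{E(x_0,r)}f(y)\,dy$.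 $A\lesssim B$ means $A\le CB$ with a positive constant $C$ independent of appropriate quantities (in particular of $f$ and $b$). *)

(* Defs.v *)
(* MathComp-Analysis development: R is an arbitrary realType. *)
From HB Require Import structures.
From mathcomp Require Import all_boot all_order all_algebra.
From mathcomp Require Import all_classical all_reals all_analysis.
From mathcomp Require Import measurable_realfun ess_sup_inf.
From mathcomp.real_closed Require Import complex.

Set Implicit Arguments.
Unset Strict Implicit.
Unset Printing Implicit Defensive.
Import Order.TTheory GRing.Theory Num.Theory.
Import numFieldNormedType.Exports.

Local Open Scope classical_set_scope.
Local Open Scope ring_scope.

(* R^n is 'rV[R]_n, with the sigma-algebra generated by the coordinate maps,
   i.e. the Borel sigma-algebra.  *)
Section measurable_rV.
Context {R : realType} (n : nat).

Let coors : 'I_n -> 'rV[R]_n -> R := fun i x => x ord0 i.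

Let rV_set0 : g_sigma_preimage coors set0.
Proof. exact: sigma_algebra0. Qed.

Let rV_setC A : g_sigma_preimage coors A -> g_sigma_preimage coors (~` A).
Proof. exact: sigma_algebraC. Qed.

Let rV_bigcup (F : (set 'rV[R]_n)^nat) :
  (forall i, g_sigma_preimage coors (F i)) ->
  g_sigma_preimage coors (\bigcup_i (F i)).
Proof. exact: sigma_algebra_bigcup. Qed.

HB.instance Definition _ := @isMeasurable.Build default_measure_display
  'rV[R]_n (g_sigma_preimage coors) rV_set0 rV_setC rV_bigcup.

Lemma measurable_coord (i : 'I_n) :
  measurable_fun [set: 'rV[R]_n] (fun x => x ord0 i).
Proof.
move=> _ Y mY; rewrite setTI; apply: sub_sigma_algebra => /=.
rewrite -bigcup_seq/=; exists i => /=; first by rewrite mem_index_enum.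
by exists Y => //; rewrite setTI.
Qed.

Lemma measurable_rVP d (T : measurableType d) (f : T -> 'rV[R]_n) :
  (forall i, measurable_fun [set: T] (fun x => f x ord0 i)) ->
  measurable_fun [set: T] f.
Proof.
move=> mf; rewrite -(setTI setT) => _ Y.
suff: g_sigma_preimage coors `<=` [set Y | measurable (setT `&` f @^-1` Y)].
  by move=> /(_ Y) + mY; rewrite setTI; exact.
apply: smallest_sub.
  split => /=.
  - by rewrite preimage_set0 setI0.
  - by move=> A; rewrite !setTI setTD preimage_setC; exact: measurableC.
  - move=> F mF; rewrite preimage_bigcup setI_bigcupr.
    exact: bigcupT_measurable.
rewrite -bigcup_seq; apply: bigcup_sub => i _ _ [B mB <-] /=.
rewrite !setTI -[X in measurable X]setTI.
exact: (mf i).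
Qed.

End measurable_rV.

(* [pushforward] with the measurability proof as an argument, so that its
   measure structure can be inferred (compare [mrestr]). *)
Definition mimage d1 d2 (T1 : measurableType d1) (T2 : measurableType d2)
    (R : realType) (m : set T1 -> \bar R) (f : T1 -> T2)
    (mf : measurable_fun [set: T1] f) : set T2 -> \bar R :=
  pushforward m f.

Section mimage_measure.
Context d1 d2 (T1 : measurableType d1) (T2 : measurableType d2) (R : realType).
Variables (m : {measure set T1 -> \bar R}) (f : T1 -> T2).
Hypothesis mf : measurable_fun [set: T1] f.

Let mimage0 : mimage m mf set0 = 0%E.
Proof. exact: (measure0 (pushforward m f)). Qed.

Let mimage_ge0 A : (0 <= mimage m mf A)%E.
Proof. exact: (measure_ge0 (pushforward m f)). Qed.

Let mimage_sigma_additive : semi_sigma_additive (mimage m mf).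
Proof. exact: (@measure_semi_sigma_additive _ _ _ (pushforward m f)). Qed.

HB.instance Definition _ := isMeasure.Build _ _ _ (mimage m mf)
  mimage0 mimage_ge0 mimage_sigma_additive.

End mimage_measure.

Section mimage_sigma_finite.
Context d1 d2 (T1 : measurableType d1) (T2 : measurableType d2) (R : realType).
Variables (m : {measure set T1 -> \bar R}) (f : T1 -> T2).
Hypothesis mf : measurable_fun [set: T1] f.

Lemma mimage_sigma_finite (g : T2 -> T1) :
  measurable_fun [set: T2] g -> cancel f g ->
  sigma_finite [set: T1] m -> sigma_finite [set: T2] (mimage m mf).
Proof.
move=> mg fK [F FT mF].
exists (fun i => g @^-1` F i); first by rewrite -preimage_bigcup -FT.
move=> i; have [mFi Fioo] := mF i; split.
  by rewrite -[X in measurable X]setTI; exact: mg.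
by rewrite /mimage /pushforward -comp_preimage (_ : g \o f = id)//; exact/funext.
Qed.

End mimage_sigma_finite.

(* Lebesgue measure on n-tuples: the n-fold product of the Lebesgue measure of
   the line (a unit point mass in dimension 0). *)
Section lebesgue_tuple.
Context {R : realType}.

Definition tcons n (z : R * n.-tuple R) : n.+1.-tuple R := [tuple of z.1 :: z.2].

Lemma measurable_tcons n : measurable_fun [set: R * n.-tuple R] (@tcons n).
Proof. exact: measurable_cons. Qed.

Definition tuncons n (t : n.+1.-tuple R) : R * n.-tuple R :=
  (thead t, [tuple of behead t]).

Lemma tconsK n : cancel (@tcons n) (@tuncons n).
Proof. by case=> x t; congr pair; apply/val_inj. Qed.

Lemma measurable_tuncons n : measurable_fun [set: n.+1.-tuple R] (@tuncons n).
Proof.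
apply/measurable_fun_pairP; split; first exact: (measurable_tnth ord0).
apply/measurable_fun_tnthP => i.
rewrite (_ : _ \o _ = (@tnth n.+1 R)^~ (lift ord0 i)).
  exact: measurable_tnth.
apply/funext => t /=; rewrite tnth_behead; congr tnth; apply/val_inj.
by rewrite /= inordK// ltnS.
Qed.

Section succ.
Variables (n : nat) (m : {sigma_finite_measure set (n.-tuple R) -> \bar R}).

Definition lebesgue_tupleS :=
  mimage (@lebesgue_measure R \x m)%E (@measurable_tcons n).

HB.instance Definition _ := Measure.on lebesgue_tupleS.

Let sigma_finite_prod :
  sigma_finite [set: R * n.-tuple R] (@lebesgue_measure R \x m)%E.
Proof.
have /sigma_finiteP[F [TF ndF Foo]] := sigma_finiteT (@lebesgue_measure R).
have /sigma_finiteP[G [TG ndG Goo]] := sigma_finiteT m.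
exists (fun k => F k `*` G k).
  rewrite -setXTT TF TG predeqE => -[x y]; split=> [[/= [k _ Fkx] [l _ Gly]]|].
    exists (maxn k l) => //; split.
    - by move: x Fkx; exact/subsetPset/ndF/leq_maxl.
    - by move: y Gly; exact/subsetPset/ndG/leq_maxr.
  by move=> [k _ [/= ? ?]]; split; exists k.
move=> k; have [? ?] := Foo k; have [? ?] := Goo k.
split; first exact: measurableX.
by rewrite product_measure1E// lte_mul_pinfty// ge0_fin_numE.
Qed.

Let sigma_finite_tupleS : sigma_finite [set: n.+1.-tuple R] lebesgue_tupleS.
Proof.
apply: (@mimage_sigma_finite _ _ _ _ R (@lebesgue_measure R \x m)%E _
  (@measurable_tcons n) (@tuncons n)).
- exact: measurable_tuncons.
- exact: tconsK.
- exact: sigma_finite_prod.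
Qed.

HB.instance Definition _ := Measure_isSigmaFinite.Build _ _ _ lebesgue_tupleS
  sigma_finite_tupleS.

End succ.

Fixpoint lebesgue_tuple n : {sigma_finite_measure set (n.-tuple R) -> \bar R} :=
  if n is n'.+1 then lebesgue_tupleS (lebesgue_tuple n') else \d_[tuple].

End lebesgue_tuple.

Section lebesgue_rV.
Context {R : realType} (n : nat).

Definition tuple_row (t : n.-tuple R) : 'rV[R]_n := \row_i tnth t i.

Lemma measurable_tuple_row : measurable_fun [set: n.-tuple R] tuple_row.
Proof.
apply: measurable_rVP => i.
rewrite (_ : (fun _ => _) = (@tnth n R)^~ i); first exact: measurable_tnth.
by apply/funext => t; rewrite mxE.
Qed.

Definition lebesgue_rV : set 'rV[R]_n -> \bar R :=
  mimage (lebesgue_tuple n) measurable_tuple_row.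

HB.instance Definition _ := Measure.on lebesgue_rV.

Let sigma_finite_rV : sigma_finite [set: 'rV[R]_n] lebesgue_rV.
Proof.
apply: (@mimage_sigma_finite _ _ _ _ R (lebesgue_tuple n) _ measurable_tuple_row
  (fun x => [tuple x ord0 i | i < n])).
- apply/measurable_fun_tnthP => i.
  rewrite (_ : _ \o _ = fun x : 'rV[R]_n => x ord0 i).
    exact: measurable_coord.
  by apply/funext => x /=; rewrite tnth_mktuple.
- by move=> t; apply: eq_from_tnth => i; rewrite tnth_mktuple mxE.
- exact: sigma_finiteT.
Qed.

HB.instance Definition _ := Measure_isSigmaFinite.Build _ _ _ lebesgue_rV
  sigma_finite_rV.

Definition vol (A : set 'rV[R]_n) : R := fine (lebesgue_rV A).

End lebesgue_rV.

Section euclidean_sphere.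
Context {R : realType} (n : nat).

Definition enorm (x : 'rV[R]_n) : R := Num.sqrt (\sum_i x ord0 i ^+ 2).

Lemma measurable_enorm : measurable_fun [set: 'rV[R]_n] enorm.
Proof.
rewrite (_ : enorm = (fun x => (\sum_i x ord0 i ^+ 2) `^ 2^-1)).
  apply: (measurableT_comp (measurable_powR (R := R) 2^-1)).
  by apply: measurable_sum => i; apply: measurable_funX; exact: measurable_coord.
by apply/funext => x; rewrite powR12_sqrt// sumr_ge0// => i _; exact: sqr_ge0.
Qed.

Definition eball : set 'rV[R]_n := [set x | enorm x <= 1].

Lemma measurable_eball : measurable eball.
Proof.
rewrite (_ : eball = [set: 'rV[R]_n] `&` enorm @^-1` `]-oo, 1]%classic).
  by apply: measurable_enorm => //; exact: measurable_itv.
by rewrite setTI; apply/seteqP; split => x /=; rewrite in_itv.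
Qed.

Definition radial_proj (x : 'rV[R]_n) : 'rV[R]_n := (enorm x)^-1 *: x.

Lemma measurable_radial_proj : measurable_fun [set: 'rV[R]_n] radial_proj.
Proof.
apply: measurable_rVP => i.
rewrite (_ : (fun _ => _) = (fun x => enorm x `^ (-1) * x ord0 i)).
  apply: measurable_funM; last exact: measurable_coord.
  exact: (measurableT_comp (measurable_powR (R := R) (-1))) measurable_enorm.
by apply/funext => x; rewrite mxE powR_inv1// sqrtr_ge0.
Qed.

Let inv_vol_eball_ge0 : 0 <= (vol eball)^-1.
Proof. by rewrite invr_ge0 fine_ge0. Qed.

(* The normalized surface measure of S^{n-1}, as a measure on R^n carried by
   S^{n-1}: the mass of A is the proportion of the unit ball occupied by the
   cone with vertex 0 over A. *)
Definition sphere_measure : set 'rV[R]_n -> \bar R :=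
  mscale (NngNum inv_vol_eball_ge0)
    (mimage (mrestr (@lebesgue_rV R n) measurable_eball)
            measurable_radial_proj).

HB.instance Definition _ := Measure.on sphere_measure.

End euclidean_sphere.

Section parabolic_setting.
Context {R : realType} (n : nat).
Implicit Types (P A : 'M[R]_n) (x y z : 'rV[R]_n) (f b Omega : 'rV[R]_n -> R).

Local Notation mu := (@lebesgue_rV R n).

Definition expmx A : 'M[R]_n := limn (series (fun k => k`!%:R^-1 *: A ^+ k)).

(* t^P = exp ((ln t) P) *)
Definition mxpower P (t : R) : 'M[R]_n := expmx (ln t *: P).

(* The action of a matrix on the column vector represented by a row. *)
Definition mxact A x : 'rV[R]_n := (A *m x^T)^T.

Definition dilation P (t : R) : 'rV[R]_n -> 'rV[R]_n := mxact (mxpower P t).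

Definition positive_spectrum P : Prop :=
  forall z : R[i], eigenvalue (map_mx (real_complex R) P) z -> 0 < complex.Re z.

Record quasi_distance P (rho : 'rV[R]_n -> R) : Prop := {
  qd_measurable : measurable_fun [set: 'rV[R]_n] rho ;
  qd_dilation : forall t x, 0 < t -> rho (dilation P t x) = t * rho x ;
  qd_0 : rho 0 = 0 ;
  qd_sym : forall x y, rho (x - y) = rho (y - x) ;
  qd_ge0 : forall x y, 0 <= rho (x - y) ;
  qd_triangle : exists2 k : R, 1 <= k &
    forall x y z, rho (x - y) <= k * (rho (x - z) + rho (y - z)) ;
  (* dx = r^(gamma - 1) dsigma(w) dr for x = A_r w with rho w = 1 *)
  qd_polar : exists sigma : {measure set 'rV[R]_n -> \bar R},
    sigma [set w | rho w != 1] = 0%E /\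
    forall g : 'rV[R]_n -> \bar R,
      measurable_fun [set: 'rV[R]_n] g -> (forall x, 0 <= g x)%E ->
      (\int[mu]_x g x =
       \int[@lebesgue_measure R]_(r in `]0%R, +oo[)
         ((r `^ (\tr P - 1))%:E *
          \int[sigma]_(w in [set w | rho w = 1%R]) g (dilation P r w)))%E ;
  qd_outer : exists c1 c2 alpha1 alpha2 : R,
    [/\ 0 < c1, 0 < c2, 0 < alpha1, 0 < alpha2 &
      forall x, 1 <= rho x ->
        c1 * enorm x `^ alpha1 <= rho x <= c2 * enorm x `^ alpha2] ;
  qd_inner : exists c3 c4 alpha3 alpha4 : R,
    [/\ 0 < c3, 0 < c4, 0 < alpha3, 0 < alpha4 &
      forall x, rho x <= 1 ->
        c3 * enorm x `^ alpha3 <= rho x <= c4 * enorm x `^ alpha4] ;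
  qd_contract : forall (theta : R) x, 0 < theta < 1 -> rho (theta *: x) <= rho x
}.

Definition homogeneous0 P Omega : Prop :=
  forall t x, 0 < t -> Omega (dilation P t x) = Omega x.

Definition supp f : set 'rV[R]_n := closure [set x | f x != 0].

Definition Lploc (p : R) f : Prop :=
  measurable_fun [set: 'rV[R]_n] f /\
  forall K : set 'rV[R]_n, compact K -> (f \_ K) \in Lfun mu p%:E.

Section operators.
Variable T : ('rV[R]_n -> R) -> ('rV[R]_n -> R).

(* The functions on which the operator is given: L_q for 1 < q < oo, and
   compactly supported L_1. The values of T are functions, but only matter up
   to null sets in [linear_ae] and [Lq_bounded]. *)
Definition op_domain f : Prop :=
  (exists2 q : R, 1 < q & f \in Lfun mu q%:E) \/
  (f \in Lfun mu 1%E /\ compact (supp f)).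

Definition linear_ae : Prop :=
  forall (a : R) f g,
    op_domain f -> op_domain g -> op_domain (fun x => a * f x + g x) ->
    {ae mu, forall x, T (fun y => a * f y + g y) x = a * T f x + T g x}.

Definition Lq_bounded (q : R) : Prop :=
  exists C : R, forall f, f \in Lfun mu q%:E ->
    T f \in Lfun mu q%:E /\
    (Lnorm mu q%:E (EFin \o T f) <= C%:E * Lnorm mu q%:E (EFin \o f))%E.

Definition size_condition (gamma : R) (rho : 'rV[R]_n -> R) Omega : Prop :=
  exists c0 : R, forall f, f \in Lfun mu 1%E -> compact (supp f) ->
    forall x, ~ supp f x ->
      (`|T f x|%:E <=
       c0%:E * \int[mu]_y
         (`|Omega (x - y)| / rho (x - y) `^ gamma * `|f y|)%:E)%E.

End operators.

Section quasi_metric_spaces.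
Variable rho : 'rV[R]_n -> R.

Definition ellipsoid x (r : R) : set 'rV[R]_n := [set y | rho (x - y) < r].

Definition mean f (A : set 'rV[R]_n) : R :=
  (vol A)^-1 * \int[mu]_(y in A) f y.

Definition LM_norm (p : R) (phi : 'rV[R]_n -> R -> R) x0 f : \bar R :=
  ereal_sup [set ((phi x0 r)^-1 * vol (ellipsoid x0 r) `^ (- p^-1))%:E *
                 Lnorm mu p%:E (EFin \o (f \_ (ellipsoid x0 r)))
            | r in [set r : R | (0 < r)%R]]%E.

Definition LM (p : R) (phi : 'rV[R]_n -> R -> R) x0 f : Prop :=
  Lploc p f /\ (LM_norm p phi x0 f < +oo)%E.

Definition LC_norm (q lambda : R) x0 f : \bar R :=
  ereal_sup [set (((vol (ellipsoid x0 r) `^ (1 + lambda * q))^-1)%:E *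
                  \int[mu]_(y in ellipsoid x0 r)
                    (`|f y - mean f (ellipsoid x0 r)| `^ q)%:E) `^ q^-1
            | r in [set r : R | (0 < r)%R]]%E.

Definition LC (q lambda : R) x0 f : Prop :=
  Lploc q f /\ (LC_norm q lambda x0 f < +oo)%E.

(* Functions of LM need not belong to any L_q, and the data on T do not determine
   its values outside [op_domain]. There T f means the pointwise limit of
   T (f 1_{E(0,N)}), which is the usual action of a singular integral on such
   functions; [truncations_cvg] says that this limit exists almost everywhere
   and, when f is in [op_domain], that it is T f. *)
Definition truncations (T : ('rV[R]_n -> R) -> 'rV[R]_n -> R) f x : R^nat :=
  fun N => T (f \_ (ellipsoid 0 N%:R)) x.

Definition extension (T : ('rV[R]_n -> R) -> 'rV[R]_n -> R) f :
    'rV[R]_n -> R :=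
  if `[< op_domain f >] then T f else fun x => limn (truncations T f x).

Definition truncations_cvg (T : ('rV[R]_n -> R) -> 'rV[R]_n -> R) f : Prop :=
  {ae mu, forall x, truncations T f x @ \oo --> extension T f x}.

Definition commutator (T : ('rV[R]_n -> R) -> 'rV[R]_n -> R) b f :
    'rV[R]_n -> R :=
  fun x => b x * extension T f x - extension T (fun y => b y * f y) x.

End quasi_metric_spaces.

Definition essinf_tail (phi : 'rV[R]_n -> R -> R) x0 (a t : R) : \bar R :=
  ess_inf (mrestr (@lebesgue_measure R) (measurable_itv `]t, +oo[))
          (fun tau : R => (phi x0 tau * tau `^ a)%:E).

Definition morrey_weight (phi : 'rV[R]_n -> R -> R) : Prop :=
  measurable_fun ([set: 'rV[R]_n] `*` (`]0, +oo[%classic : set R))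
    (fun z : 'rV[R]_n * R => phi z.1 z.2) /\
  (forall x r, 0 < r -> 0 < phi x r).

Definition morrey_integral (phi : 'rV[R]_n -> R -> R) x0 (a c r : R) : \bar R :=
  \int[@lebesgue_measure R]_(t in `]r, +oo[)
    ((1 + ln (t / r))%:E * essinf_tail phi x0 a t * ((t `^ c)^-1)%:E)%E.

End parabolic_setting.

(* Main.v *)
(* On E = E(x0, r) write m for the mean of b over E, so that a.e.
   [b, T] f = (b - m) T f - T ((b - m) f). Let E' = E(x0, 2 k r). The part of each
   function inside E' is handled by the boundedness of T on L_p1 and L_p and by
   Hoelder's inequality; the part outside is dominated, by the size condition, by
   the potential of its absolute value with kernel |Omega(x - y)| / rho(x - y)^gamma.
   Averaging over E (Jensen's inequality in case (b), Hoelder's inequality in the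
   variable y in case (a)) and the layer cake formula bound the potential
   of h by an integral over t > r of the norms of h on E(x0, t). For h = (b - m) f
   these norms grow like 1 + ln (t / r), by telescoping the means of b, which is where
   the logarithm in the hypotheses comes from; finally the norm of f on E(x0, t)
   increases with t and hence is at most the essential infimum in the hypotheses.

   The same bounds show that the potentials are finite a.e., which gives the
   convergence of T on the truncations of f and b f.

   Since Omega is only known on the Euclidean sphere, its integrals over ellipsoids are
   compared with its norm in L_s(S^{n-1}) through a locally Lipschitz map sending
   rays to orbits of A_t; such maps increase measures by at most
   a constant factor. *)

Require Import Defs.
From HB Require Import structures.
From mathcomp Require Import all_boot all_order all_algebra.
From mathcomp Require Import all_classical all_reals all_analysis.
From mathcomp Require Import measurable_realfun ess_sup_inf.
From mathcomp.real_closed Require Import complex.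
From mathcomp Require Import ring lra.

Set Implicit Arguments.
Unset Strict Implicit.
Unset Printing Implicit Defensive.
Import Order.TTheory GRing.Theory Num.Theory.
Import numFieldNormedType.Exports.

Local Open Scope classical_set_scope.
Local Open Scope ring_scope.

(** * Lebesgue measure on row vectors *)

(** Both alternatives are instances of one estimate with a parameter [delta], which is 0 in case (a)
    and gamma / s in case (b). The potential has to be bounded both in L_p and in L_p1: (b - m) T f
    is separated by Hoelder's inequality into L_p2 and L_p1, while T ((b - m) f) is measured in L_p.
    Either bound involves only the L_p norms of h over larger ellipsoids, so one growth condition,
    [dom], serves for f and for (b - m) f.

    The measure sigma of the polar formula is abstract, and only power bounds relate [rho] to the
    Euclidean norm. The integral of a homogeneous function over a region cut out by [rho] is however
    a radial factor times an angular constant, so that finiteness on the single shell 1/2 <= rho < 1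
    is enough. The comparison with the sphere is therefore made on that shell alone.

    T is linear only almost everywhere and is not given on all of the Morrey space. Identities and
    bounds are proved for the countably many truncations and carried to the limit off one null set;
    for a function of L_q the limit must still be identified with T f. *)

Lemma eqW d (T : porderType d) (x y : T) : x = y -> (x <= y)%O.
Proof. by move=> ->. Qed.

Section ge0_le.
Local Open Scope ereal_scope.
Context d (T : measurableType d) (R : realType).
Variable mu : {measure set T -> \bar R}.

(** The integral of a nonnegative function is a supremum over the simple functions below it, hence
    monotone without any measurability. *)
Lemma ge0_le_integral_nomeas (D : set T) (f g : T -> \bar R) :
  (forall x, D x -> 0 <= f x) -> (forall x, D x -> f x <= g x) ->
  \int[mu]_(x in D) f x <= \int[mu]_(x in D) g x.
Proof.
move=> f0 fg; have g0 x : D x -> 0 <= g x.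
  by move=> Dx; apply: le_trans (fg _ Dx); exact: f0.
rewrite !ge0_integralE//; apply: ge_ereal_sup => _ [h/= hf] <-.
apply: ereal_sup_ubound; exists h => // x; apply: le_trans (hf x) _.
by rewrite lee_restrict.
Qed.

End ge0_le.

Section lebesgue_affine.
Context {R : realType}.
Implicit Types (c a r : R) (A : set R).
Local Notation mu := (@lebesgue_measure R).

Lemma measurable_affine c a :
  measurable_fun [set: measurableTypeR R]
    (fun x : measurableTypeR R => (c * x + a) : measurableTypeR R).
Proof. by apply: measurable_funD => //; exact: measurable_funM. Qed.

(** By uniqueness of Lebesgue measure it is enough to test half-open intervals; for [c < 0] the
    preimage is closed at the other end, which does not change its length. *)
Lemma lebesgue_measure_affine c a A : c != 0 -> measurable A ->
  mu A = (`|c|%:E * mu ((fun x : R => c * x + a)%R @^-1` A))%E.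
Proof.
move=> c0 mA.
have c_ge0 : 0 <= `|c| by [].
pose m : {measure set (measurableTypeR R) -> \bar R} :=
  mscale (NngNum c_ge0) (mimage mu (measurable_affine c a)).
suff mE X : ocitv X -> mu X = m X by rewrite (@lebesgue_measure_unique R m mE A mA).
move=> [[x y] _ <-].
rewrite [RHS](_ : _ = `|c|%:E *
  mu ((fun x : R => c * x + a)%R @^-1` `]x, y]%classic))%E//.
case: (ltgtP c 0) => [cn|cp|c00]; last by rewrite c00 eqxx in c0.
- rewrite (_ : _ @^-1` _ = `[(y - a) / c, (x - a) / c[%classic); last first.
    apply/seteqP; split => z /=; rewrite !in_itv/= => /andP[h1 h2]; apply/andP.
      by rewrite ler_ndivrMr// ltr_ndivlMr//; split; nra.
    by move: h1 h2; rewrite ler_ndivrMr// ltr_ndivlMr// => h1 h2; split; nra.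
  rewrite !lebesgue_measure_itv/= !lte_fin ltr_nM2r ?invr_lt0// ltrD2r.
  case: ifP => _; last by rewrite mule0.
  rewrite -!EFinD -EFinM; congr EFin; rewrite ltr0_norm//.
  by field.
- rewrite (_ : _ @^-1` _ = `](x - a) / c, (y - a) / c]%classic); last first.
    apply/seteqP; split => z /=; rewrite !in_itv/= => /andP[h1 h2]; apply/andP.
      by rewrite ler_pdivlMr// ltr_pdivrMr//; split; nra.
    by move: h1 h2; rewrite ler_pdivlMr// ltr_pdivrMr// => h1 h2; split; nra.
  rewrite !lebesgue_measure_itv/= !lte_fin ltr_pM2r ?invr_gt0// ltrD2r.
  case: ifP => _; last by rewrite mule0.
  rewrite -!EFinD -EFinM; congr EFin; rewrite gtr0_norm//.
  by field.
Qed.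

Lemma ge0_integral_affine c a (f : R -> \bar R) : c != 0 ->
  measurable_fun [set: R] f -> (forall x, 0 <= f x)%E ->
  (\int[mu]_x f x = `|c|%:E * \int[mu]_x f (c * x + a)%R)%E.
Proof.
move=> c0 mf f0; have c_ge0 : 0 <= `|c| by [].
transitivity (\int[mscale (NngNum c_ge0) (mimage mu (measurable_affine c a))]_x
    f x)%E.
  apply: eq_measure_integral => A mA _.
  exact: (lebesgue_measure_affine a c0 mA).
rewrite ge0_integral_mscale//=; congr (_ * _)%E.
by rewrite (@ge0_integral_pushforward _ _ _ _ R _ (measurable_affine c a))// preimage_setT.
Qed.

End lebesgue_affine.

Section lebesgue_rV_theory.
Context {R : realType}.
Local Notation leb := (@lebesgue_measure R).

Definition tuple_affine n (c : R) (a : 'I_n -> R) (t : n.-tuple R) :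
    n.-tuple R := [tuple c * tnth t i + a i | i < n].

Lemma tuple_affine_tcons n c (a : 'I_n.+1 -> R) (z : R * n.-tuple R) :
  tuple_affine c a (tcons z) =
  tcons (c * z.1 + a ord0, tuple_affine c (fun i => a (lift ord0 i)) z.2).
Proof.
apply: eq_from_tnth => i; rewrite tnth_mktuple.
case: (unliftP ord0 i) => [j|] ->; last by rewrite !tnth0.
by rewrite !tnthS tnth_mktuple.
Qed.

(** Induction on the dimension: the sections are handled by the induction hypothesis, the first
    coordinate by the one-dimensional formula. The only maps needed later are translations and
    reflections, hence [|c| = 1]. *)
Lemma lebesgue_tuple_affine n c (a : 'I_n -> R) (A : set (n.-tuple R)) :
  `|c| = 1 -> measurable A ->
  lebesgue_tuple n (tuple_affine c a @^-1` A) = lebesgue_tuple n A.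
Proof.
move=> c1; elim: n a A => [|n IH] a A mA.
  congr (lebesgue_tuple 0 _); apply/seteqP; split => t /=.
    by rewrite (tuple0 (tuple_affine c a t)) (tuple0 t).
  by rewrite (tuple0 (tuple_affine c a t)) (tuple0 t).
have c0 : c != 0 by rewrite -normr_eq0 c1 oner_eq0.
pose B := @tcons R n @^-1` A.
have mB : measurable B.
  by rewrite -[B]setTI; exact: measurable_tcons.
transitivity (\int[leb]_x (lebesgue_tuple n (xsection B (c * x + a ord0)%R)))%E.
  transitivity (\int[leb]_x (lebesgue_tuple n
      (xsection (@tcons R n @^-1` (tuple_affine c a @^-1` A)) x)))%E => //.
  apply: eq_integral => x _.
  rewrite -[RHS](IH (fun i => a (lift ord0 i))); last exact: measurable_xsection.
  congr (lebesgue_tuple n _).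
  rewrite /xsection/=; apply/seteqP; split => t /=; rewrite !inE/= tuple_affine_tcons//.
transitivity (\int[leb]_x (lebesgue_tuple n (xsection B x)))%E => //.
rewrite [RHS](ge0_integral_affine (a ord0) c0) ?c1 ?mul1e//.
exact: measurable_fun_xsection.
Qed.

Lemma lebesgue_tuple_cube n (a : 'I_n -> R) (e : R) : 0 < e ->
  lebesgue_tuple n [set t | forall i, `|a i - tnth t i| < e] = ((2 * e) ^+ n)%:E.
Proof.
move=> e0; elim: n a => [|n IH] a.
  rewrite /= diracE mem_set ?expr0//=; by case.
rewrite [LHS](_ : _ = (leb \x lebesgue_tuple n)%E
    (ball (a ord0) e `*` [set t | forall i, `|a (lift ord0 i) - tnth t i| < e])); last first.
  rewrite [LHS](_ : _ = (leb \x lebesgue_tuple n)%E (@tcons R n @^-1`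
     [set t | forall i, `|a i - tnth t i| < e]))//.
  congr ((_ \x _)%E _); apply/seteqP; split => [[x t]/= h|[x t]/= [h1 h2] i].
    split; first by have := h ord0; rewrite tnth0.
    by move=> i; have := h (lift ord0 i); rewrite tnthS.
  by case: (unliftP ord0 i) => [j|] ->; rewrite ?tnth0 ?tnthS.
rewrite product_measure1E//=; [|exact: measurable_ball|].
  by rewrite IH lebesgue_measure_ball ?ltW// -EFinM exprS mulr_natl.
rewrite (_ : mkset _ = \bigcap_(i in [set: 'I_n]) 
   ((@tnth n R)^~ i @^-1` ball (a (lift ord0 i)) e)); last first.
  by apply/seteqP; split => t /= h i; [move=> _; exact: h|exact: (h i)].
apply: fin_bigcap_measurable => // i _.
rewrite -[X in measurable X]setTI; apply: measurable_tnth => //.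
exact: measurable_ball.
Qed.

Lemma ex_natSinv_lt (e : R) : 0 < e -> exists m : nat, m.+1%:R^-1 < e.
Proof.
move=> e0; exists (Num.truncn e^-1).
by rewrite invf_plt ?posrE//; exact: truncnS_gt.
Qed.

Variable n : nat.
Local Notation mu := (@lebesgue_rV R n).
Implicit Types (x y a : 'rV[R]_n) (A U F : set 'rV[R]_n).

Lemma rV_ballE x e : 0 < e ->
  ball x e = [set y : 'rV[R]_n | forall i, `|x ord0 i - y ord0 i| < e].
Proof.
move=> e0; apply/seteqP; split => y /=.
  by move=> [_ h] i; apply: h.
by move=> h; split=> // i j; rewrite (ord1 i); exact: h.
Qed.

Lemma measurable_rV_ball x e : measurable (ball x e).
Proof.
have [e0|e0] := ltP 0 e; last first.
  rewrite (_ : ball x e = set0)//; apply/seteqP; split => // y [].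
  by move=> /lt_le_trans/(_ e0); rewrite ltxx.
rewrite rV_ballE// (_ : mkset _ = \bigcap_(i in [set: 'I_n])
   ((fun y : 'rV[R]_n => y ord0 i) @^-1` ball (x ord0 i) e)); last first.
  by apply/seteqP; split => t /= h i; [move=> _; exact: h|exact: (h i)].
apply: fin_bigcap_measurable => // i _.
rewrite -[X in measurable X]setTI; apply: measurable_coord => //.
exact: measurable_ball.
Qed.

Lemma lebesgue_rV_ball x e : 0 < e -> mu (ball x e) = ((2 * e) ^+ n)%:E.
Proof.
move=> e0; rewrite rV_ballE// /lebesgue_rV /mimage /pushforward.
rewrite -(@lebesgue_tuple_cube n (fun i => x ord0 i) _ e0).
congr (lebesgue_tuple n _); apply/seteqP; split => t /= h i; have := h i;
  by rewrite mxE.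
Qed.

Lemma measurable_rV_affine c a :
  measurable_fun [set: 'rV[R]_n] (fun x : 'rV[R]_n => c *: x + a).
Proof.
apply: measurable_rVP => i.
rewrite (_ : (fun _ => _) = fun x : 'rV[R]_n => c * x ord0 i + a ord0 i); last first.
  by apply/funext => x; rewrite !mxE.
apply: measurable_funD => //; apply: measurable_funM => //.
exact: measurable_coord.
Qed.

Lemma lebesgue_rV_affine c a A : `|c| = 1 -> measurable A ->
  mu ((fun x : 'rV[R]_n => c *: x + a) @^-1` A) = mu A.
Proof.
move=> c1 mA; rewrite /lebesgue_rV /mimage /pushforward.
rewrite -[RHS](lebesgue_tuple_affine (fun i => a ord0 i) c1); last first.
  by rewrite -[X in measurable X]setTI; exact: measurable_tuple_row.
congr (lebesgue_tuple n _).
have E t : tuple_row (tuple_affine c (fun i => a ord0 i) t) =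
    c *: tuple_row t + a by apply/rowP => i; rewrite !mxE tnth_mktuple.
by apply/seteqP; split => t /=; rewrite E.
Qed.

Lemma ge0_integral_rV_affine c a (f : 'rV[R]_n -> \bar R) : `|c| = 1 ->
  measurable_fun [set: 'rV[R]_n] f -> (forall x, 0 <= f x)%E ->
  (\int[mu]_x f x = \int[mu]_x f (c *: x + a)%R)%E.
Proof.
move=> c1 mf f0.
transitivity (\int[mimage mu (measurable_rV_affine c a)]_x f x)%E.
  by apply: eq_measure_integral => A mA _; apply: esym; exact: lebesgue_rV_affine.
by rewrite (@ge0_integral_pushforward _ _ _ _ R _ (measurable_rV_affine c a))//.
Qed.

(** The cubes with rational centre and radius 1/(m + 1) form a countable base: with 1/(m + 1) < e /
    2, such a cube containing x lies in the cube of radius e around x. *)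
Lemma open_measurable_rV U : open U -> measurable U.
Proof.
move=> oU.
pose q2r (q : 'rV[rat]_n) : 'rV[R]_n := map_mx ratr q.
pose B (k : 'rV[rat]_n * nat) := ball (q2r k.1) (k.2.+1%:R^-1).
rewrite (_ : U = \bigcup_(k in [set k | B k `<=` U]) B k); last first.
  apply/seteqP; split => [x Ux|x [k /= ]]; last by move=> + ?; exact.
  have /nbhs_ballP[e /= e0 eU] : nbhs x U by exact: open_nbhs_nbhs.
  have [m me] := ex_natSinv_lt (divr_gt0 e0 (ltr0Sn R 1)).
  have rq i : {q : rat | `|ratr q - x ord0 i| < m.+1%:R^-1}.
    apply: cid; have : x ord0 i - m.+1%:R^-1 < x ord0 i + m.+1%:R^-1.
      by rewrite ltrBlDr -addrA ltrDl addr_gt0 ?invr_gt0.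
    by move=> /rat_in_itvoo[q]; rewrite in_itv/= => qx; exists q; rewrite ltr_distl.
  have xB : B (\row_i sval (rq i), m) x.
    rewrite /B rV_ballE ?invr_gt0//= => i; rewrite !mxE.
    by case: (rq i).
  exists (\row_i sval (rq i), m) => //=.
  move=> y By; apply: eU; rewrite rV_ballE// => i.
  move: xB By; rewrite /B rV_ballE ?invr_gt0//= => /(_ i) h1 /(_ i) h2.
  rewrite (le_lt_trans (ler_distD (q2r (\row_i sval (rq i)) ord0 i) _ _))//.
  rewrite [e]splitr ltrD//; last by apply: lt_trans me.
  by rewrite distrC; apply: lt_trans me.
rewrite bigcup_mkcond; apply: countable_bigcupT_measurable => [|k].
  exact: countableP.
case: ifP => _; last exact: measurable0.
exact: measurable_rV_ball.
Qed.

Lemma closed_measurable_rV F : closed F -> measurable F.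
Proof.
by move=> cF; rewrite -[F]setCK; apply: measurableC; apply: open_measurable_rV; exact: closed_openC.
Qed.

End lebesgue_rV_theory.

(** * Approximation of Borel sets by closed sets, for finite measures *)

Section regularity.
Context {R : realType} (n : nat).
Implicit Types (A U F : set 'rV[R]_n).

Lemma closed_inner_ball U (e : R) : closed [set x | ball x e `<=` U].
Proof.
rewrite -openC (_ : ~` _ = \bigcup_(y in ~` U) ball y e); last first.
  apply/seteqP; split => [x /= /existsNP[y /not_implyP[xy Uy]]|x [y /= Uy yx]].
    by exists y => //; exact: ball_sym.
  by move=> /(_ y (ball_sym yx)).
apply: bigcup_open => y _; have [e0|e0] := ltP 0 e; first exact: ball_open.
rewrite (_ : ball y e = set0); first exact: open0.
by apply/seteqP; split => // z [/lt_le_trans/(_ e0)]; rewrite ltxx.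
Qed.

Variable m : {finite_measure set 'rV[R]_n -> \bar R}.

(** Approximation from inside and from outside at once is a condition stable under complements, so
    it passes from generators to the whole sigma-algebra. *)
Let approx A := measurable A /\ forall e : R, 0 < e ->
  exists F U, [/\ closed F, open U, F `<=` A, A `<=` U & (m (U `\` F) <= e%:E)%E].

Let m_fin A : measurable A -> (m A < +oo)%E.
Proof.
move=> mA; apply: (@le_lt_trans _ _ (m setT)); last exact: fin_num_fun_lty.
by apply: le_measure; rewrite ?inE.
Qed.

(** An open set is exhausted by the closed sets of points whose cube of radius 1/(k + 1) stays
    inside; continuity from above, for a finite measure, makes the remainder small. *)
Let approx_open U : open U -> approx U.
Proof.
move=> oU; split; first exact: open_measurable_rV.
move=> e e0; pose F k := [set x : 'rV[R]_n | ball x k.+1%:R^-1 `<=` U].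
have cF k : closed (F k) by exact: closed_inner_ball.
have FU k : F k `<=` U.
  by move=> x; apply; apply: ballxx; rewrite invr_gt0.
have ndF k l : (k <= l)%N -> F k `<=` F l.
  move=> kl x Fx y xy; apply: Fx; apply: le_ball xy.
  by rewrite lef_pV2 ?posrE// ler_nat.
have UF : \bigcap_k (U `\` F k) = set0.
  apply/seteqP; split => // x UFx.
  have [Ux _] := UFx 0%N I.
  have /nbhs_ballP[d /= d0 dU] : nbhs x U by exact: open_nbhs_nbhs.
  have [k kd] := ex_natSinv_lt d0.
  have [_ ] := UFx k I; apply => y xy; apply: dU; apply: le_ball xy; exact: ltW.
have mUF k : measurable (U `\` F k).
  by apply: measurableD; [exact: open_measurable_rV|exact: closed_measurable_rV].
have : (m \o (fun k => U `\` F k)) x @[x --> \oo] --> m (\bigcap_k (U `\` F k)).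
  apply: nonincreasing_cvg_mu => //.
  - exact: m_fin.
  - by rewrite UF.
  - move=> k l kl; apply/subsetPset => x [Ux Fx]; split => //.
    by apply: contra_not Fx; exact: ndF.
rewrite UF measure0 => /fine_cvgP[ufin].
move=> /cvgrPdist_le/(_ _ e0) [N _ /(_ N (leqnn _))/=].
rewrite sub0r normrN => he.
exists (F N), U; split => //.
rewrite -[leLHS]fineK ?lee_fin; last by rewrite ge0_fin_numE// m_fin.
by apply: le_trans he; exact: ler_norm.
Qed.

Let approxC A : approx A -> approx (~` A).
Proof.
move=> [mA hA]; split; first exact: measurableC.
move=> e /hA[F [U [cF oU FA AU FUe]]]; exists (~` U), (~` F); split.
- exact: open_closedC.
- exact: closed_openC.
- exact: subsetC.
- exact: subsetC.
- by rewrite setDE setCK setIC -setDE.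
Qed.

(** Half of [e] is distributed geometrically over the sets [A k]. The other half pays for keeping
    only finitely many of the inner sets, because a countable union of closed sets need not be
    closed. *)
Let approx_bigcup (A : (set 'rV[R]_n)^nat) :
  (forall k, approx (A k)) -> approx (\bigcup_k A k).
Proof.
move=> hA; split; first by apply: bigcup_measurable => k _; case: (hA k).
move=> e e0.
have e2 k : 0 < e / 2 / (2 ^ k.+1)%:R.
  by rewrite !divr_gt0// ltr0n expn_gt0.
have /choice[FU hFU] : forall k, exists FU : set 'rV[R]_n * set 'rV[R]_n,
    [/\ closed FU.1, open FU.2, FU.1 `<=` A k, A k `<=` FU.2 &
     (m (FU.2 `\` FU.1) <= (e / 2 / (2 ^ k.+1)%:R)%:E)%E].
  by move=> k; have [F [U ?]] := (hA k).2 _ (e2 k); exists (F, U).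
pose U := \bigcup_k (FU k).2.
pose F N := \bigcup_(k in `I_N) (FU k).1.
have oU : open U by apply: bigcup_open => k _; have [] := hFU k.
have mU := open_measurable_rV oU.
have cF N : closed (F N).
  by apply: closed_bigcup => // k _; have [] := hFU k.
have mF N := closed_measurable_rV (cF N).
have mFk k : measurable (FU k).1.
  by apply: closed_measurable_rV; have [] := hFU k.
have mUk k : measurable (FU k).2.
  by apply: open_measurable_rV; have [] := hFU k.
have cvgm : (m \o (fun k => U `\` F k)) x @[x --> \oo] -->
    m (\bigcap_k (U `\` F k)).
  apply: nonincreasing_cvg_mu => //.
  - by apply: m_fin; exact: measurableD.
  - by move=> k; exact: measurableD.
  - by apply: bigcapT_measurable => k; exact: measurableD.
  - move=> k l kl; apply/subsetPset => x [Ux Fx]; split => //.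
    apply: contra_not Fx => -[i /= ik Fi]; exists i => //=.
    exact: leq_trans kl.
have mcap : (m (\bigcap_k (U `\` F k)) <= (e / 2)%:E)%E.
  apply: (@le_trans _ _ (\sum_(k <oo) m ((FU k).2 `\` (FU k).1))%E).
    apply: measure_sigma_subadditive.
    - by move=> k; exact: measurableD.
    - by apply: bigcapT_measurable => k; exact: measurableD.
    move=> x Hx; have [[k _ Ukx] _] := Hx 0%N I; exists k => //; split => // Fkx.
    by have [_ ] := Hx k.+1 I; apply; exists k => /=.
  apply: le_trans (epsilon_trick0 xpredT _); last by rewrite ltW// divr_gt0.
  by apply: lee_nneseries => // k _; have [] := hFU k.
have mcapf : m (\bigcap_k (U `\` F k)) \is a fin_num.
  by rewrite ge0_fin_numE// (le_lt_trans mcap)// ltry.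
move: cvgm; rewrite -[X in _ --> X]fineK// => /fine_cvgP[_].
have e20 : 0 < e / 2 by rewrite divr_gt0.
move=> /cvgrPdist_le/(_ _ e20) [N _ /(_ N (leqnn _))/= he].
exists (F N), U; split => //.
- by move=> x [k _ Fk]; exists k => //; have [_ _ + _ _] := hFU k; exact.
- by move=> x [k _ Fk]; exists k => //; have [_ _ _ + _] := hFU k; exact.
have mfin : m (U `\` F N) \is a fin_num.
  by rewrite ge0_fin_numE// m_fin//; exact: measurableD.
rewrite -(fineK mfin) lee_fin [e]splitr.
move: he; rewrite ler_distlC => /andP[_ /le_trans]; apply.
by rewrite lerD2r -lee_fin fineK.
Qed.

Let approx_coord (i : 'I_n) (Y : set R) : measurable Y ->
  approx ((fun x : 'rV[R]_n => x ord0 i) @^-1` Y).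
Proof.
suff : measurable `<=` [set Y : set R | approx ((fun x : 'rV[R]_n => x ord0 i) @^-1` Y)].
  by move=> H; exact: H.
rewrite [measurable](@RGenOpens.measurableE R).
apply: smallest_sub => [|_ [x [y ->]] /=].
  split => /=.
  - by rewrite preimage_set0; apply: approx_open; exact: open0.
  - by move=> A; rewrite setTD preimage_setC; exact: approxC.
  - by move=> F hF; rewrite preimage_bigcup; exact: approx_bigcup.
apply: approx_open; apply: open_comp; last exact: itv_open.
by move=> z _; exact: coord_continuous.
Qed.

Lemma closed_approx A (e : R) : measurable A -> 0 < e ->
  exists F, [/\ closed F, F `<=` A & (m (A `\` F) <= e%:E)%E].
Proof.
move=> mA e0; suff : approx A.
  move=> [_ /(_ _ e0)[F [U [cF oU FA AU mUF]]]]; exists F; split => //.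
  apply: le_trans mUF; apply: le_measure; rewrite ?inE.
  - by apply: measurableD => //; exact: closed_measurable_rV.
  - by apply: measurableD; [exact: open_measurable_rV|exact: closed_measurable_rV].
  - by move=> x [Ax Fx]; split => //; exact: AU.
move: A mA; apply: smallest_sub.
  split => /=.
  - by apply: approx_open; exact: open0.
  - by move=> A; rewrite setTD; exact: approxC.
  - by move=> F hF; exact: approx_bigcup.
rewrite -bigcup_seq; apply: bigcup_sub => i _ _ [B mB <-] /=.
by rewrite setTI; exact: approx_coord.
Qed.

End regularity.

(** * Lipschitz images *)

Section lipschitz_image.
Context {R : realType} (n : nat).
Local Notation mu := (@lebesgue_rV R n).
Variables (Phi : 'rV[R]_n -> 'rV[R]_n) (K K' : set 'rV[R]_n) (L d : R).
Hypotheses (mPhi : measurable_fun [set: 'rV[R]_n] Phi) (mK' : measurable K').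
Hypotheses (K'fin : (mu K' < +oo)%E) (L0 : 0 < L) (d0 : 0 < d).
Hypothesis KK' : forall x, K x -> ball x d `<=` K'.
Hypothesis PhiL : forall x e z, K x -> 0 < e <= d -> ball x e z ->
  ball (Phi x) (L * e) (Phi z).

Let measurable_near (r : R) :
  measurable [set u : 'rV[R]_n * 'rV[R]_n | ball u.1 r (Phi u.2)].
Proof.
have [r0|r0] := ltP 0 r; last first.
  rewrite (_ : mkset _ = set0)//; apply/seteqP; split => // u [].
  by move=> /lt_le_trans/(_ r0); rewrite ltxx.
rewrite (_ : mkset _ = \bigcap_(i in [set: 'I_n])
   ((fun u : 'rV[R]_n * 'rV[R]_n => u.1 ord0 i - Phi u.2 ord0 i) @^-1` ball 0 r)); last first.
  apply/seteqP; split => u /=; rewrite rV_ballE//= => h i.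
    by move=> _; rewrite /ball/= sub0r normrN; exact: h.
  by have := h i I; rewrite /ball/= sub0r normrN.
apply: fin_bigcap_measurable => // i _.
rewrite -[X in measurable X]setTI.
apply: measurable_funB; [| |exact: measurableT|exact: measurable_ball].
  exact: measurableT_comp (measurable_coord i) measurable_fst.
apply: measurableT_comp (measurable_coord i) _.
exact: measurableT_comp mPhi measurable_snd.
Qed.

Let near_set (B : set 'rV[R]_n) r := \bigcup_(y in B) ball y r.

Let open_near_set B r : 0 < r -> open (near_set B r).
Proof. by move=> r0; apply: bigcup_open => y _; exact: ball_open. Qed.

Let mPhi_pre (U : set 'rV[R]_n) : measurable U -> measurable (K' `&` Phi @^-1` U).
Proof.
by move=> mU; apply: measurableI => //; rewrite -[X in measurable X]setTI; exact: mPhi.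
Qed.

(* Tonelli's theorem for the pairs (y, z) with y in B and Phi z close to y: for fixed
   y = Phi x these z fill the cube of side 2 e around x, for fixed z these y lie in a
   cube of side 2 L e *)
Let near_image_le (B : set 'rV[R]_n) e : measurable B -> B `<=` Phi @` K ->
  0 < e <= d -> (mu B <= (L ^+ n)%:E *
     mu (K' `&` Phi @^-1` near_set B (L * e)))%E.
Proof.
move=> mB BPhi /andP[e0 ed]; have Le0 : 0 < L * e by rewrite mulr_gt0.
pose D := (B `*` K') `&`
  [set u : 'rV[R]_n * 'rV[R]_n | ball u.1 (L * e) (Phi u.2)].
have mD : measurable D by apply: measurableI => //; exact: measurableX.
have mN : measurable (K' `&` Phi @^-1` near_set B (L * e)).
  by apply: mPhi_pre; apply: open_measurable_rV; exact: open_near_set.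
have e2 : (0 < (2 * e) ^+ n)%R by rewrite exprn_gt0// mulr_gt0.
have key : (((2 * e) ^+ n)%:E * mu B <=
    ((2 * (L * e)) ^+ n)%:E * mu (K' `&` Phi @^-1` near_set B (L * e)))%E.
  apply: (@le_trans _ _ (\int[mu]_y mu (xsection D y))%E).
    rewrite -(integral_cst _ mB) [leLHS]integral_mkcond.
    apply: ge0_le_integral_nomeas => y _.
      by rewrite patchE; case: ifPn => // _; rewrite lee_fin ltW.
    rewrite patchE; case: ifPn => [/set_mem By|_]; last exact: measure_ge0.
    have [x Kx xy] := BPhi _ By.
    rewrite /= -(lebesgue_rV_ball x e0); apply: le_measure; rewrite ?inE.
    - exact: measurable_rV_ball.
    - exact: measurable_xsection.
    move=> z xz; rewrite /xsection/= inE; split => /=.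
      split => //=; apply: (KK' Kx); apply: le_ball xz; exact: ed.
    by rewrite -xy; apply: PhiL => //; rewrite e0 ed.
  have -> : (\int[mu]_y mu (xsection D y) = \int[mu]_z mu (ysection D z))%E.
    have := @indic_fubini_tonelli _ _ _ _ R mu mu D mD.
    by rewrite (indic_fubini_tonelli_FE mu mD) (indic_fubini_tonelli_GE mu mD).
  rewrite -(integral_cst _ mN) [leRHS]integral_mkcond.
  apply: ge0_le_integral_nomeas => // z _.
  rewrite patchE; case: ifPn => [_|/negP/[!inE] Kz].
    rewrite -(lebesgue_rV_ball (Phi z) Le0); apply: le_measure; rewrite ?inE.
    - exact: measurable_ysection.
    - exact: measurable_rV_ball.
    by move=> y; rewrite /ysection/= inE => -[_ /=]; exact: ball_sym.
  rewrite (_ : ysection D z = set0) ?measure0//.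
  apply/seteqP; split => // y; rewrite /ysection/= inE => -[[/= By K'z] yz].
  by apply: Kz; split => //; exists y.
move: key; rewrite (_ : ((2 * (L * e)) ^+ n = (2 * e) ^+ n * L ^+ n)%R).
  by rewrite EFinM -muleA lee_pmul2l.
by rewrite -exprMn; congr (_ ^+ n); ring.
Qed.

(** As e tends to 0 the neighbourhoods of a closed [B] decrease to [B]; since [K'] has finite
    measure, the preceding bound passes to the limit. *)
Let closed_image_le (B : set 'rV[R]_n) : closed B -> B `<=` Phi @` K ->
  (mu B <= (L ^+ n)%:E * mu (K' `&` Phi @^-1` B))%E.
Proof.
move=> cB BPhi; have mB := closed_measurable_rV cB.
pose e k := d / k.+1%:R.
have e0 k : 0 < e k by rewrite divr_gt0.
have ed k : e k <= d by rewrite ler_pdivrMr// ler_peMr ?ler1n// ltW.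
pose G k := K' `&` Phi @^-1` near_set B (L * e k).
have mG k : measurable (G k).
  apply: mPhi_pre; apply: open_measurable_rV; apply: open_near_set.
  by rewrite mulr_gt0.
have capG : \bigcap_k G k = K' `&` Phi @^-1` B.
  apply/seteqP; split => [z Gz|z [K'z Bz] k _]; last first.
    by split => //; exists (Phi z) => //; apply: ballxx; rewrite mulr_gt0.
  split; first by have [] := Gz 0%N I.
  apply: cB => V /nbhs_ballP[r /= r0 rV].
  have [k kr] := ex_natSinv_lt (divr_gt0 r0 (mulr_gt0 L0 d0)).
  have [_ [y By yz]] := Gz k I; exists y; split => //; apply: rV.
  apply: ball_sym; apply: le_ball yz.
  move: kr; rewrite ltr_pdivlMr ?mulr_gt0// => /ltW; apply: le_trans.
  by rewrite /e; apply: eqW; ring.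
have : (mu \o G) x @[x --> \oo] --> mu (\bigcap_k G k).
  apply: nonincreasing_cvg_mu => //.
  - apply: le_lt_trans K'fin; apply: le_measure; rewrite ?inE//.
    by apply: subIsetl.
  - by apply: bigcapT_measurable.
  - move=> k l kl; apply/subsetPset => z [K'z [y By yz]]; split => //.
    exists y => //; apply: le_ball yz; rewrite ler_pM2l// /e ler_pM2l//.
    by rewrite lef_pV2 ?posrE// ler_nat.
rewrite capG => cvgG.
have Ln : (L ^+ n)%:E \is a fin_num by [].
have := cvgeZl Ln cvgG.
move=> /cvg_lim <- //; apply: lime_ge.
  by apply/cvg_ex; eexists; exact: (cvgeZl Ln cvgG).
apply: nearW => k /=; apply: near_image_le => //.
by rewrite e0 ed.
Qed.

(** Inner regularity, applied to Lebesgue measure restricted to [B], reduces the claim to closed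
    sets. The image of [K] is not known to be measurable, hence the formulation with measurable
    subsets [B] of it; [K'] leaves room for the cubes around the points of [K]. *)
Lemma lipschitz_image_le (B : set 'rV[R]_n) : measurable B ->
  (mu B < +oo)%E -> B `<=` Phi @` K ->
  (mu B <= (L ^+ n)%:E * mu (K' `&` Phi @^-1` B))%E.
Proof.
move=> mB Bfin BPhi.
apply/lee_addgt0Pr => e e0.
have [F [cF FB mF]] := closed_approx (mfrestr mB Bfin) mB e0.
have mcF := closed_measurable_rV cF.
rewrite -[X in mu X](setDUK FB) measureU//; [|exact: measurableD|]; last first.
  by apply/seteqP; split => // x [? []].
rewrite leeD//; last first.
  have /setIidl <- : B `\` F `<=` B by exact: subDsetl.
  exact: mF.
have FPhi : F `<=` Phi @` K by move=> x /FB /BPhi.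
apply: le_trans (closed_image_le cF FPhi) _.
apply: lee_wpmul2l; first by rewrite lee_fin exprn_ge0// ltW.
apply: le_measure; rewrite ?inE.
- exact: mPhi_pre.
- exact: mPhi_pre.
- by move=> x [? ?]; split => //; exact: FB.
Qed.

End lipschitz_image.

(** * The matrix exponential *)

Section expmx.
Context {R : realType} (n : nat).
Variable P : 'M[R]_n.

Lemma cvg_mxP m1 m2 (u : nat -> 'M[R]_(m1, m2)) (l : 'M[R]_(m1, m2)) :
  (forall i j, (fun k => u k i j) @ \oo --> l i j) -> u @ \oo --> l.
Proof.
move=> ul; apply/cvg_ballP => e e0.
suff : \forall k \near \oo, forall ij : 'I_m1 * 'I_m2,
    `|l ij.1 ij.2 - u k ij.1 ij.2| < e.
  by apply: filterS => k h; split => // i j; exact: (h (i, j)).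
by apply: filter_forall => -[i j] /=; move/cvgrPdist_lt: (ul i j); exact.
Qed.

(** A crude matrix norm: the entries of [P ^+ k] are at most [a ^+ k], so every entry of the
    exponential series is dominated by the scalar series for [|u| * a]. *)
Let a : R := \sum_i \sum_j `|P i j|.

Let a_ge0 : 0 <= a.
Proof. by apply: sumr_ge0 => i _; apply: sumr_ge0. Qed.

Let mxpow_bound k i j : `|(P ^+ k) i j| <= a ^+ k.
Proof.
elim: k i j => [|k IH] i j.
  by rewrite !expr0 mxE; case: eqP => _; rewrite ?normr1 ?normr0.
rewrite exprS mxE; apply: (le_trans (ler_norm_sum _ _ _)).
apply: (@le_trans _ _ (\sum_l `|P i l| * a ^+ k)).
  by apply: ler_sum => l _; rewrite normrM ler_wpM2l.
rewrite -mulr_suml exprS ler_wpM2r ?exprn_ge0//.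
rewrite /a [leRHS](bigD1 i)//= lerDl; apply: sumr_ge0 => l _.
exact: sumr_ge0.
Qed.

Let mxpowZ (u : R) k : (u *: P) ^+ k = u ^+ k *: P ^+ k.
Proof.
elim: k => [|k IH]; first by rewrite !expr0 scale1r.
rewrite [LHS]exprS IH [u ^+ k.+1]exprS [P ^+ k.+1]exprS.
by rewrite -[LHS]/(_ *m _) -scalemxAl -scalemxAr scalerA.
Qed.

Let term u i j (k : nat) : R := k`!%:R^-1 * (u ^+ k * (P ^+ k) i j).

Let expmx_series u i j :
  (fun N => series (fun k => k`!%:R^-1 *: (u *: P) ^+ k) N i j) =
  series (term u i j).
Proof.
apply/funext => N; rewrite /series/= summxE; apply: eq_bigr => k _.
by rewrite /term mxpowZ !mxE.
Qed.

Let is_cvg_term u i j : cvgn (series (term u i j)).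
Proof.
apply: normed_cvg; rewrite /=.
apply: (@series_le_cvg _ _ (exp_coeff (`|u| * a))).
- by move=> k /=.
- by move=> k; rewrite exp_coeff_ge0// mulr_ge0.
- move=> k; rewrite /term exp_coeffE/= normrM ger0_norm ?invr_ge0//.
  rewrite ler_wpM2l ?invr_ge0// exprMn normrM normrX.
  by rewrite ler_wpM2l ?exprn_ge0.
- exact: is_cvg_series_exp_coeff.
Qed.

Lemma expmxE u i j : expmx (u *: P) i j = limn (series (term u i j)).
Proof.
rewrite /expmx; set v := series _.
have : v @ \oo --> (\matrix_(i, j) limn (series (term u i j)) : 'M[R]_n).
  by apply: cvg_mxP => k l; rewrite mxE expmx_series; exact: is_cvg_term.
by move=> /(cvg_lim (@norm_hausdorff _ _)) ->; rewrite mxE.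
Qed.

Let exprB_bound (U u v : R) k : `|u| <= U -> `|v| <= U ->
  `|u ^+ k.+1 - v ^+ k.+1| <= k.+1%:R * U ^+ k * `|u - v|.
Proof.
move=> uU vU; have U0 : 0 <= U by exact: le_trans uU.
elim: k => [|k IH]; first by rewrite !expr1 expr0 !mul1r.
have -> : u ^+ k.+2 - v ^+ k.+2 =
    u * (u ^+ k.+1 - v ^+ k.+1) + (u - v) * v ^+ k.+1.
  by rewrite [u ^+ k.+2]exprS [v ^+ k.+2]exprS; ring.
apply: (le_trans (ler_normD _ _)); rewrite !normrM.
apply: (@le_trans _ _ (U * (k.+1%:R * U ^+ k * `|u - v|) + `|u - v| * U ^+ k.+1)).
  apply: lerD; first by apply: ler_pM.
  by rewrite ler_wpM2l// normrX lerXn2r// nnegrE.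
apply: eqW.
by rewrite exprS -[k.+2]addn1 natrD; ring.
Qed.

(** The factor k + 1 in the difference of the powers cancels against the factorial, and what remains
    is the exponential series at [U * a] shifted by one index. *)
Let term_lip (U u v : R) i j N : `|u| <= U -> `|v| <= U ->
  `|series (term u i j) N - series (term v i j) N| <= a * expR (U * a) * `|u - v|.
Proof.
move=> uU vU; have U0 : 0 <= U by exact: le_trans uU.
have -> : series (term u i j) N - series (term v i j) N =
    \sum_(0 <= k < N) k`!%:R^-1 * ((u ^+ k - v ^+ k) * (P ^+ k) i j).
  by rewrite /series/= -sumrB; apply: eq_bigr => k _; rewrite /term; ring.
case: N => [|N]; first by rewrite big_nil normr0 mulr_ge0// mulr_ge0// expR_ge0.
rewrite big_nat_recl// !expr0 subrr mul0r mulr0 add0r.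
apply: (le_trans (ler_norm_sum _ _ _)).
apply: (@le_trans _ _ (\sum_(0 <= k < N) a * `|u - v| * exp_coeff (U * a) k)).
  apply: ler_sum => k _; rewrite exp_coeffE/= !normrM ger0_norm ?invr_ge0//.
  apply: (@le_trans _ _ ((k.+1)`!%:R^-1 * ((k.+1%:R * U ^+ k * `|u - v|) * a ^+ k.+1))).
    rewrite ler_wpM2l ?invr_ge0// ler_pM//; exact: exprB_bound.
  apply: eqW.
  rewrite factS natrM exprMn exprS.
  have k0 : k`!%:R != 0 :> R by rewrite pnatr_eq0 -lt0n fact_gt0.
  by field; rewrite k0 /= nat1r pnatr_eq0.
rewrite -mulr_sumr mulrAC ler_wpM2r// ler_wpM2l//.
rewrite /expR; apply: nondecreasing_cvgn_le; last exact: is_cvg_series_exp_coeff.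
move=> k l kl; apply: nondecreasing_series => // m _ _.
by rewrite exp_coeff_ge0// mulr_ge0.
Qed.

Lemma expmx_lipschitz (U : R) : 0 <= U -> exists2 L, 0 < L &
  (forall u v i j, `|u| <= U -> `|v| <= U ->
    `|expmx (u *: P) i j - expmx (v *: P) i j| <= L * `|u - v|) /\
  (forall u i j, `|u| <= U -> `|expmx (u *: P) i j| <= L).
Proof.
move=> U0.
have lip u v i j : `|u| <= U -> `|v| <= U ->
    `|expmx (u *: P) i j - expmx (v *: P) i j| <= a * expR (U * a) * `|u - v|.
  move=> uU vU; rewrite !expmxE.
  have cvgd : (fun N => `|series (term u i j) N - series (term v i j) N|) @ \oo -->
      `|limn (series (term u i j)) - limn (series (term v i j))|.
    by apply: cvg_norm; apply: cvgB; exact: is_cvg_term.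
  rewrite -(cvg_lim (@norm_hausdorff _ _) cvgd).
  apply: limr_le; first by apply/cvg_ex; eexists; exact: cvgd.
  by apply: nearW => N; exact: term_lip.
pose b := \sum_i \sum_j `|expmx (0 *: P) i j|.
have b0 : 0 <= b by apply: sumr_ge0 => i _; apply: sumr_ge0.
have ae0 : 0 <= a * expR (U * a) by rewrite mulr_ge0// expR_ge0.
(* The second summand is the Lipschitz constant; the last two bound the entries through their values
   at time 0; the 1 ensures positivity. *)
exists (1 + a * expR (U * a) + a * expR (U * a) * U + b).
  by rewrite ltr_pwDl// ltr_pwDl// ?mulr_ge0// ltr_pwDl.
split=> [u v i j uU vU|u i j uU].
  apply: (le_trans (lip _ _ _ _ uU vU)); rewrite ler_wpM2r//.
  by rewrite -!addrA addrCA lerDl !addr_ge0// mulr_ge0.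
have := lip u 0 i j uU; rewrite normr0 subr0 => /(_ U0) h.
rewrite -(subrK (expmx (0 *: P) i j) (expmx (u *: P) i j)).
apply: (le_trans (ler_normD _ _)); apply: lerD.
  apply: (le_trans h); apply: (@le_trans _ _ (a * expR (U * a) * U)).
    by rewrite ler_wpM2l.
  by rewrite lerDr addr_ge0.
rewrite /b (bigD1 i)//= (bigD1 j)//= -addrA lerDl addr_ge0// ?sumr_ge0// => k _.
exact: sumr_ge0.
Qed.

Lemma continuous_expmx i j : continuous (fun u : R => expmx (u *: P) i j).
Proof.
move=> u; have U0 : 0 <= `|u| + 1 by rewrite addr_ge0.
have [L L0 [lip _]] := expmx_lipschitz U0.
apply/cvgrPdist_le => e e0; near=> v.
apply: le_trans (lip _ _ _ _ _ _) _.
- by rewrite lerDl.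
- rewrite -[v](subrK u); apply: (le_trans (ler_normD _ _)).
  by rewrite addrC lerD2l; near: v; apply: cvgr_distC_le.
- rewrite mulrC -ler_pdivlMr//.
  by near: v; apply: cvgr_dist_le => //; rewrite divr_gt0.
Unshelve. all: by end_near. Qed.

End expmx.

(** * Quasi-distances and the Euclidean norm *)

Section enorm.
Context {R : realType} (n : nat).
Implicit Types (x y : 'rV[R]_n).

Lemma enorm_ge0 x : 0 <= enorm x.
Proof. exact: sqrtr_ge0. Qed.

Lemma sqr_enorm x : enorm x ^+ 2 = \sum_i x ord0 i ^+ 2.
Proof. by rewrite sqr_sqrtr// sumr_ge0// => i _; exact: sqr_ge0. Qed.

Lemma coord_le_enorm x i : `|x ord0 i| <= enorm x.
Proof.
rewrite -sqrtr_sqr ler_sqrt ?sumr_ge0// => [|j _]; last exact: sqr_ge0.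
by rewrite (bigD1 i)//= lerDl sumr_ge0// => j _; exact: sqr_ge0.
Qed.

Lemma enorm0 : enorm (0 : 'rV[R]_n) = 0.
Proof.
by rewrite /enorm big1 ?sqrtr0// => i _; rewrite mxE expr0n.
Qed.

Lemma enorm_eq0 x : enorm x = 0 -> x = 0.
Proof.
move=> x0; apply/rowP => i; rewrite mxE; apply/normr0_eq0/eqP.
by rewrite eq_le normr_ge0 andbT -x0 coord_le_enorm.
Qed.

Lemma enormZ (c : R) x : enorm (c *: x) = `|c| * enorm x.
Proof.
rewrite /enorm -sqrtr_sqr -sqrtrM ?sqr_ge0// mulr_sumr.
by congr Num.sqrt; apply: eq_bigr => i _; rewrite mxE exprMn.
Qed.

(** Factor the difference of the squared norms as the sum of (x_i - y_i) (x_i + y_i), bound the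
    second factors by |x| + |y|, and divide; the case |x| + |y| = 0 is therefore apart. *)
Lemma enormB_le x y : `|enorm x - enorm y| <= \sum_i `|x ord0 i - y ord0 i|.
Proof.
have [s0|s0] := eqVneq (enorm x + enorm y) 0.
  have /eqP x0 : enorm x == 0.
    by have := enorm_ge0 x; have := enorm_ge0 y; lra.
  have /eqP y0 : enorm y == 0.
    by have := enorm_ge0 x; have := enorm_ge0 y; lra.
  by rewrite x0 y0 subrr normr0 sumr_ge0.
have s_gt0 : 0 < enorm x + enorm y by rewrite lt0r s0 addr_ge0 ?enorm_ge0.
rewrite -(ler_pM2r s_gt0) -{1}(ger0_norm (ltW s_gt0)) -normrM.
rewrite -subr_sqr !sqr_enorm -sumrB mulr_suml.
apply: (le_trans (ler_norm_sum _ _ _)); apply: ler_sum => i _.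
rewrite subr_sqr normrM ler_wpM2l// (le_trans (ler_normD _ _))//.
by rewrite lerD// coord_le_enorm.
Qed.

Lemma enorm_le_sum x : enorm x <= \sum_i `|x ord0 i|.
Proof.
have := enormB_le x 0; rewrite enorm0 subr0 ger0_norm ?enorm_ge0//.
by move/le_trans; apply; apply: ler_sum => i _; rewrite mxE subr0.
Qed.

Lemma enorm_ball x y e : ball x e y -> `|enorm x - enorm y| <= n%:R * e.
Proof.
move=> [e0 xy]; apply: (le_trans (enormB_le _ _)).
rewrite mulr_natl -[X in _ *+ X]card_ord -sumr_const; apply: ler_sum => i _.
by apply: ltW; exact: xy.
Qed.

Lemma bounded_enorm (A : set 'rV[R]_n) : bounded_set A ->
  exists M, forall x, A x -> enorm x <= M.
Proof.
move=> [M [_ AM]]; exists (\sum_(i < n) (M + 1)) => x Ax.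
apply: (le_trans (enorm_le_sum _)); apply: ler_sum => i _.
have : `|x| <= M + 1 by apply: AM => //; rewrite ltrDl.
apply: le_trans; rewrite /Num.norm/= mx_normrE.
by apply: (@le_bigmax _ _ _ 0 (fun k : 'I_1 * 'I_n => `|x k.1 k.2|) (ord0, i)).
Qed.

End enorm.

Section quasi_distance.
Context {R : realType} (n : nat).
Variables (P : 'M[R]_n) (rho : 'rV[R]_n -> R).
Hypothesis hrho : quasi_distance P rho.
Implicit Types (x y : 'rV[R]_n).

Lemma rho_ge0 x : 0 <= rho x.
Proof. by rewrite -(subr0 x); exact: (qd_ge0 hrho). Qed.

Lemma rhoN x : rho (- x) = rho x.
Proof. by rewrite -sub0r (qd_sym hrho) subr0. Qed.

(** The first term of the minimum excludes [1 <= rho x] through the outer bound, so that the inner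
    bound applies; the second makes that bound less than [e]. *)
Lemma rho_small e : 0 < e -> exists2 d, 0 < d &
  forall x, enorm x < d -> rho x < e.
Proof.
move=> e0.
have [c1 [c2 [a1 [a2 [c10 c20 a10 a20 outer]]]]] := qd_outer hrho.
have [c3 [c4 [a3 [a4 [c30 c40 a30 a40 inner]]]]] := qd_inner hrho.
exists (Num.min ((c2^-1) `^ a2^-1) ((e / c4) `^ a4^-1)).
  by rewrite lt_min !powR_gt0// ?invr_gt0// divr_gt0.
move=> x; rewrite lt_min => /andP[x2 x4].
have powlt (u v w : R) : 0 <= u -> 0 < v -> 0 < w -> u < v `^ w^-1 -> u `^ w < v.
  move=> u0 v0 w0 uv; rewrite -[ltRHS](powRr1 (ltW v0)) -(mulVf (lt0r_neq0 w0)).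
  by rewrite powRrM gt0_ltr_powR// nnegrE// powR_ge0.
have [r1|r1] := leP 1 (rho x).
  have /andP[_ ] := outer _ r1; rewrite leNgt => /negP[].
  apply: lt_le_trans r1; rewrite -ltr_pdivlMl// mulr1.
  by apply: powlt => //; [exact: enorm_ge0|rewrite invr_gt0].
have /andP[_ /le_lt_trans] := inner _ (ltW r1); apply.
rewrite mulrC -ltr_pdivlMr//; apply: powlt => //; first exact: enorm_ge0.
by rewrite divr_gt0.
Qed.

Lemma small_rho e : 0 < e -> exists2 d, 0 < d &
  forall x, rho x < d -> enorm x < e.
Proof.
move=> e0; have [c3 [c4 [a3 [a4 [c30 c40 a30 a40 inner]]]]] := qd_inner hrho.
exists (Num.min 1 (c3 * e `^ a3)).
  by rewrite lt_min ltr01/= mulr_gt0// powR_gt0.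
move=> x; rewrite lt_min => /andP[/ltW /inner/andP[h _] /(le_lt_trans h)].
rewrite ltr_pM2l// => ea; rewrite ltNge; apply/negP => xe.
by move: ea; rewrite ltNge ge0_ler_powR ?nnegrE ?enorm_ge0 ?(ltW a30) ?(ltW e0).
Qed.

Lemma rho_eq0 x : rho x = 0 -> x = 0.
Proof.
move=> x0; apply: enorm_eq0; apply/eqP; rewrite eq_le enorm_ge0 andbT.
apply/ler_addgt0Pr => e e0; rewrite add0r.
by have [d d0 h] := small_rho e0; apply/ltW/h; rewrite x0.
Qed.

Lemma rho_bounded r : exists2 M, 0 < M & forall x, enorm x <= r -> rho x <= M.
Proof.
have [c1 [c2 [a1 [a2 [c10 c20 a10 a20 outer]]]]] := qd_outer hrho.
exists (1 + c2 * (Num.max r 0) `^ a2).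
  by rewrite ltr_pwDl// mulr_ge0 ?powR_ge0// ltW.
move=> x xr; have [r1|r1] := leP 1 (rho x); last first.
  by apply: ltW; apply: lt_le_trans r1 _; rewrite lerDl mulr_ge0 ?powR_ge0// ltW.
have /andP[_ ] := outer _ r1 => /le_trans; apply.
apply: (@le_trans _ _ (c2 * (Num.max r 0) `^ a2)); last by rewrite lerDr.
by rewrite ler_pM2l// ge0_ler_powR ?nnegrE ?enorm_ge0 ?(ltW a20)// le_max ?lexx ?orbT ?xr.
Qed.

Lemma bounded_rho r : exists2 M, 0 < M & forall x, rho x <= r -> enorm x <= M.
Proof.
have [c1 [c2 [a1 [a2 [c10 c20 a10 a20 outer]]]]] := qd_outer hrho.
have [c3 [c4 [a3 [a4 [c30 c40 a30 a40 inner]]]]] := qd_inner hrho.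
have powle (u v w : R) : 0 <= u -> 0 <= v -> 0 < w -> u `^ w <= v -> u <= v `^ w^-1.
  move=> u0 v0 w0 uv; rewrite -[leLHS](powRr1 u0) -(mulfV (lt0r_neq0 w0)).
  by rewrite powRrM ge0_ler_powR ?nnegrE ?powR_ge0// invr_ge0 ltW.
exists (1 + (Num.max r 0 / c1) `^ a1^-1 + (1 / c3) `^ a3^-1).
  by rewrite -addrA ltr_pwDl// addr_ge0 ?powR_ge0.
move=> x xr; have [r1|r1] := leP 1 (rho x).
  have /andP[h _] := outer _ r1.
  have : enorm x <= (Num.max r 0 / c1) `^ a1^-1.
    apply: powle => //; first exact: enorm_ge0.
      by rewrite divr_ge0 ?(ltW c10)// le_max lexx orbT.
    by rewrite ler_pdivlMr// mulrC (le_trans h)// le_max xr.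
  by move/le_trans; apply; rewrite addrAC lerDr addr_ge0// powR_ge0.
have /andP[h _] := inner _ (ltW r1).
have : enorm x <= (1 / c3) `^ a3^-1.
  apply: powle => //; first exact: enorm_ge0.
    by rewrite divr_ge0 ?(ltW c30).
  by rewrite ler_pdivlMr// mulrC (le_trans h)// ltW.
by move/le_trans; apply; rewrite lerDr addr_ge0// powR_ge0.
Qed.

Lemma mxactD (A : 'M[R]_n) x y : mxact A (x + y) = mxact A x + mxact A y.
Proof. by rewrite /mxact linearD/= mulmxDr linearD. Qed.

Lemma mxactN (A : 'M[R]_n) x : mxact A (- x) = - mxact A x.
Proof. by rewrite /mxact linearN/= mulmxN linearN. Qed.

Lemma mxactBl (A B : 'M[R]_n) x : mxact (A - B) x = mxact A x - mxact B x.
Proof. by rewrite /mxact mulmxBl linearB. Qed.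

Lemma mxactE (A : 'M[R]_n) x i : mxact A x ord0 i = \sum_j A i j * x ord0 j.
Proof. by rewrite !mxE; apply: eq_bigr => j _; rewrite mxE. Qed.

Lemma mxact_bound (A : 'M[R]_n) x a b :
  (forall i j, `|A i j| <= a) -> (forall j, `|x ord0 j| <= b) ->
  forall i, `|mxact A x ord0 i| <= n%:R * (a * b).
Proof.
move=> Aa xb i; rewrite mxactE (le_trans (ler_norm_sum _ _ _))//.
rewrite mulr_natl -[X in _ *+ X]card_ord -sumr_const; apply: ler_sum => j _.
by rewrite normrM ler_pM.
Qed.

Lemma dilation_expR u x : dilation P (expR u) x = mxact (expmx (u *: P)) x.
Proof. by rewrite /dilation /mxpower expRK. Qed.

Lemma rho_expmx u x : rho (mxact (expmx (u *: P)) x) = expR u * rho x.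
Proof. by rewrite -dilation_expR (qd_dilation hrho)// expR_gt0. Qed.

(** A vector killed by exp (u P) satisfies e^u rho x = 0, hence vanishes: invertibility is read off
    the homogeneity of [rho]. *)
Lemma expmx_unit u : expmx (u *: P) \in unitmx.
Proof.
rewrite -unitmx_tr -row_free_unit -kermx_eq0; apply/eqP/row_matrixP => i.
rewrite row0; set v := row i _.
have : v *m (expmx (u *: P))^T = 0.
  by rewrite -row_mul mulmx_ker row0.
move=> /(congr1 trmx); rewrite trmx_mul trmxK trmx0 => vE.
apply: rho_eq0; apply/eqP; rewrite -(mulrI_eq0 _ (lregP (lt0r_neq0 (expR_gt0 u)))).
by rewrite -rho_expmx /mxact vE trmx0 (qd_0 hrho).
Qed.

(** The point from which the flow exp (u P) reaches [y]. *)
Let theta y u : 'rV[R]_n := mxact (invmx (expmx (u *: P))) y.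

Let thetaK y u : mxact (expmx (u *: P)) (theta y u) = y.
Proof. by rewrite /theta /mxact trmxK mulKVmx ?trmxK// expmx_unit. Qed.

Let rho_theta y u : rho (theta y u) = expR (- u) * rho y.
Proof.
by rewrite -[in RHS](thetaK y u) rho_expmx mulrA -expRD addNr expR0 mul1r.
Qed.

(** Continuity of the inverse matrix is avoided. Applying exp (u P) to theta_u - theta_v gives (exp
    (v P) - exp (u P)) theta_v, which is small by the Lipschitz bound; [rho] of the difference is
    e^(-u) times [rho] of this vector, and [small_rho] returns to the Euclidean norm. *)
Let theta_continuous y : continuous (fun u => enorm (theta y u)).
Proof.
move=> v; apply/cvgrPdist_le => e e0.
suff [d d0 h] : exists2 d, 0 < d & forall u, `|v - u| < d ->
    enorm (theta y u - theta y v) <= e / (n%:R + 1).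
  exists d => //= u /h h'; rewrite distrC.
  apply: (le_trans (enormB_le _ _)).
  apply: (@le_trans _ _ (\sum_(i < n) (e / (n%:R + 1)))).
    apply: ler_sum => i _; apply: le_trans h'.
    by have := coord_le_enorm (theta y u - theta y v) i; rewrite !mxE.
  rewrite sumr_const card_ord -[leLHS]mulr_natr mulrAC ler_pdivrMr ?ltr_wpDl//.
  by rewrite ler_pM2l// lerDl.
have n1 : 0 < n%:R + 1 :> R by rewrite ltr_wpDl.
have [r r0 hr] := small_rho (divr_gt0 e0 n1).
have [r' r'0 hr'] := rho_small (mulr_gt0 r0 (expR_gt0 (v - 1))).
have U0 : 0 <= `|v| + 1 by rewrite addr_ge0.
have [L L0 [lip _]] := expmx_lipschitz P U0.
pose b := enorm (theta y v).
have nLb : 0 < n%:R * (n%:R * (L * b)) + 1.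
  by rewrite ltr_wpDl// !mulr_ge0// ?enorm_ge0// ltW.
exists (Num.min 1 (r' / (n%:R * (n%:R * (L * b)) + 1))).
  by rewrite lt_min ltr01 divr_gt0.
move=> u; rewrite lt_min => /andP[uv1 uvr].
apply/ltW/hr; rewrite -[ltLHS]mul1r -expR0 -(addNr u) expRD -mulrA -rho_expmx.
rewrite mxactD mxactN thetaK -{1}(thetaK y v) -mxactBl.
rewrite -ltr_pdivlMl ?expR_gt0// -expRN opprK mulrC.
apply: (@lt_le_trans _ _ (r * expR (v - 1))); last first.
  rewrite ler_pM2l// ler_expR lerBlDl; move: uv1; rewrite ltr_distl => /andP[_].
  by rewrite addrC => /ltW.
apply: hr'; apply: (le_lt_trans (enorm_le_sum _)).
apply: (@le_lt_trans _ _ (n%:R * (n%:R * (L * b)) * `|v - u|)).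
  rewrite -!mulrA mulr_natl -[X in _ *+ X]card_ord -sumr_const; apply: ler_sum => i _.
  have -> : n%:R * (L * (b * `|v - u|)) = n%:R * ((L * `|v - u|) * b) by ring.
  apply: mxact_bound => [k j|j]; last exact: coord_le_enorm.
  rewrite !mxE; apply: lip; first by rewrite lerDl.
  rewrite -(subrK v u) addrC (le_trans (ler_normD _ _))// lerD2l distrC.
  exact: ltW.
move: uvr; rewrite ltr_pdivlMr// mulrC; apply: le_lt_trans.
by rewrite ler_wpM2r// lerDl.
Qed.

(** Intermediate value theorem for the Euclidean norm along the orbit. At time [a] the value of
    [rho] is 2 M, where M bounds [rho] on the unit ball, so the norm exceeds 1; at time [b] it is d
    / 2, which forces the norm below 1. *)
Lemma orbit_meets_sphere y : y != 0 -> exists u theta,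
  [/\ enorm theta = 1, y = mxact (expmx (u *: P)) theta &
      rho y = expR u * rho theta].
Proof.
move=> y0; have ry : 0 < rho y.
  by rewrite lt0r rho_ge0 andbT; apply: contra_neq y0; exact: rho_eq0.
suff [u yu] : exists u, enorm (theta y u) = 1.
  exists u, (theta y u); rewrite thetaK rho_theta mulrA -expRD addrN expR0 mul1r.
  by split.
have [d d0 hd] := small_rho (@ltr01 R).
have [M M0 hM] := rho_bounded 1.
pose a := - ln (2 * M / rho y).
pose b := - ln (d / 2 / rho y).
have ga : 1 < enorm (theta y a).
  rewrite ltNge; apply/negP => /hM; rewrite rho_theta opprK lnK ?posrE; last first.
    by rewrite divr_gt0// mulr_gt0.
  by rewrite divfK ?gt_eqF//; lra.
have gb : enorm (theta y b) < 1.
  apply: hd; rewrite rho_theta opprK lnK ?posrE; last first.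
    by rewrite !divr_gt0.
  by rewrite divfK ?gt_eqF//; lra.
have cont (A : set R) : {within A, continuous (fun u => enorm (theta y u))}.
  by apply: continuous_subspaceT => x; exact: theta_continuous.
have minmax (s t : R) : 1 < s -> t < 1 ->
    Num.min s t <= 1 <= Num.max s t /\ Num.min t s <= 1 <= Num.max t s.
  move=> /ltW s1 /ltW t1.
  by rewrite !ge_min !le_max s1 t1 !orbT.
have [ab|/ltW ba] := leP a b.
  have [|u _ hu] := @IVT R (fun u => enorm (theta y u)) a b 1 ab (cont _).
    exact: (minmax _ _ ga gb).1.
  by exists u.
have [|u _ hu] := @IVT R (fun u => enorm (theta y u)) b a 1 ba (cont _).
  exact: (minmax _ _ ga gb).2.
by exists u.
Qed.

End quasi_distance.

(** * Integrals of homogeneous functions *)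

Section homogeneous_integrals.
Context {R : realType} (n : nat).
Local Notation mu := (@lebesgue_rV R n).
Variables (P : 'M[R]_n) (rho : 'rV[R]_n -> R).
Hypothesis hrho : quasi_distance P rho.
Local Notation gamma := (\tr P).

Lemma measurable_preimage_rho (I : set R) : measurable I ->
  measurable (rho @^-1` I).
Proof.
by move=> mI; rewrite -[X in measurable X]setTI; exact: (qd_measurable hrho).
Qed.

Definition radial_mass (I : set R) : \bar R :=
  \int[@lebesgue_measure R]_(r in `]0%R, +oo[) (r `^ (gamma - 1) * \1_I r)%:E.

(** In polar coordinates a homogeneous [g] depends only on the angular variable, so its integral
    factors with one [G] for all [I]. At this stage [G] may be infinite. *)
Lemma polar_homogeneous (g : 'rV[R]_n -> \bar R) :
  measurable_fun [set: 'rV[R]_n] g -> (forall x, 0 <= g x)%E ->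
  (forall t x, 0 < t -> g (dilation P t x) = g x) ->
  exists2 G : \bar R, (0 <= G)%E & forall I, measurable I ->
    (\int[mu]_(x in rho @^-1` I) g x = radial_mass I * G)%E.
Proof.
move=> mg g0 gh; have [sigma [_ polar]] := qd_polar hrho.
exists (\int[sigma]_(w in [set w | rho w = 1%R]) g w)%E.
  by apply: integral_ge0.
set G := (\int[sigma]_(w in _) _)%E.
have G0 : (0 <= G)%E by apply: integral_ge0.
move=> I mI; have mrI := measurable_preimage_rho mI.
rewrite integral_mkcond polar; last 2 first.
- by apply/(measurable_restrictT _ mrI); exact: measurable_funTS.
- by move=> x; rewrite erestrict_ge0.
rewrite /radial_mass -ge0_integralZr//; last 2 first.
- apply/measurable_EFinP; apply: measurable_funTS.
  by apply: measurable_funM; [exact: measurable_powR|exact: measurable_indic].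
- by move=> r _; rewrite lee_fin mulr_ge0// powR_ge0.
apply: eq_integral => r; rewrite inE/= in_itv/= andbT => r0.
rewrite EFinM -muleA; congr (_ * _)%E.
rewrite /G indicE; have [rI|rI] := boolP (r \in I).
  rewrite mul1e; apply: eq_integral => w; rewrite inE/= => w1.
  rewrite patchE mem_set ?gh//=.
  by rewrite (qd_dilation hrho)// w1 mulr1; exact: set_mem.
rewrite mul0e; apply: integral0_eq => w /= w1.
rewrite patchE memNset//= (qd_dilation hrho)// w1 mulr1.
by move=> /mem_set; rewrite (negbTE rI).
Qed.

Lemma radial_mass_ge0 I : (0 <= radial_mass I)%E.
Proof.
by apply: integral_ge0 => r _; rewrite lee_fin mulr_ge0// powR_ge0.
Qed.

Let measurable_radial_density (t : R) : measurable_fun [set: R]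
  ((fun r : R => (r `^ (gamma - 1) * \1_(`]-oo, t[%classic : set R) r)%:E) \_ `]0, +oo[).
Proof.
have m0 : measurable (`]0, +oo[%classic : set R) by [].
apply/(measurable_restrictT _ m0).
apply/measurable_EFinP; apply: measurable_funTS.
by apply: measurable_funM; [exact: measurable_powR|exact: measurable_indic].
Qed.

Lemma radial_mass_scale (t : R) : 0 < t ->
  radial_mass `]-oo, t[ = ((t `^ gamma)%:E * radial_mass `]-oo, 1%R[)%E.
Proof.
move=> t0; rewrite /radial_mass [LHS]integral_mkcond.
rewrite (@ge0_integral_affine _ t 0); last 3 first.
- exact: lt0r_neq0.
- exact: measurable_radial_density.
- by move=> r; rewrite erestrict_ge0// => x _; rewrite lee_fin mulr_ge0// powR_ge0.
rewrite [in RHS]integral_mkcond gtr0_norm//.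
have -> : t `^ gamma = t * t `^ (gamma - 1).
  rewrite -{2}(powRr1 (ltW t0)) -powRD ?(gt_eqF t0) ?implybT//.
  by rewrite addrC subrK.
rewrite EFinM -muleA.
congr (_ * _)%E; rewrite -ge0_integralZl_EFin ?powR_ge0//; last 2 first.
- by move=> r _; rewrite erestrict_ge0// => x _; rewrite lee_fin mulr_ge0// powR_ge0.
- exact: measurable_radial_density.
apply: eq_integral => r _; rewrite addr0 !patchE.
have -> : (t * r \in `]0, +oo[%classic) = (r \in `]0, +oo[%classic).
  by apply/idP/idP; rewrite !inE/= !in_itv/= !andbT pmulr_rgt0.
case: ifPn; rewrite ?mule0// inE/= in_itv/= andbT => r0.
rewrite -EFinM; congr EFin; rewrite mulrA powRM ?ltW//; congr (_ * _).
rewrite !indicE; congr (nat_of_bool _)%:R.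
by apply/idP/idP; rewrite !inE/= !in_itv/= gtr_pMr.
Qed.

(** Allows this factor to be cancelled: once the integral over the shell is finite, so is the
    angular constant. The minimum in [c] covers both signs of gamma - 1. *)
Lemma radial_mass_annulus_gt0 : (0 < radial_mass `[2^-1%R, 1%R[)%E.
Proof.
pose c : R := Num.min 1 ((2^-1) `^ (gamma - 1)).
have c0 : 0 < c by rewrite lt_min ltr01 powR_gt0.
apply: (@lt_le_trans _ _ (\int[@lebesgue_measure R]_(r in `[2^-1%R, 1%R[) c%:E)%E).
  rewrite integral_cst//= lebesgue_measure_itv/= lte_fin invf_lt1// ltr1n.
  by rewrite -EFinB -EFinM lte_fin mulr_gt0// subr_gt0 invf_lt1// ltr1n.
rewrite /radial_mass [leLHS]integral_mkcond [leRHS]integral_mkcond.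
apply: ge0_le_integral_nomeas => r _.
  by rewrite erestrict_ge0// => x _; rewrite lee_fin ltW.
rewrite !patchE; case: ifPn => [|_]; last first.
  by case: ifPn => // _; rewrite lee_fin mulr_ge0// powR_ge0.
rewrite inE/= in_itv/= => /andP[r2 r1]; have r0 : 0 < r by apply: lt_le_trans r2.
rewrite mem_set/=; last by rewrite in_itv/= r0.
rewrite indicE mem_set/=; last by rewrite in_itv/= r2 r1.
rewrite mulr1 lee_fin /c ge_min; apply/orP.
have [g1|g1] := leP 0 (gamma - 1).
  by right; rewrite ge0_ler_powR// ?nnegrE ?invr_ge0// ltW.
left; rewrite -(opprK (gamma - 1)) powRN -[leLHS]invr1 lef_pV2 ?posrE ?powR_gt0//.
rewrite [leRHS](_ : _ = 1 `^ (- (gamma - 1))); last by rewrite powR1.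
rewrite ge0_ler_powR ?nnegrE ?(ltW r0) ?(ltW r1)//.
by rewrite oppr_ge0 ltW.
Qed.

Lemma bounded_preimage_rho_fin (I : set R) M : measurable I ->
  (forall r, I r -> r <= M) -> (mu (rho @^-1` I) < +oo)%E.
Proof.
move=> mI IM; have [N N0 hN] := bounded_rho hrho M.
have N1 : 0 < N + 1 by rewrite addr_gt0.
apply: (@le_lt_trans _ _ (mu (ball 0 (N + 1)))).
  apply: le_measure; rewrite ?inE; first exact: measurable_preimage_rho.
    exact: measurable_rV_ball.
  move=> x /= /IM /hN xN; rewrite rV_ballE// => i; rewrite mxE sub0r normrN.
  by rewrite (le_lt_trans (coord_le_enorm _ _))// (le_lt_trans xN)// ltrDl.
by rewrite lebesgue_rV_ball// ltry.
Qed.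

Lemma ellipsoid0E r : ellipsoid rho 0 r = rho @^-1` `]-oo, r[.
Proof.
by apply/seteqP; split => x /=; rewrite /ellipsoid/= in_itv/= sub0r (rhoN hrho).
Qed.

Lemma ellipsoidE x r :
  ellipsoid rho x r = (fun y : 'rV[R]_n => 1 *: y + (- x)) @^-1` ellipsoid rho 0 r.
Proof.
by apply/seteqP; split => y; rewrite /ellipsoid/= scale1r sub0r opprB.
Qed.

Lemma measurable_ellipsoid x r : measurable (ellipsoid rho x r).
Proof.
rewrite ellipsoidE -[X in measurable X]setTI.
apply: measurable_rV_affine => //; rewrite ellipsoid0E.
exact: measurable_preimage_rho.
Qed.

(** The polar formula with g = 1 writes the volume of an ellipsoid as radial mass times angular
    constant. The unit ellipsoid contains a cube and is bounded, so this product is positive and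
    finite; hence the angular constant is positive and the radial mass finite. The constant [v] is
    the volume of the unit ellipsoid. *)
Lemma radial_mass_fin : (radial_mass `]-oo, 1%R[ < +oo)%E /\
  exists2 v, 0 < v & forall x r, 0 < r ->
    mu (ellipsoid rho x r) = (v * r `^ gamma)%:E.
Proof.
have m1 : measurable_fun [set: 'rV[R]_n] (fun=> 1%E : \bar R).
  exact: measurable_cst.
have [|t x _|G G0 hG] := polar_homogeneous m1; [by move=> x; rewrite lee_fin|by []|].
have muE r : mu (rho @^-1` `]-oo, r[) = (radial_mass `]-oo, r[ * G)%E.
  rewrite -hG// integral_cst ?mul1e//; exact: measurable_preimage_rho.
have fin1 : (mu (rho @^-1` `]-oo, 1%R[) < +oo)%E.
  by apply: (@bounded_preimage_rho_fin _ 1) => // r /=; rewrite in_itv/= => /ltW.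
have pos1 : (0 < mu (rho @^-1` `]-oo, 1%R[))%E.
  have [d d0 hd] := rho_small hrho (@ltr01 R).
  have e0 : 0 < d / (n%:R + 1) by rewrite divr_gt0// ltr_wpDl.
  apply: (@lt_le_trans _ _ (mu (ball (0 : 'rV[R]_n) (d / (n%:R + 1))))).
    by rewrite lebesgue_rV_ball// lte_fin exprn_gt0// mulr_gt0.
  apply: le_measure; rewrite ?inE; [exact: measurable_rV_ball|exact: measurable_preimage_rho|].
  move=> x /enorm_ball; rewrite enorm0 sub0r normrN ger0_norm ?enorm_ge0// => h.
  rewrite /= in_itv/=; apply: hd; apply: le_lt_trans h _.
  by rewrite mulrCA gtr_pMr// ltr_pdivrMr ?mul1r ?ltrDl// ltr_wpDl.
have mass_fin : (radial_mass `]-oo, 1%R[ < +oo)%E.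
  have Gpos : (0 < G)%E.
    rewrite lt0e G0 andbT; apply: contraTneq pos1 => G00.
    by rewrite muE G00 mule0 ltxx.
  rewrite ltNge leye_eq; apply: contraTN fin1 => /eqP my.
  by rewrite muE my gt0_mulye// ltxx.
split=> //.
have v1 : mu (rho @^-1` `]-oo, 1[) \is a fin_num.
  by rewrite ge0_fin_numE.
exists (fine (mu (rho @^-1` `]-oo, 1[))); first by rewrite fine_gt0// pos1 fin1.
move=> x r r0; rewrite ellipsoidE lebesgue_rV_affine ?normr1//; last exact: measurable_ellipsoid.
by rewrite ellipsoid0E muE radial_mass_scale// -muleA -muE muleC EFinM fineK.
Qed.

End homogeneous_integrals.

(** * Comparison with the surface measure of the Euclidean sphere *)

Lemma ge0_integral_mrestr d (T : measurableType d) (R : realType)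
    (m : {measure set T -> \bar R}) (D : set T) (mD : measurable D)
    (f : T -> \bar R) : measurable_fun [set: T] f -> (forall x, 0 <= f x)%E ->
  (\int[mrestr m mD]_x f x = \int[m]_(x in D) f x)%E.
Proof.
move=> mf f0; have mCD : measurable (~` D) by exact: measurableC.
transitivity (\int[mrestr m mD]_(x in D) f x)%E; last first.
  by apply: eq_measure_integral => A mA /setIidl AD; rewrite -[in RHS]AD.
rewrite -[X in integral _ X _](setUv D) ge0_integral_setU//; last first.
- by rewrite /disj_set setICr.
- by rewrite setUv.
rewrite [X in (_ + X)%E](_ : _ = 0%E) ?adde0//.
rewrite (eq_measure_integral mzero) ?integral_measure_zero// => A mA AD.
rewrite [LHS](_ : _ = m (A `&` D))// (_ : A `&` D = set0) ?measure0//.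
by apply/seteqP; split => // x [/AD].
Qed.

Section sphere.
Context {R : realType} (n : nat).
Local Notation mu := (@lebesgue_rV R n).
Variables (P : 'M[R]_n) (rho : 'rV[R]_n -> R).
Hypothesis hrho : quasi_distance P rho.
Local Notation gamma := (\tr P).

Lemma radial_projE (x : 'rV[R]_n) : radial_proj x = (enorm x)^-1 *: x.
Proof. by []. Qed.

Section orbit_chart.
Variables u1 u2 : R.

Let time (x : 'rV[R]_n) : R := u1 + (u2 - u1) * (3 * enorm x - 1).

(* maps the ray through a point [w] of the sphere to the orbit of [w], the
   segment 1/3 <= |x| <= 2/3 corresponding to the times in [u1, u2] *)
Definition orbit_chart (x : 'rV[R]_n) : 'rV[R]_n :=
  mxact (expmx (time x *: P)) (radial_proj x).

Let K : set 'rV[R]_n := [set x | 3^-1 <= enorm x <= 2 / 3].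
Let K' : set 'rV[R]_n := [set x | 4^-1 <= enorm x <= 1].
(** In a cube of radius [d] the Euclidean norm varies by at most n d <= 1/12 = 1/3 - 1/4, which is
    the gap between [K] and [K']. *)
Let d : R := (12 * (n%:R + 1))^-1.

Let n1 : 0 < n%:R + 1 :> R.
Proof. by rewrite ltr_wpDl. Qed.

Let d0 : 0 < d.
Proof. by rewrite invr_gt0 mulr_gt0. Qed.

Let nd : n%:R * d <= 12^-1.
Proof. by rewrite /d ler_pdivrMr ?mulr_gt0// mulrA mulVf// mul1r lerDl. Qed.

Let KK' x : K x -> ball x d `<=` K'.
Proof.
move=> /andP[x1 x2] z /enorm_ball; rewrite ler_distl => /andP[h1 h2].
by apply/andP; split; have := nd; lra.
Qed.

Let measurable_time : measurable_fun [set: 'rV[R]_n] time.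
Proof.
apply: measurable_funD => //; apply: measurable_funM => //.
apply: measurable_funB => //; apply: measurable_funM => //.
exact: measurable_enorm.
Qed.

Lemma measurable_orbit_chart : measurable_fun [set: 'rV[R]_n] orbit_chart.
Proof.
apply: measurable_rVP => i.
rewrite (_ : (fun _ => _) = fun x =>
    \sum_j expmx (time x *: P) i j * radial_proj x ord0 j); last first.
  by apply/funext => x; rewrite mxactE.
apply: measurable_sum => j; apply: measurable_funM.
  have mexp : measurable_fun [set: R] (fun u : R => expmx (u *: P) i j).
    by apply: continuous_measurable_fun; exact: continuous_expmx.
  exact: measurableT_comp mexp measurable_time.
exact: measurableT_comp (measurable_coord j) (@measurable_radial_proj R n).
Qed.

Let orbit_chart_lipschitz : exists2 L, 0 < L & forall x e z, K x ->
  0 < e <= d -> ball x e z -> ball (orbit_chart x) (L * e) (orbit_chart z).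
Proof.
have U0 : 0 <= `|u1| + `|u2 - u1| * 2 by rewrite addr_ge0// mulr_ge0.
have [L1 L10 [lip bnd]] := expmx_lipschitz P U0.
have timeU x : K' x -> `|time x| <= `|u1| + `|u2 - u1| * 2.
  move=> /andP[x1 x2]; rewrite (le_trans (ler_normD _ _))// lerD2l normrM.
  by rewrite ler_wpM2l// ler_norml; apply/andP; split; lra.
(* The first summand measures the variation of the radial projection, 4 being a bound for the
   inverse norm on [K']; the second measures the variation of the time. The 1 makes the final
   inequality strict. *)
pose L := n%:R * (L1 * (4 + 4 * n%:R)) + n%:R * (L1 * (`|u2 - u1| * 3 * n%:R)) + 1.
exists L.
  by rewrite ltr_wpDl// addr_ge0// !mulr_ge0// ?addr_ge0 ?mulr_ge0// ltW.
move=> x e z Kx /andP[e0 ed] xz.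
have xzd : ball x d z by apply: le_ball xz.
have K'z := KK' Kx xzd.
have K'x : K' x by apply: (KK' Kx); exact: ballxx.
have [zge4 _] := andP K'z; have [xge4 _] := andP K'x.
have z0 : 0 < enorm z by apply: lt_le_trans zge4; rewrite invr_gt0.
have x0 : 0 < enorm x by apply: lt_le_trans xge4; rewrite invr_gt0.
have nxz := enorm_ball xz.
have zV : (enorm z)^-1 <= 4 by rewrite -[leRHS]invrK lef_pV2 ?posrE ?invr_gt0.
have xz_coord j : `|z ord0 j - x ord0 j| <= e.
  by rewrite distrC; move: xz; rewrite rV_ballE// => /(_ j)/ltW.
have px j : `|radial_proj x ord0 j| <= 1.
  rewrite mxE normrM ger0_norm ?invr_ge0 ?(ltW x0)// ler_pdivrMl// mulr1.
  exact: coord_le_enorm.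
rewrite rV_ballE ?mulr_gt0//; last first.
  by rewrite ltr_wpDl// addr_ge0// !mulr_ge0// ?addr_ge0 ?mulr_ge0// ltW.
move=> i; rewrite distrC.
have -> : orbit_chart z ord0 i - orbit_chart x ord0 i =
    mxact (expmx (time z *: P)) (radial_proj z - radial_proj x) ord0 i +
    mxact (expmx (time z *: P) - expmx (time x *: P)) (radial_proj x) ord0 i.
  by rewrite mxactD mxactN mxactBl !mxE; ring.
apply: (le_lt_trans (ler_normD _ _)).
apply: (@le_lt_trans _ _ (n%:R * (L1 * ((4 + 4 * n%:R) * e)) +
    n%:R * (L1 * (`|u2 - u1| * 3 * n%:R * e) * 1))); last first.
  rewrite [ltRHS](_ : _ = n%:R * (L1 * ((4 + 4 * n%:R) * e)) +
    n%:R * (L1 * (`|u2 - u1| * 3 * n%:R * e) * 1) + e); last by rewrite /L; ring.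
  by rewrite ltrDl.
apply: lerD; apply: mxact_bound => //.
- by move=> k l; apply: bnd; exact: timeU.
- move=> j; have -> : (radial_proj z - radial_proj x) ord0 j =
     (z ord0 j - x ord0 j) * (enorm z)^-1 +
     radial_proj x ord0 j * (enorm x - enorm z) * (enorm z)^-1.
    by rewrite !mxE; field; rewrite !gt_eqF.
  apply: (le_trans (ler_normD _ _)); rewrite !normrM.
  have zV0 : 0 <= (enorm z)^-1 by rewrite invr_ge0 ltW.
  rewrite [`|(enorm z)^-1|]ger0_norm//.
  have -> : (4 + 4 * n%:R) * e = e * 4 + 1 * (n%:R * e) * 4 by ring.
  by apply: lerD; apply: ler_pM => //; apply: ler_pM.
- move=> k l; rewrite !mxE; apply: (le_trans (lip _ _ _ _ (timeU _ K'z) (timeU _ K'x))).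
  rewrite ler_pM2l// /time opprD addrACA subrr add0r -mulrBr opprD opprK.
  rewrite addrACA addNr addr0 -mulrBr !normrM -!mulrA ler_wpM2l//.
  by rewrite ger0_norm// ler_pM2l// distrC.
Qed.

(** Lebesgue measure on [Z] is at most [L ^+ n] times the image under the chart of Lebesgue measure
    on [K']. By homogeneity [g] after the chart is [g] after the radial projection, and enlarging
    [K'] to the unit ball produces the definition of [sphere_measure]; the volume of the ball in the
    constant undoes the normalization. *)
Lemma orbit_chart_integral_le (Z : set 'rV[R]_n) (g : 'rV[R]_n -> \bar R) :
  measurable Z -> (mu Z < +oo)%E ->
  (forall y, Z y -> exists u theta,
    [/\ enorm theta = 1, y = mxact (expmx (u *: P)) theta & u1 <= u <= u2]) ->
  u1 < u2 ->
  measurable_fun [set: 'rV[R]_n] g -> (forall x, 0 <= g x)%E ->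
  (forall t x, 0 < t -> g (dilation P t x) = g x) ->
  exists2 C : R, 0 <= C &
    (\int[mu]_(x in Z) g x <= C%:E * \int[@sphere_measure R n]_x g x)%E.
Proof.
move=> mZ Zfin Zorb u12 mg g0 gh.
have [L L0 lip] := orbit_chart_lipschitz.
have mK' : measurable K'.
  rewrite (_ : K' = @enorm R n @^-1` (`[4^-1, 1]%classic : set R)); last first.
    by apply/seteqP; split => x /=; rewrite in_itv.
  by rewrite -[X in measurable X]setTI; apply: measurable_enorm.
have big : ((mu (@eball R n) < +oo) /\ (0 < mu (@eball R n)))%E.
  split.
    apply: (@le_lt_trans _ _ (mu (ball 0 2))).
      apply: le_measure; rewrite ?inE; [exact: measurable_eball|exact: measurable_rV_ball|].
      move=> x; rewrite /eball/= => x1; rewrite rV_ballE// => i.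
      rewrite mxE sub0r normrN (le_lt_trans (coord_le_enorm _ _))//.
      by apply: le_lt_trans x1 _; rewrite ltr1n.
    by rewrite lebesgue_rV_ball// ltry.
  apply: (@lt_le_trans _ _ (mu (ball (0 : 'rV[R]_n) (n%:R + 1)^-1))).
    by rewrite lebesgue_rV_ball ?invr_gt0// lte_fin exprn_gt0// mulr_gt0// invr_gt0.
  apply: le_measure; rewrite ?inE; [exact: measurable_rV_ball|exact: measurable_eball|].
  move=> x /enorm_ball; rewrite enorm0 sub0r normrN ger0_norm ?enorm_ge0// => h.
  by rewrite /eball/=; apply: le_trans h _; rewrite ler_pdivrMr// mul1r lerDl.
have [eballfin eballpos] := big.
have K'fin : (mu K' < +oo)%E.
  apply: le_lt_trans eballfin; apply: le_measure; rewrite ?inE//.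
    exact: measurable_eball.
  by move=> x /andP[].
have vol0 : 0 < vol (@eball R n) by rewrite /vol fine_gt0// eballpos eballfin.
have Ln0 : 0 <= L ^+ n by rewrite exprn_ge0// ltW.
have Zim : Z `<=` orbit_chart @` K.
  move=> y /Zorb[u [w [w1 yE /andP[uu1 uu2]]]].
  (* The radius between 1/3 and 2/3 to which the chart assigns the time [u]. *)
  pose r := (1 + (u - u1) / (u2 - u1)) / 3.
  have q0 : 0 <= (u - u1) / (u2 - u1) by rewrite divr_ge0 ?subr_ge0// ltW.
  have q1 : (u - u1) / (u2 - u1) <= 1.
    by rewrite ler_pdivrMr ?subr_gt0// mul1r lerD2r.
  have r0 : 0 < r by rewrite /r; lra.
  have rw : enorm (r *: w) = r by rewrite enormZ w1 mulr1 gtr0_norm.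
  exists (r *: w); first by rewrite /K/= rw; apply/andP; split; rewrite /r; lra.
  rewrite /orbit_chart radial_projE rw scalerA mulVf ?gt_eqF// scale1r yE.
  have -> // : time (r *: w) = u.
  by rewrite /time rw /r; field; rewrite gt_eqF// subr_gt0.
pose m2 := mscale (NngNum Ln0) (mimage (mrestr mu mK') measurable_orbit_chart).
have le12 A : measurable A -> (mrestr mu mZ A <= m2 A)%E.
  move=> mA; rewrite /mrestr.
  have mAZ : measurable (A `&` Z) by exact: measurableI.
  have AZfin : (mu (A `&` Z) < +oo)%E.
    by apply: le_lt_trans Zfin; apply: le_measure; rewrite ?inE//; exact: subIsetr.
  have AZim : A `&` Z `<=` orbit_chart @` K by move=> x [_ /Zim].
  apply: le_trans (lipschitz_image_le measurable_orbit_chart mK' K'fin L0 d0 KK' lip mAZ AZfin AZim) _.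
  rewrite /m2 /mscale/= /mimage /pushforward /mrestr.
  apply: lee_wpmul2l; first by rewrite lee_fin.
  have mch B : measurable B -> measurable (orbit_chart @^-1` B).
    by move=> mB; rewrite -[X in measurable X]setTI; exact: measurable_orbit_chart.
  rewrite setIC; apply: le_measure; rewrite ?inE.
  - by apply: measurableI => //; exact: mch.
  - by apply: measurableI => //; exact: mch.
  - by move=> x [[? ?] ?].
exists (L ^+ n * vol (@eball R n)); first by rewrite mulr_ge0// ltW.
rewrite -(ge0_integral_mrestr mu mZ mg g0).
apply: (le_trans (ge0_le_measure_integral le12 measurableT g0 mg)).
rewrite ge0_integral_mscale//= EFinM -muleA; apply: lee_wpmul2l.
  by rewrite lee_fin.
rewrite (@ge0_integral_pushforward _ _ _ _ R _ measurable_orbit_chart)//.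
rewrite preimage_setT ge0_integral_mrestr; last 2 first.
- exact: measurableT_comp mg measurable_orbit_chart.
- by move=> x; exact: g0.
rewrite /sphere_measure ge0_integral_mscale//=.
rewrite muleA -EFinM divff ?gt_eqF// mul1e.
rewrite (@ge0_integral_pushforward _ _ _ _ R _ (@measurable_radial_proj R n))//.
have mgp : measurable_fun setT (g \o @radial_proj R n).
  exact: measurableT_comp mg (@measurable_radial_proj R n).
rewrite preimage_setT ge0_integral_mrestr//; last by move=> x; exact: g0.
rewrite [leLHS](_ : _ = \int[mu]_(x in K') (g \o @radial_proj R n) x)%E; last first.
  apply: eq_integral => x _ /=; rewrite /orbit_chart -dilation_expR gh//.
  exact: expR_gt0.
apply: ge0_subset_integral => //; first exact: measurable_eball.
  by apply: measurable_funTS.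
by move=> x _; exact: g0.
by move=> x /andP[].
Qed.

End orbit_chart.

(** The chart bounds the integral over the shell 1/2 <= rho < 1. Dividing by the positive radial
    mass of the shell shows that the angular constant is finite, and scaling of the radial mass
    gives every ellipsoid centred at 0. *)
Lemma homogeneous_integral_le (g : 'rV[R]_n -> \bar R) :
  measurable_fun [set: 'rV[R]_n] g -> (forall x, 0 <= g x)%E ->
  (forall t x, 0 < t -> g (dilation P t x) = g x) ->
  (\int[@sphere_measure R n]_x g x < +oo)%E ->
  exists2 C : R, 0 <= C & forall t, 0 < t ->
    (\int[mu]_(x in ellipsoid rho 0 t) g x <= (C * t `^ gamma)%:E)%E.
Proof.
move=> mg g0 gh gfin.
have [G G0 hG] := polar_homogeneous hrho mg g0 gh.
have mI : measurable (`[2^-1, 1[%classic : set R) by [].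
pose Z := rho @^-1` `[2^-1, 1[.
have mZ : measurable Z by exact: (measurable_preimage_rho hrho).
have Zfin : (mu Z < +oo)%E.
  apply: (@bounded_preimage_rho_fin _ _ _ _ hrho _ 1) => // r /=.
  by rewrite in_itv/= => /andP[_ /ltW].
have [M M0 hM] := rho_bounded hrho 1.
have [d d0 hd] := small_rho hrho (@ltr01 R).
(* On the Euclidean sphere [rho] lies between [d] and [M], so a point of the shell is reached at a
   time between ln (1 / (2 M)) and ln (1 / d); the shifts by 1 and the maximum ensure [u1 < u2]. *)
pose u1 := ln (2^-1 / M) - 1; pose u2 := Num.max (ln (1 / d)) u1 + 1.
have u12 : u1 < u2 by rewrite /u2 ltr_pwDr// le_max lexx orbT.
have Zorb y : Z y -> exists u theta,
    [/\ enorm theta = 1, y = mxact (expmx (u *: P)) theta & u1 <= u <= u2].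
  rewrite /Z/= in_itv/= => /andP[y2 y1].
  have ry : 0 < rho y by apply: lt_le_trans y2.
  have y0 : y != 0 by apply: contraTneq ry => ->; rewrite (qd_0 hrho) ltxx.
  have [u [w [w1 yE rE]]] := orbit_meets_sphere hrho y0.
  exists u, w; split => //.
  have rw0 : 0 < rho w.
    by move: ry; rewrite rE pmulr_rgt0// expR_gt0.
  have wM : rho w <= M by apply: hM; rewrite w1.
  have dw : d <= rho w.
    by rewrite leNgt; apply/negP => /hd; rewrite w1 ltxx.
  have -> : u = ln (rho y / rho w) by rewrite rE mulfK ?gt_eqF// expRK.
  apply/andP; split.
    rewrite /u1 lerBlDr (@le_trans _ _ (ln (rho y / rho w)))// ?lerDl//.
    by rewrite ler_ln ?posrE ?divr_gt0// ler_pM// ?invr_ge0 ?(ltW M0)// lef_pV2.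
  rewrite /u2 (@le_trans _ _ (ln (1 / d)))//.
    rewrite ler_ln ?posrE ?divr_gt0// ler_pM// ?(ltW ry) ?invr_ge0 ?(ltW rw0) ?(ltW y1)//.
    by rewrite lef_pV2.
  by rewrite ler_wpDr// le_max lexx.
have [C C0 hC] := orbit_chart_integral_le mZ Zfin Zorb u12 mg g0 gh.
have Zint : (radial_mass P `[2^-1%R, 1%R[ * G < +oo)%E.
  rewrite -hG//; apply: le_lt_trans hC _.
  by rewrite lte_mul_pinfty// lee_fin.
have Gfin : (G < +oo)%E.
  rewrite ltNge leye_eq; apply: contraTN Zint => /eqP ->.
  by rewrite gt0_muley ?ltxx// radial_mass_annulus_gt0.
have [mass_fin _] := radial_mass_fin hrho.
have fin : (radial_mass P `]-oo, 1%R[ * G)%E \is a fin_num.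
  by rewrite fin_numM// ge0_fin_numE// radial_mass_ge0.
exists (fine (radial_mass P `]-oo, 1%R[ * G)).
  by rewrite fine_ge0// mule_ge0// radial_mass_ge0.
move=> t t0; rewrite (ellipsoid0E hrho) hG// radial_mass_scale//.
by rewrite -muleA muleC EFinM fineK.
Qed.

End sphere.

(** * Local L_q norms *)

Section Lq.
Context d (T : measurableType d) (R : realType).
Variable mu : {measure set T -> \bar R}.
Implicit Types (A B : set T) (f g : T -> R) (q : R).

Lemma ge0_poweR_le (x y : \bar R) (r : R) :
  0 <= r -> (0 <= x)%E -> (x <= y)%E -> (x `^ r <= y `^ r)%E.
Proof.
move=> r0 x0 xy; apply: gt0_ler_poweR => //; rewrite in_itv/= leey andbT//.
exact: le_trans xy.
Qed.

Lemma ge0_subset_integral_nomeas A B (f : T -> \bar R) :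
  A `<=` B -> (forall x, 0 <= f x)%E ->
  (\int[mu]_(x in A) f x <= \int[mu]_(x in B) f x)%E.
Proof.
move=> AB f0; rewrite integral_mkcond [leRHS]integral_mkcond.
apply: ge0_le_integral_nomeas => x _; first by rewrite erestrict_ge0.
rewrite !patchE; case: ifPn => [/set_mem/AB/mem_set ->//|_].
by case: ifPn.
Qed.

(** The L_q norm of the restriction to [A] for q > 0 ([Lnorm_patch]), written as an integral over
    [A] so that estimates can be made pointwise on [A]. *)
Definition Lq q A f : \bar R := ((\int[mu]_(x in A) (`|f x| `^ q)%:E) `^ q^-1)%E.

Lemma int_powR_ge0 q A f : (0 <= \int[mu]_(x in A) (`|f x| `^ q)%:E)%E.
Proof. by apply: integral_ge0 => x _; rewrite lee_fin powR_ge0. Qed.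
#[local] Hint Resolve int_powR_ge0 : core.

Lemma Lq_ge0 q A f : (0 <= Lq q A f)%E.
Proof. exact: poweR_ge0. Qed.

Lemma Lq_powR q A f : q != 0 ->
  (Lq q A f `^ q = \int[mu]_(x in A) (`|f x| `^ q)%:E)%E.
Proof. by move=> q0; rewrite /Lq -poweRrM mulVf// poweRe1. Qed.

Lemma Lnorm_patch q A f : 0 < q ->
  Lnorm mu q%:E (EFin \o (f \_ A)) = Lq q A f.
Proof.
move=> q0; rewrite unlock /Lq [in RHS]integral_mkcond; congr (_ `^ _)%E.
apply: eq_integral => x _ /=; rewrite !patchE; case: ifPn => // _.
by rewrite normr0 powR0// gt_eqF.
Qed.

Lemma LnormT q f : 0 < q -> Lnorm mu q%:E (EFin \o f) = Lq q setT f.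
Proof. by move=> q0; rewrite -Lnorm_patch// patch_setT. Qed.

Lemma Lq_le q A f g : 0 < q -> (forall x, A x -> `|f x| <= `|g x|) ->
  (Lq q A f <= Lq q A g)%E.
Proof.
move=> q0 fg; apply: ge0_poweR_le => //; first by rewrite invr_ge0 ltW.
apply: ge0_le_integral_nomeas => x Ax; rewrite lee_fin ?powR_ge0//.
by rewrite ge0_ler_powR ?nnegrE ?(ltW q0)// fg.
Qed.

Lemma eq_Lq q A f g : 0 < q -> (forall x, A x -> `|f x| = `|g x|) ->
  Lq q A f = Lq q A g.
Proof. by move=> q0 fg; apply/le_anti/andP; split; apply: Lq_le => // x /fg ->. Qed.

Lemma Lq_ae_le q A f g : measurable A -> 0 < q ->
  measurable_fun A f -> measurable_fun A g ->
  {ae mu, forall x, A x -> `|f x| <= `|g x|} -> (Lq q A f <= Lq q A g)%E.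
Proof.
move=> mA q0 mf mg fg; apply: ge0_poweR_le => //; first by rewrite invr_ge0 ltW.
have mp (h : T -> R) : measurable_fun A h -> measurable_fun A (fun x => (`|h x| `^ q)%:E).
  move=> mh; apply/measurable_EFinP.
  by apply: (measurableT_comp (measurable_powR q)); exact: measurableT_comp.
apply: ae_ge0_le_integral => //.
- exact: mp.
- exact: mp.
apply: filterS fg => x /[apply] h; rewrite lee_fin.
by rewrite ge0_ler_powR ?nnegrE ?(ltW q0)// fg.
Qed.

Lemma Lq_subset q A B f : 0 < q -> A `<=` B -> (Lq q A f <= Lq q B f)%E.
Proof.
move=> q0 AB; apply: ge0_poweR_le => //; first by rewrite invr_ge0 ltW.
by apply: ge0_subset_integral_nomeas => // x; rewrite lee_fin powR_ge0.
Qed.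

Lemma Lq_cst q A c : measurable A -> 0 < q ->
  Lq q A (cst c) = (`|c|%:E * mu A `^ q^-1)%E.
Proof.
move=> mA q0; rewrite /Lq (integral_cst _ mA (`|c| `^ q)%:E) poweRM ?lee_fin ?powR_ge0//.
by rewrite poweR_EFin -powRrM mulfV ?gt_eqF// powRr1.
Qed.

Lemma LqZ q A c f : measurable A -> measurable_fun A f -> 0 < q ->
  Lq q A (fun x => c * f x) = (`|c|%:E * Lq q A f)%E.
Proof.
move=> mA mf q0; rewrite /Lq.
under eq_integral do rewrite normrM powRM// EFinM.
rewrite ge0_integralZl_EFin//=.
- rewrite poweRM ?lee_fin ?powR_ge0//.
  by rewrite poweR_EFin -powRrM mulfV ?gt_eqF// powRr1.
- apply/measurable_EFinP.
  by apply: (measurableT_comp (measurable_powR q)); exact: measurableT_comp.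
Qed.

Let measurable_patch A f : measurable A -> measurable_fun A f ->
  measurable_fun setT (f \_ A).
Proof. by move=> mA mf; apply/(measurable_restrictT _ mA). Qed.

Lemma Lq_minkowski q A f g : measurable A -> 1 <= q ->
  measurable_fun A f -> measurable_fun A g ->
  (Lq q A (fun x => f x + g x)%R <= Lq q A f + Lq q A g)%E.
Proof.
move=> mA q1 mf mg; have q0 : 0 < q by apply: lt_le_trans q1.
rewrite -!Lnorm_patch//.
rewrite (_ : (fun x => f x + g x) \_ A = (f \_ A) \+ (g \_ A)).
  by apply: minkowski_EFin => //; exact: measurable_patch.
by apply/funext => x /=; rewrite !patchE; case: ifPn => //; rewrite addr0.
Qed.

Lemma integral_mul_le_Lq A f g a b : measurable A ->
  measurable_fun A f -> measurable_fun A g -> 0 < a -> 0 < b ->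
  a^-1 + b^-1 = 1 ->
  (\int[mu]_(x in A) (`|f x * g x|)%:E <= Lq a A f * Lq b A g)%E.
Proof.
move=> mA mf mg a0 b0 ab; rewrite -!Lnorm_patch//.
apply: le_trans (hoelder mu (measurable_patch mA mf) (measurable_patch mA mg) a0 b0 ab).
rewrite Lnorm1 integral_mkcond; apply: ge0_le_integral_nomeas => x _.
  by rewrite erestrict_ge0.
rewrite /= !patchE; case: ifPn => // _; by rewrite mul0r normr0.
Qed.

(** Hoelder's inequality for the powers |f|^q and |g|^q with the conjugate exponents q1 / q and q2 /
    q. *)
Lemma Lq_hoelder q q1 q2 A f g : measurable A ->
  measurable_fun A f -> measurable_fun A g -> 0 < q -> 0 < q1 -> 0 < q2 ->
  q^-1 = q1^-1 + q2^-1 ->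
  (Lq q A (fun x => f x * g x)%R <= Lq q1 A f * Lq q2 A g)%E.
Proof.
move=> mA mf mg q0 q10 q20 qq.
have mp (h : T -> R) : measurable_fun A h -> measurable_fun A (fun x => `|h x| `^ q).
  by move=> mh; apply: (measurableT_comp (measurable_powR q)); exact: measurableT_comp.
have E c (h : T -> R) : 0 < c -> (Lq (c / q) A (fun x => `|h x| `^ q)%R `^ q^-1 = Lq c A h)%E.
  move=> c0; have e : (c / q)^-1 * q^-1 = c^-1 by rewrite invfM invrK mulfK// gt_eqF.
  rewrite /Lq -[LHS]poweRrM e.
  rewrite (@eq_integral _ _ _ mu A (fun x => (`|h x| `^ c)%:E))// => x _.
  by rewrite ger0_norm ?powR_ge0// -powRrM mulrCA mulfV ?mulr1// gt_eqF.
rewrite -(E q1)// -(E q2)// -poweRM ?Lq_ge0//.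
apply: ge0_poweR_le => //; first by rewrite invr_ge0 ltW.
apply: le_trans (integral_mul_le_Lq mA (mp _ mf) (mp _ mg) _ _ _); last 3 first.
- by rewrite divr_gt0.
- by rewrite divr_gt0.
- by rewrite !invfM !invrK -mulrDl -qq mulVf// gt_eqF.
apply: eqW; apply: eq_integral => x _.
by rewrite [in RHS]ger0_norm ?mulr_ge0 ?powR_ge0// normrM powRM.
Qed.

Lemma Lq_embed q q2 A f : measurable A -> measurable_fun A f ->
  0 < q -> q <= q2 ->
  (Lq q A f <= mu A `^ (q^-1 - q2^-1) * Lq q2 A f)%E.
Proof.
move=> mA mf q0; rewrite le_eqVlt => /predU1P[<-|qq2].
  by rewrite subrr poweRe0 mul1e.
have q20 : 0 < q2 by exact: lt_trans qq2.
have c0 : 0 < q^-1 - q2^-1 by rewrite subr_gt0 ltf_pV2 ?posrE.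
rewrite (@eq_Lq q A f (fun x => cst 1 x * f x))//; last by move=> x _; rewrite mul1r.
apply: le_trans (@Lq_hoelder _ ((q^-1 - q2^-1)^-1) _ _ _ _ mA _ _ q0 _ q20 _) _ => //.
- by rewrite invr_gt0.
- by rewrite invrK subrK.
- by rewrite Lq_cst ?invr_gt0// normr1 mul1e invrK.
Qed.

Lemma Lfun_patchP q A f : measurable A -> 0 < q -> measurable_fun A f ->
  (f \_ A) \in Lfun mu q%:E <-> (Lq q A f < +oo)%E.
Proof.
move=> mA q0 mf; split.
  by move=> /andP[_]; rewrite inE/= /finite_norm Lnorm_patch.
move=> fin; apply/andP; split; first by rewrite inE; exact: measurable_patch.
by rewrite inE/= /finite_norm Lnorm_patch.
Qed.

Lemma LfunTP q f : 0 < q ->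
  f \in Lfun mu q%:E <-> measurable_fun setT f /\ (Lq q setT f < +oo)%E.
Proof.
move=> q0; split.
  by move=> /andP[]; rewrite !inE/= /finite_norm LnormT.
move=> [mf fin]; apply/andP; split; first by rewrite inE.
by rewrite inE/= /finite_norm LnormT.
Qed.

(* Jensen's inequality for the measure with density [w] *)
Lemma weighted_power_mean q A (K w : T -> R) : measurable A -> 1 < q ->
  measurable_fun A K -> measurable_fun A w ->
  (forall x, 0 <= K x) -> (forall x, 0 <= w x) ->
  ((\int[mu]_(x in A) (K x * w x)%:E) `^ q <=
   (\int[mu]_(x in A) (w x)%:E) `^ (q - 1) *
   \int[mu]_(x in A) (K x `^ q * w x)%:E)%E.
Proof.
move=> mA q1 mK mw K0 w0; have q0 : 0 < q by apply: lt_trans q1.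
have qV1 : 0 < 1 - q^-1 by rewrite subr_gt0 invf_lt1.
(* A factorization of [K w], to which Hoelder's inequality with [q] and its conjugate exponent is
   applied. *)
pose f x := K x * w x `^ q^-1; pose g x := w x `^ (1 - q^-1).
have mf : measurable_fun A f.
  by apply: measurable_funM => //; exact: measurableT_comp (measurable_powR _) mw.
have mg : measurable_fun A g by exact: measurableT_comp (measurable_powR _) mw.
have fE : (\int[mu]_(x in A) (K x `^ q * w x)%:E = Lq q A f `^ q)%E.
  rewrite Lq_powR ?gt_eqF//; apply: eq_integral => x _.
  rewrite ger0_norm ?mulr_ge0 ?powR_ge0// powRM ?powR_ge0// -powRrM mulVf ?gt_eqF//.
  by rewrite powRr1.
have gE : (\int[mu]_(x in A) (w x)%:E = Lq (1 - q^-1)^-1 A g `^ (1 - q^-1)^-1)%E.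
  rewrite Lq_powR ?gt_eqF ?invr_gt0//; apply: eq_integral => x _.
  by rewrite ger0_norm ?powR_ge0// -powRrM mulfV ?gt_eqF// powRr1.
rewrite fE gE -poweRrM (_ : (1 - q^-1)^-1 * (q - 1) = q); last first.
  have -> : q - 1 = q * (1 - q^-1) by rewrite mulrBr mulr1 mulfV// gt_eqF.
  by rewrite mulrCA mulVf ?mulr1// gt_eqF.
rewrite -poweRM ?Lq_ge0//; apply: ge0_poweR_le; first exact: ltW.
  by apply: integral_ge0 => x _; rewrite lee_fin mulr_ge0.
rewrite muleC.
apply: le_trans (integral_mul_le_Lq mA mf mg q0 _ _); last 2 first.
- by rewrite invr_gt0.
- by rewrite invrK addrC subrK.
apply: eqW; apply: eq_integral => x _.
rewrite ger0_norm; last by rewrite /f /g !mulr_ge0// powR_ge0.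
rewrite /f /g -mulrA -powRD; last first.
  by rewrite addrC subrK oner_eq0.
by rewrite addrC subrK powRr1.
Qed.

End Lq.
#[global] Hint Resolve int_powR_ge0 : core.

(** * The layer cake formula *)

Lemma powRN_le (R : realType) (x y c : R) : 0 < x -> x <= y -> 0 <= c ->
  y `^ (- c) <= x `^ (- c).
Proof.
move=> x0 xy c0; have y0 : 0 < y by apply: lt_le_trans xy.
rewrite !powRN lef_pV2 ?posrE ?powR_gt0// ge0_ler_powR// nnegrE ltW//.
Qed.

Section layer_cake.
Context d (T : measurableType d) (R : realType).
Variable mu : {sigma_finite_measure set T -> \bar R}.
Variables (rho0 : T -> R) (H : T -> \bar R).
Hypotheses (mrho0 : measurable_fun [set: T] rho0).
Hypotheses (mH : measurable_fun [set: T] H) (H0 : forall x, (0 <= H x)%E).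
Local Notation leb := (@lebesgue_measure R).

Let measurable_lt : measurable [set u : T * R | rho0 u.1 < u.2].
Proof.
rewrite (_ : mkset _ = (fun u : T * R => u.2 - rho0 u.1) @^-1` `]0, +oo[).
  rewrite -[X in measurable X]setTI.
  apply: measurable_funB; [exact: measurable_snd| |exact: measurableT|exact: measurable_itv].
  exact: measurableT_comp mrho0 measurable_fst.
by apply/seteqP; split => u /=; rewrite in_itv/= andbT subr_gt0.
Qed.

Let F (u : T * R) : \bar R := (H u.1 * (\1_[set u | rho0 u.1 < u.2] u)%:E)%E.

Let mF : measurable_fun [set: T * R] F.
Proof.
apply: emeasurable_funM; first exact: measurableT_comp mH measurable_fst.
by apply/measurable_EFinP; exact: measurable_indic.
Qed.

Let F0 u : (0 <= F u)%E.
Proof. by rewrite /F mule_ge0// lee_fin. Qed.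

Let FE t : (\int[mu]_(y in [set y | (rho0 y < t)%R]) H y = \int[mu]_y F (y, t))%E.
Proof.
rewrite integral_mkcond; apply: eq_integral => y _.
rewrite patchE /F/= indicE; case: ifPn => hy.
  by rewrite mem_set/= ?mule1//; exact: set_mem hy.
by rewrite memNset/= ?mule0// => hy'; move/negP: hy; apply; exact: mem_set.
Qed.

Lemma measurable_sublevel_integral : measurable_fun [set: R]
  (fun t => \int[mu]_(y in [set y | (rho0 y < t)%R]) H y)%E.
Proof.
rewrite (_ : (fun _ => _) = fubini_G mu F).
  exact: measurable_fun_fubini_tonelli_G.
by apply/funext => t; rewrite FE.
Qed.

(* Tonelli's theorem, starting from
   [rho0 y `^ (- b) <= 2 `^ (b + 1) * \int_(rho0 y)^(2 * rho0 y) t `^ (- b - 1) dt] *)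
Lemma layer_cake (a b : R) : 0 < a -> 0 < b ->
  (\int[mu]_(y in [set y | (a <= rho0 y)%R]) (H y * (rho0 y `^ (- b))%:E) <=
   (2 `^ (b + 1))%:E * \int[leb]_(t in `]a, +oo[)
     ((t `^ (- b - 1))%:E * \int[mu]_(y in [set y | (rho0 y < t)%R]) H y))%E.
Proof.
move=> a0 b0; set c := 2 `^ (b + 1); have c0 : 0 < c by exact: powR_gt0.
pose w (t : R) : \bar R := (t `^ (- b - 1) * \1_(`]a, +oo[%classic : set R) t)%:E.
have mw : measurable_fun [set: R] w.
  apply/measurable_EFinP; apply: measurable_funM; first exact: measurable_powR.
  exact: measurable_indic.
have w0 t : (0 <= w t)%E by rewrite lee_fin mulr_ge0// powR_ge0.
pose F' (u : T * R) := (F u * w u.2)%E.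
have mF' : measurable_fun [set: T * R] F'.
  by apply: emeasurable_funM => //; exact: measurableT_comp mw measurable_snd.
have F'0 u : (0 <= F' u)%E by rewrite mule_ge0.
have step1 : (\int[mu]_(y in [set y | (a <= rho0 y)%R]) (H y * (rho0 y `^ (- b))%:E) <=
   \int[mu]_y (c%:E * \int[leb]_t F' (y, t)))%E.
  rewrite integral_mkcond; apply: ge0_le_integral_nomeas => y _.
    by rewrite erestrict_ge0// => x _; rewrite mule_ge0// lee_fin powR_ge0.
  rewrite patchE; case: ifPn => [|_]; last first.
    by rewrite mule_ge0 ?lee_fin ?(ltW c0)// integral_ge0.
  rewrite inE/= => ay; have y0 : 0 < rho0 y by apply: lt_le_trans ay.
  have FyE t : F' (y, t) = (H y * ((\1_[set u : T * R | (rho0 u.1 < u.2)%R] (y, t))%:E * w t))%E.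
    by rewrite /F' /F muleA.
  under eq_integral do rewrite FyE.
  have m1 : measurable_fun [set: R]
      (fun t : R => (\1_[set u : T * R | (rho0 u.1 < u.2)%R] (y, t))%:E * w t)%E.
    apply: emeasurable_funM => //; apply/measurable_EFinP.
    rewrite (_ : (fun _ => _) = \1_(`]rho0 y, +oo[%classic : set R)).
      exact: measurable_indic.
    apply/funext => t; rewrite !indicE; congr (nat_of_bool _)%:R.
    by apply/idP/idP; rewrite !inE/= in_itv/= andbT.
  rewrite ge0_integralZl//; last by move=> t _; rewrite mule_ge0// lee_fin.
  rewrite muleCA; apply: lee_wpmul2l => //.
  have -> : (rho0 y `^ (- b))%:E =
      (c%:E * \int[leb]_(t in `]rho0 y, (2 * rho0 y)%R[) ((2 * rho0 y) `^ (- b - 1))%:E)%E.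
    rewrite integral_cst//= lebesgue_measure_itv/= lte_fin.
    rewrite ltr_pMl// ltr1n -EFinB -!EFinM; congr EFin.
    rewrite powRM ?(ltW y0)// /c (_ : 2 * rho0 y - rho0 y = rho0 y); last by ring.
    rewrite !mulrA -powRD; last by rewrite implybE pnatr_eq0/= orbT.
    rewrite (_ : b + 1 + (- b - 1) = 0) ?powRr0 ?mul1r; last by ring.
    rewrite -{3}(powRr1 (ltW y0)) -powRD; last by rewrite (gt_eqF y0) implybT.
    by congr (_ `^ _); ring.
  apply: lee_wpmul2l; first by rewrite lee_fin ltW.
  rewrite [leLHS]integral_mkcond; apply: ge0_le_integral_nomeas => t _.
    by rewrite erestrict_ge0// => x _; rewrite lee_fin powR_ge0.
  rewrite patchE; case: ifPn => [|_]; last by rewrite mule_ge0// lee_fin.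
  rewrite inE/= in_itv/= => /andP[yt t2].
  rewrite indicE mem_set//= mul1e /w indicE mem_set/= ?mulr1; last first.
    by rewrite in_itv/= andbT (le_lt_trans ay).
  rewrite lee_fin -opprD; apply: powRN_le; [exact: lt_trans yt|exact: ltW|].
  by rewrite addr_ge0// ltW.
apply: (le_trans step1).
rewrite ge0_integralZl//; last 3 first.
- exact: measurable_fun_fubini_tonelli_F.
- by move=> y _; exact: integral_ge0.
- by rewrite lee_fin ltW.
apply: lee_wpmul2l; first by rewrite lee_fin ltW.
rewrite fubini_tonelli// [leRHS]integral_mkcond.
apply: ge0_le_integral_nomeas => t _; first exact: integral_ge0.
rewrite patchE /F'/=.
rewrite ge0_integralZr//; last exact: measurableT_comp mF _.
rewrite -FE muleC /w indicE.
by case: ifPn => ta; rewrite ?mulr1// mulr0 mul0e.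
Qed.

End layer_cake.

(** * The potential of the size condition *)

Section potential.
Context {R : realType} (n : nat).
Local Notation mu := (@lebesgue_rV R n).
Local Notation leb := (@lebesgue_measure R).
Variables (P : 'M[R]_n) (rho : 'rV[R]_n -> R).
Hypothesis hrho : quasi_distance P rho.
Local Notation gamma := (\tr P).
Hypothesis gamma0 : 0 < gamma.
Variables (v k : R).
Hypotheses (v0 : 0 < v) (k1 : 1 <= k).
Hypothesis volE : forall x r, 0 < r ->
  mu (ellipsoid rho x r) = (v * r `^ gamma)%:E.
Hypothesis tri : forall x y z, rho (x - y) <= k * (rho (x - z) + rho (y - z)).
Variables (x0 : 'rV[R]_n) (Omega : 'rV[R]_n -> R).
Hypothesis mOmega : measurable_fun [set: 'rV[R]_n] Omega.
Variables (s KO : R).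
Hypotheses (s1 : 1 < s) (KO0 : 0 <= KO).
Hypothesis hOmega : forall t, 0 < t ->
  (\int[mu]_(x in ellipsoid rho 0 t) (`|Omega x| `^ s)%:E <=
   (KO * t `^ gamma)%:E)%E.
Local Notation E := (ellipsoid rho x0).
Local Notation rho0 := (fun y => rho (x0 - y)).
Implicit Types (h : 'rV[R]_n -> R) (x y : 'rV[R]_n).

Let k0 : 0 < k. Proof. exact: lt_le_trans k1. Qed.
Let s0 : 0 < s. Proof. exact: lt_trans s1. Qed.
Let k20 : 0 < 2 * k. Proof. by rewrite mulr_gt0. Qed.

Let mE r : measurable (E r). Proof. exact: (measurable_ellipsoid hrho). Qed.

Lemma measurable_rVB (f : 'rV[R]_n -> R) x : measurable_fun [set: 'rV[R]_n] f ->
  measurable_fun [set: 'rV[R]_n] (fun y => f (x - y)).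
Proof.
move=> mf; rewrite (_ : (fun _ => _) = f \o (fun y => -1 *: y + x)).
  exact: measurableT_comp mf (measurable_rV_affine _ _).
by apply/funext => y /=; rewrite scaleN1r addrC.
Qed.

Lemma measurable_rVB2 (f : 'rV[R]_n -> R) : measurable_fun [set: 'rV[R]_n] f ->
  measurable_fun [set: 'rV[R]_n * 'rV[R]_n] (fun u => f (u.1 - u.2)).
Proof.
move=> mf; apply: (measurableT_comp mf); apply: measurable_rVP => i.
rewrite (_ : (fun _ => _) =
    fun u : 'rV[R]_n * 'rV[R]_n => u.1 ord0 i - u.2 ord0 i); last first.
  by apply/funext => u; rewrite !mxE.
by apply: measurable_funB; apply: measurableT_comp (measurable_coord i) _.
Qed.

Let mrho0 : measurable_fun [set: 'rV[R]_n] rho0.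
Proof. exact: measurable_rVB (qd_measurable hrho). Qed.

Let rho0_ge0 y : 0 <= rho0 y. Proof. exact: qd_ge0 hrho _ _. Qed.

(** The radius 2 k r absorbs the constant of the quasi-triangle inequality: for x in E(x0, r) and y
    in this set, k rho(x0 - x) is at most half of rho(x0 - y), and rho(x - y) is comparable with
    rho(x0 - y). *)
Definition far r : set 'rV[R]_n := [set y | 2 * k * r <= rho (x0 - y)].

Lemma measurable_far r : measurable (far r).
Proof.
rewrite (_ : far r = rho0 @^-1` `[2 * k * r, +oo[).
  by rewrite -[X in measurable X]setTI; apply: mrho0.
by apply/seteqP; split => y; rewrite /far/= in_itv/= andbT.
Qed.

Definition potential r h x : \bar R :=
  \int[mu]_(y in far r) (`|Omega (x - y)| / rho (x - y) `^ gamma * `|h y|)%:E.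

Lemma potential_ge0 r h x : (0 <= potential r h x)%E.
Proof.
apply: integral_ge0 => y _; rewrite lee_fin mulr_ge0// divr_ge0//.
exact: powR_ge0.
Qed.

Lemma measurable_potential_kernel h : measurable_fun [set: 'rV[R]_n] h ->
  measurable_fun [set: 'rV[R]_n * 'rV[R]_n]
  (fun u => `|Omega (u.1 - u.2)| / rho (u.1 - u.2) `^ gamma * `|h u.2|).
Proof.
move=> mh; rewrite (_ : (fun _ => _) = (fun u : 'rV[R]_n * 'rV[R]_n =>
  `|Omega (u.1 - u.2)| * ((rho (u.1 - u.2) `^ gamma) `^ (-1)) * `|h u.2|)); last first.
  by apply/funext => u; rewrite powR_inv1// powR_ge0.
apply: measurable_funM; last by apply: measurableT_comp => //; exact: measurableT_comp.
apply: measurable_funM.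
  by apply: measurableT_comp => //; exact: measurable_rVB2.
apply: (measurableT_comp (measurable_powR _)).
apply: (measurableT_comp (measurable_powR _)).
exact: measurable_rVB2 (qd_measurable hrho).
Qed.

Lemma measurable_potential r h : measurable_fun [set: 'rV[R]_n] h ->
  measurable_fun [set: 'rV[R]_n] (potential r h).
Proof.
move=> mh; rewrite (_ : potential r h = fubini_F mu (fun u : 'rV[R]_n * 'rV[R]_n =>
    (`|Omega (u.1 - u.2)| / rho (u.1 - u.2) `^ gamma * `|h u.2| * \1_(far r) u.2)%:E)).
  apply: measurable_fun_fubini_tonelli_F => [|u]; last first.
    by rewrite lee_fin !mulr_ge0// ?invr_ge0 powR_ge0.
  apply/measurable_EFinP; apply: measurable_funM.
    exact: measurable_potential_kernel.
  by apply: measurableT_comp measurable_snd; apply: measurable_indic; exact: measurable_far.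
apply/funext => x; rewrite /potential /fubini_F [LHS]integral_mkcond; apply: eq_integral => y _.
by rewrite patchE indicE; case: ifPn => _ /=; rewrite ?mulr1// mulr0.
Qed.

Lemma far_lower r x y : 0 < r -> E r x -> far r y ->
  rho0 y <= 2 * k * rho (x - y).
Proof.
move=> r0; rewrite /ellipsoid/far/= => xr yr.
have := tri x0 y x; rewrite (qd_sym hrho y x).
have : k * rho (x0 - x) <= k * r by rewrite ler_pM2l// ltW.
lra.
Qed.

Lemma far_upper r x y : 0 < r -> E r x -> far r y ->
  rho (x - y) < 2 * k * rho0 y.
Proof.
move=> r0; rewrite /ellipsoid/far/= => xr yr.
have := tri x y x0; rewrite (qd_sym hrho x x0) (qd_sym hrho y x0).
have : k * rho (x0 - x) < k * r by rewrite ltr_pM2l.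
have : 2 * k * r <= k * (2 * k * r) by rewrite ler_peMl// mulr_ge0// ltW.
have : k * (2 * k * r) <= k * rho (x0 - y) by rewrite ler_pM2l.
have : 0 < k * r by rewrite mulr_gt0.
lra.
Qed.

Lemma ellipsoid_upper r t x y : r <= t -> E r x -> E t y ->
  rho (x - y) < 2 * k * t.
Proof.
rewrite /ellipsoid/= => rt xr yt.
have := tri x y x0; rewrite (qd_sym hrho x x0) (qd_sym hrho y x0).
have : k * rho (x0 - x) < k * r by rewrite ltr_pM2l.
have : k * rho (x0 - y) < k * t by rewrite ltr_pM2l.
have : k * r <= k * t by rewrite ler_pM2l.
lra.
Qed.

Lemma rho0_far r y : 0 < r -> far r y -> 0 < rho0 y.
Proof. by move=> r0; apply: lt_le_trans; rewrite mulr_gt0. Qed.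

Let OmegaS x := (`|Omega x| `^ s)%:E.

Let mOmegaS : measurable_fun [set: 'rV[R]_n] OmegaS.
Proof.
apply/measurable_EFinP; apply: (measurableT_comp (measurable_powR _)).
exact: measurableT_comp.
Qed.

Let Omega_restr_le t : 0 < t -> (\int[mu]_z (OmegaS \_ (ellipsoid rho 0 t)) z <=
  (KO * t `^ gamma)%:E)%E.
Proof. by move=> t0; rewrite -integral_mkcond; exact: hOmega. Qed.

Let ellipsoid0P t z : ellipsoid rho 0 t z = (rho z < t) :> Prop.
Proof. by rewrite /ellipsoid/= sub0r (rhoN hrho). Qed.

Lemma Lq_Omega_sub c (a : 'rV[R]_n) t (A : set 'rV[R]_n) : `|c| = 1 -> 0 < t ->
  (forall y, A y -> rho (c *: y + a) < t) ->
  (Lq mu s A (fun y => Omega (c *: y + a)) <= ((KO * t `^ gamma) `^ s^-1)%:E)%E.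
Proof.
move=> c1 t0 At; rewrite -poweR_EFin; apply: ge0_poweR_le.
- by rewrite invr_ge0 ltW.
- exact: int_powR_ge0.
apply: le_trans (Omega_restr_le t0).
rewrite (@ge0_integral_rV_affine _ _ c a)//; last 2 first.
- apply/(measurable_restrictT _ (measurable_ellipsoid hrho 0 t)).
  exact: measurable_funTS.
- by move=> z; rewrite erestrict_ge0// => y _; rewrite lee_fin powR_ge0.
rewrite [leLHS]integral_mkcond; apply: ge0_le_integral_nomeas => y _.
  by rewrite erestrict_ge0// => z _; rewrite lee_fin powR_ge0.
rewrite patchE; case: ifPn => [/set_mem/At yt|_].
  by rewrite patchE mem_set// ellipsoid0P.
by rewrite erestrict_ge0// => z _; rewrite lee_fin powR_ge0.
Qed.

(** The substitution z = x - y carries E(x0, t) into the ellipsoid of radius 2 k t about 0, on which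
    the L_s norm of [Omega] is of order t^(gamma / s). *)
Lemma Lq_Omega_y r t x : 0 < r -> r <= t -> E r x ->
  (Lq mu s (E t) (fun y => Omega (x - y)) <=
   ((KO * (2 * k) `^ gamma) `^ s^-1 * t `^ (gamma / s))%:E)%E.
Proof.
move=> r0 rt xr; have t0 : 0 < t by apply: lt_le_trans rt.
rewrite (_ : (fun y => Omega (x - y)) = (fun y => Omega (-1 *: y + x))); last first.
  by apply/funext => y; rewrite scaleN1r addrC.
rewrite (_ : _ * _ = (KO * (2 * k * t) `^ gamma) `^ s^-1); last first.
  rewrite [(2 * k * t) `^ _]powRM ?(ltW t0) ?(ltW k20)// mulrA [RHS]powRM ?powR_ge0//.
    by rewrite -powRrM.
  by rewrite mulr_ge0// powR_ge0.
apply: Lq_Omega_sub; rewrite ?normrN1 ?mulr_gt0// => y yt.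
by rewrite scaleN1r addrC; exact: (ellipsoid_upper rt xr yt).
Qed.

Lemma Lq_Omega_x r y : 0 < r -> far r y ->
  (Lq mu s (E r) (fun x => Omega (x - y)) <=
   ((KO * (2 * k) `^ gamma) `^ s^-1 * rho0 y `^ (gamma / s))%:E)%E.
Proof.
move=> r0 yr; have t0 := rho0_far r0 yr.
rewrite (_ : (fun x => Omega (x - y)) = (fun x => Omega (1 *: x + - y))); last first.
  by apply/funext => x; rewrite scale1r.
rewrite (_ : _ * _ = (KO * (2 * k * rho0 y) `^ gamma) `^ s^-1); last first.
  rewrite [(2 * k * _) `^ _]powRM ?(ltW t0) ?(ltW k20)// mulrA [RHS]powRM ?powR_ge0//.
    by rewrite -powRrM.
  by rewrite mulr_ge0// powR_ge0.
apply: Lq_Omega_sub; rewrite ?normr1 ?mulr_gt0// => x xr.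
by rewrite scale1r; exact: (far_upper r0 xr yr).
Qed.

(** The common output of the layer cake formula; [e] will be - gamma / p or gamma / s - gamma /
    p. *)
Definition tail_integral (e p r : R) h : \bar R :=
  \int[leb]_(t in `]r, +oo[) ((t `^ (e - 1))%:E * Lq mu p (E t) h).

Lemma Lq_ellipsoid_embed q q2 r h : 0 < r -> measurable_fun (E r) h ->
  0 < q -> q <= q2 ->
  (Lq mu q (E r) h <=
   ((v * r `^ gamma) `^ (q^-1 - q2^-1))%:E * Lq mu q2 (E r) h)%E.
Proof.
by move=> r0 mh q0 qq; rewrite -poweR_EFin -(volE x0 r0); exact: Lq_embed.
Qed.

Lemma measurable_Lq_ellipsoid p h : measurable_fun [set: 'rV[R]_n] h ->
  measurable_fun [set: R] (fun t => Lq mu p (E t) h).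
Proof.
move=> mh; apply: (measurableT_comp (measurable_poweR _)).
apply: (measurable_sublevel_integral _ mrho0) => [|y].
  apply/measurable_EFinP; apply: (measurableT_comp (measurable_powR _)).
  exact: measurableT_comp.
by rewrite lee_fin powR_ge0.
Qed.

Let measurable_tail_integrand (c : R) p h : measurable_fun [set: 'rV[R]_n] h ->
  measurable_fun [set: R] (fun t => (t `^ c)%:E * Lq mu p (E t) h)%E.
Proof.
move=> mh; apply: emeasurable_funM; last exact: measurable_Lq_ellipsoid.
by apply/measurable_EFinP; exact: measurable_powR.
Qed.

Let r_lt_far r t : 0 < r -> 2 * k * r < t -> r < t.
Proof. by move=> r0; apply: le_lt_trans; have := k1; nra. Qed.

(* a pointwise bound of the inner integral in the layer cake formula is
   integrated against [t `^ (- b - 1)] *)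
Let layer_cake_tail (H : 'rV[R]_n -> \bar R) (c b e p r : R) h :
  measurable_fun [set: 'rV[R]_n] H -> (forall y, 0 <= H y)%E ->
  measurable_fun [set: 'rV[R]_n] h -> 0 < r -> 0 < b -> 0 <= c ->
  (forall t, r < t -> (\int[mu]_(y in E t) H y <=
     (c * t `^ (e + b))%:E * Lq mu p (E t) h)%E) ->
  (\int[mu]_(y in far r) (H y * (rho0 y `^ (- b))%:E) <=
   (2 `^ (b + 1) * c)%:E * tail_integral e p r h)%E.
Proof.
move=> mH H0 mh r0 b0 c0 Hb; have a0 : 0 < 2 * k * r by rewrite mulr_gt0.
apply: (le_trans (layer_cake mu mrho0 mH H0 a0 b0)).
rewrite EFinM -muleA; apply: lee_wpmul2l; first by rewrite lee_fin powR_ge0.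
rewrite /tail_integral -ge0_integralZl_EFin//; last 2 first.
- by move=> t _; rewrite mule_ge0 ?Lq_ge0// lee_fin powR_ge0.
- exact: measurable_funTS (measurable_tail_integrand _ _ mh).
rewrite [leLHS]integral_mkcond [leRHS]integral_mkcond.
have int0 t : (0 <= (t `^ (- b - 1))%:E * \int[mu]_(y in [set y | (rho (x0 - y) < t)%R]) H y)%E.
  by rewrite mule_ge0 ?lee_fin ?powR_ge0// integral_ge0.
have rhs0 t : (0 <= c%:E * ((t `^ (e - 1))%:E * Lq mu p (E t) h))%E.
  by rewrite !mule_ge0 ?Lq_ge0 ?lee_fin// powR_ge0.
apply: ge0_le_integral_nomeas => t _; first by rewrite erestrict_ge0.
rewrite !patchE; case: ifPn => [|_]; last by case: ifPn.
rewrite inE/= in_itv/= andbT => at_; have rt := r_lt_far r0 at_.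
have t0 : 0 < t by exact: lt_trans rt.
rewrite mem_set/=; last by rewrite in_itv/= rt.
apply: (@le_trans _ _ ((t `^ (- b - 1))%:E * ((c * t `^ (e + b))%:E * Lq mu p (E t) h))%E).
  by apply: lee_wpmul2l; [rewrite lee_fin powR_ge0|exact: Hb].
rewrite !muleA -!EFinM mulrCA -powRD; last by rewrite (gt_eqF t0) implybT.
by rewrite (_ : - b - 1 + (e + b) = e - 1)//; ring.
Qed.

Let far_kernel_le r h x : 0 < r -> E r x -> forall y, far r y ->
  `|Omega (x - y)| / rho (x - y) `^ gamma * `|h y| <=
  (2 * k) `^ gamma * (`|Omega (x - y)| * `|h y| * rho0 y `^ (- gamma)).
Proof.
move=> r0 xr y yr; have y0 := rho0_far r0 yr.
have low := far_lower r0 xr yr.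
have xy0 : 0 < rho (x - y).
  by rewrite -(pmulr_rgt0 _ k20); apply: lt_le_trans low.
rewrite mulrAC [leRHS]mulrCA ler_wpM2l ?mulr_ge0//.
rewrite powRN ler_pdivlMr ?powR_gt0// mulrC ler_pdivrMr ?powR_gt0//.
rewrite -powRM ?(ltW k20) ?(ltW xy0)// ge0_ler_powR ?nnegrE ?(ltW gamma0)//.
exact: ltW (lt_le_trans y0 low).
Qed.

(** Here [s] is conjugate to [p]. Hoelder's inequality on each E(x0, t) costs t^(gamma / s), and the
    layer cake formula with b = gamma turns this into the exponent - gamma / p. *)
Lemma potential_le_sup p : 0 < p -> s^-1 + p^-1 = 1 ->
  exists2 C : R, 0 <= C & forall h r x, measurable_fun [set: 'rV[R]_n] h ->
    0 < r -> E r x ->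
    (potential r h x <= C%:E * tail_integral (- (gamma / p)) p r h)%E.
Proof.
move=> p0 sp; set c := (KO * (2 * k) `^ gamma) `^ s^-1.
exists ((2 * k) `^ gamma * (2 `^ (gamma + 1) * c)).
  by rewrite !mulr_ge0 ?powR_ge0.
move=> h r x mh r0 xr.
pose H y := (`|Omega (x - y)| * `|h y|)%:E.
have mOx : measurable_fun [set: 'rV[R]_n] (fun y => Omega (x - y)).
  exact: measurable_rVB.
have mH : measurable_fun [set: 'rV[R]_n] H.
  by apply/measurable_EFinP; apply: measurable_funM; exact: measurableT_comp.
have H0 y : (0 <= H y)%E by rewrite lee_fin mulr_ge0.
apply: (@le_trans _ _ (((2 * k) `^ gamma)%:E *
    \int[mu]_(y in far r) (H y * (rho0 y `^ (- gamma))%:E))%E).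
  rewrite -ge0_integralZl_EFin//.
  - apply: ge0_le_integral_nomeas => y yr.
      by rewrite lee_fin mulr_ge0// divr_ge0// powR_ge0.
    by rewrite /H -!EFinM lee_fin; exact: (far_kernel_le _ r0 xr yr).
  - exact: measurable_far.
  - by move=> y _; rewrite mule_ge0// lee_fin powR_ge0.
  - apply: measurable_funTS; apply: emeasurable_funM => //.
    apply/measurable_EFinP; exact: measurableT_comp (measurable_powR _) mrho0.
  - exact: powR_ge0.
rewrite EFinM -muleA; apply: lee_wpmul2l; first by rewrite lee_fin powR_ge0.
apply: layer_cake_tail => //; first exact: powR_ge0.
move=> t rt; rewrite (_ : - (gamma / p) + gamma = gamma / s); last first.
  by rewrite -[X in _ + X]mulr1 -sp mulrDr addrC addrK.
apply: (@le_trans _ _ (Lq mu s (E t) (fun y => Omega (x - y)) * Lq mu p (E t) h)%E).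
  apply: le_trans (integral_mul_le_Lq mu (mE t) (measurable_funTS mOx)
    (measurable_funTS mh) s0 p0 sp).
  by apply: ge0_le_integral_nomeas => y _; rewrite ?H0// /H normrM.
apply: lee_wpmul2r; first exact: Lq_ge0.
by apply: (@Lq_Omega_y r) => //; exact: ltW.
Qed.

Let poweR_mulB1 (N : \bar R) q : (0 <= N)%E -> 1 < q ->
  (N `^ (q - 1) * N = N `^ q)%E.
Proof.
move=> N0 q1; rewrite -{2}(poweRe1 N0) -poweRD ?subrK//.
by rewrite /poweRD_def subrK gt_eqF//= (lt_trans ltr01 q1).
Qed.

(** The power rho0^(- gamma) is divided between kernel and density. With [delta] = gamma / s, the
    L_q norm of [K x y] in x over E(x0, r) is bounded independently of y, because the L_s norm of
    Omega (x - y) in x is of order (rho0 y)^(gamma / s). The remaining power [b] is positive since s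
    > 1. *)
Lemma potential_le_mean p q : 1 < p -> 1 < q -> q < s ->
  exists2 C : R, 0 <= C & forall h r, measurable_fun [set: 'rV[R]_n] h -> 0 < r ->
    ((\int[mu]_(x in E r) (potential r h x `^ q)) `^ q^-1 <=
     (C * r `^ (gamma / q - gamma / s))%:E *
     tail_integral (gamma / s - gamma / p) p r h)%E.
Proof.
move=> p1 q1 qs; have p0 : 0 < p by exact: lt_trans p1.
have q0 : 0 < q by exact: lt_trans q1.
set c := (KO * (2 * k) `^ gamma) `^ s^-1; have c0 : 0 <= c by exact: powR_ge0.
pose c3 := v `^ (q^-1 - s^-1) * c; pose delta := gamma / s.
pose b := gamma - delta.
have b0 : 0 < b by rewrite subr_gt0 gtr_pMr// invf_lt1.
exists ((2 * k) `^ gamma * c3 * (2 `^ (b + 1) * v `^ (1 - p^-1))).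
  by rewrite !mulr_ge0 ?powR_ge0.
move=> h r mh r0.
pose K x y := `|Omega (x - y)| * rho0 y `^ (- delta).
pose w y := `|h y| * rho0 y `^ (- b).
have K0 x y : 0 <= K x y by rewrite mulr_ge0// powR_ge0.
have w0 y : 0 <= w y by rewrite mulr_ge0// powR_ge0.
have mrp e : measurable_fun [set: 'rV[R]_n] (fun y => rho0 y `^ e).
  exact: measurableT_comp (measurable_powR _) mrho0.
have mw : measurable_fun [set: 'rV[R]_n] w.
  by apply: measurable_funM => //; exact: measurableT_comp.
have mK x : measurable_fun [set: 'rV[R]_n] (K x).
  apply: measurable_funM => //; apply: measurableT_comp => //.
  exact: measurable_rVB.
have mK2 : measurable_fun [set: 'rV[R]_n * 'rV[R]_n] (fun u => K u.1 u.2).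
  apply: measurable_funM.
    by apply: measurableT_comp => //; exact: measurable_rVB2.
  exact: measurableT_comp (mrp _) measurable_snd.
have mfar := measurable_far r.
pose N := (\int[mu]_(y in far r) (w y)%:E)%E.
have N0 : (0 <= N)%E by apply: integral_ge0 => y _; rewrite lee_fin.
(* The power of [r] is the cost of passing from L_s to L_q on E(x0, r), where [q < s] enters. *)
pose D := c3 * r `^ (gamma / q - delta).
have D0 : 0 <= D by rewrite !mulr_ge0 ?powR_ge0.
have pot x : E r x -> (potential r h x <=
    ((2 * k) `^ gamma)%:E * \int[mu]_(y in far r) (K x y * w y)%:E)%E.
  move=> xr; rewrite -ge0_integralZl_EFin ?powR_ge0//.
  - apply: ge0_le_integral_nomeas => y yr.
      by rewrite lee_fin mulr_ge0// divr_ge0// powR_ge0.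
    rewrite -EFinM lee_fin; apply: (le_trans (far_kernel_le _ r0 xr yr)).
    rewrite ler_pM2l ?powR_gt0// /K /w mulrACA -powRD; last first.
      by rewrite (gt_eqF (rho0_far r0 yr)) implybT.
    by rewrite (_ : - delta - b = - gamma)// /b; ring.
  - by move=> y _; rewrite lee_fin mulr_ge0.
  - by apply/measurable_EFinP; apply: measurable_funTS; exact: measurable_funM.
have Kx y : far r y -> (\int[mu]_(x in E r) (K x y `^ q)%:E <= (D `^ q)%:E)%E.
  move=> yr; have y0 := rho0_far r0 yr.
  have mOy : measurable_fun (E r) (fun x => Omega (x - y)).
    apply: measurable_funTS; rewrite (_ : (fun _ => _) = Omega \o (fun x => 1 *: x - y)).
      exact: measurableT_comp mOmega (measurable_rV_affine _ _).
    by apply/funext => x /=; rewrite scale1r.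
  have LqK : (Lq mu q (E r) (fun x => rho0 y `^ (- delta) * Omega (x - y))%R <= D%:E)%E.
    rewrite LqZ// ger0_norm ?powR_ge0//.
    have Ox := Lq_Omega_x r0 yr.
    have emb := Lq_ellipsoid_embed r0 mOy q0 (ltW qs).
    apply: (@le_trans _ _ ((rho0 y `^ (- delta))%:E *
       (((v * r `^ gamma) `^ (q^-1 - s^-1))%:E *
       (c * rho0 y `^ delta)%:E))%E).
      apply: lee_wpmul2l; first by rewrite lee_fin powR_ge0.
      by apply: (le_trans emb); apply: lee_wpmul2l; [rewrite lee_fin powR_ge0|exact: Ox].
    rewrite -!EFinM lee_fin powRM ?powR_ge0 ?(ltW v0)// -powRrM.
    rewrite (_ : gamma * (q^-1 - s^-1) = gamma / q - delta); last by rewrite mulrBr.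
    rewrite [leLHS](_ : _ = D * (rho0 y `^ (- delta) * rho0 y `^ delta)); last first.
      by rewrite /D /c3; ring.
    by rewrite -powRD ?addNr ?powRr0 ?mulr1// eqxx (gt_eqF y0).
  rewrite [leLHS](_ : _ = (Lq mu q (E r) (fun x => rho0 y `^ (- delta) * Omega (x - y))%R `^ q)%E).
    rewrite -poweR_EFin; apply: ge0_poweR_le => //; [exact: ltW|exact: Lq_ge0].
  rewrite (Lq_powR _ _ _ (lt0r_neq0 q0)); apply: eq_integral => x _.
  by rewrite /K normrM [`|_ `^ _|]ger0_norm ?powR_ge0// mulrC.
(* The layer cake formula with exponent [b], the L_1 norm on each E(x0, t) being bounded by the L_p
   norm. *)
have NT : (N <= (2 `^ (b + 1) * v `^ (1 - p^-1))%:E *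
    tail_integral (gamma / s - gamma / p) p r h)%E.
  rewrite [leLHS](_ : _ = \int[mu]_(y in far r) ((`|h y|)%:E * (rho0 y `^ (- b))%:E))%E//.
  apply: layer_cake_tail => //; [|exact: powR_ge0|].
    by apply/measurable_EFinP; exact: measurableT_comp.
  move=> t rt; have t0 : 0 < t by exact: lt_trans rt.
  have := Lq_ellipsoid_embed t0 (measurable_funTS mh) (@ltr01 R) (ltW p1).
  rewrite {1}/Lq invr1 poweRe1; last exact: int_powR_ge0.
  under eq_integral do rewrite powRr1//.
  move=> /le_trans; apply; apply: lee_wpmul2r; first exact: Lq_ge0.
  rewrite lee_fin powRM ?powR_ge0 ?(ltW v0)// -powRrM.
  rewrite (_ : gamma / s - gamma / p + b = gamma * (1 - p^-1))// /b /delta; ring.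
(* Jensen's inequality with density [w] gives the factor N^(q - 1) and an inner integral of K^q w;
   by Tonelli's theorem the integration in x can be done first and costs D^q for each y, leaving one
   more factor N. *)
have main : (\int[mu]_(x in E r) (potential r h x `^ q) <=
    ((((2 * k) `^ gamma) * D)%:E * N) `^ q)%E.
  clear NT; rewrite {}/N in N0 *; clearbody K w D.
  set N := (\int[mu]_(y in far r) (w y)%:E)%E in N0 *.
  apply: (@le_trans _ _ (\int[mu]_(x in E r) ((((2 * k) `^ gamma) `^ q)%:E *
     (N `^ (q - 1) * \int[mu]_(y in far r) (K x y `^ q * w y)%:E)))%E).
    apply: ge0_le_integral_nomeas => x xr; first exact: poweR_ge0.
    apply: (@le_trans _ _ ((((2 * k) `^ gamma)%:E *
        \int[mu]_(y in far r) (K x y * w y)%:E) `^ q)%E).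
      apply: ge0_poweR_le; [exact: ltW|exact: potential_ge0|exact: pot].
    rewrite poweRM ?lee_fin ?powR_ge0 ?integral_ge0//; last first.
      by move=> y _; rewrite lee_fin mulr_ge0.
    rewrite poweR_EFin; apply: lee_wpmul2l; first by rewrite lee_fin powR_ge0.
    apply: weighted_power_mean => //; exact: measurable_funTS.
  pose G (u : 'rV[R]_n * 'rV[R]_n) : \bar R :=
    ((K u.1 u.2 `^ q * w u.2 * \1_(far r) u.2 * \1_(E r) u.1)%:E)%E.
  have G0 u : (0 <= G u)%E by rewrite lee_fin !mulr_ge0// powR_ge0.
  have mG : measurable_fun [set: 'rV[R]_n * 'rV[R]_n] G.
    apply/measurable_EFinP; apply: measurable_funM; last first.
      by apply: measurableT_comp measurable_fst; apply: measurable_indic.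
    apply: measurable_funM; last first.
      by apply: measurableT_comp measurable_snd; apply: measurable_indic.
    apply: measurable_funM; last exact: measurableT_comp mw measurable_snd.
    exact: (measurableT_comp (measurable_powR q) mK2).
  have GxE x : (\int[mu]_y G (x, y) = (\1_(E r) x)%:E *
      \int[mu]_(y in far r) (K x y `^ q * w y)%:E)%E.
    rewrite [in RHS]integral_mkcond -ge0_integralZl_EFin//.
    - apply: eq_integral => y _; rewrite patchE /G/= [\1_(far r) y]indicE.
      case: ifPn => _; first by rewrite -EFinM mulr1 mulrC.
      by rewrite !(mulr0,mul0r,mule0).
    - by move=> y _; rewrite erestrict_ge0// => z _; rewrite lee_fin mulr_ge0// powR_ge0.
    - apply/(measurable_restrictT _ mfar); apply: measurable_funTS.
      apply/measurable_EFinP; apply: measurable_funM => //.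
      exact: (measurableT_comp (measurable_powR q) (mK x)).
  have IG : (\int[mu]_(x in E r) (\int[mu]_(y in far r) (K x y `^ q * w y)%:E) =
      \int[mu]_x \int[mu]_y G (x, y))%E.
    rewrite [LHS]integral_mkcond; apply: eq_integral => x _; rewrite GxE patchE indicE.
    by case: ifPn => _; rewrite ?mul1e// mul0e.
  have mIy : measurable_fun [set: 'rV[R]_n]
      (fun x => \int[mu]_(y in far r) (K x y `^ q * w y)%:E)%E.
    pose G' (u : 'rV[R]_n * 'rV[R]_n) : \bar R :=
      ((K u.1 u.2 `^ q * w u.2 * \1_(far r) u.2)%:E)%E.
    rewrite (_ : (fun _ => _) = fubini_F mu G').
      apply: measurable_fun_fubini_tonelli_F => [|u].
        apply/measurable_EFinP; apply: measurable_funM; last first.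
          by apply: measurableT_comp measurable_snd; apply: measurable_indic.
        apply: measurable_funM; last exact: measurableT_comp mw measurable_snd.
        exact: (measurableT_comp (measurable_powR q) mK2).
      by rewrite lee_fin !mulr_ge0// powR_ge0.
    apply/funext => x; rewrite /fubini_F [LHS]integral_mkcond; apply: eq_integral => y _.
    by rewrite patchE /G'/= [\1_(far r) y]indicE; case: ifPn => _; rewrite ?mulr1// mulr0.
  have Iy0 x : (0 <= \int[mu]_(y in far r) (K x y `^ q * w y)%:E)%E.
    by apply: integral_ge0 => y _; rewrite lee_fin mulr_ge0// powR_ge0.
  rewrite ge0_integralZl_EFin; last 4 first.
  - exact: mE.
  - by move=> x _; rewrite mule_ge0 ?poweR_ge0.
  - by apply: measurable_funTS; apply: emeasurable_funM; [exact: measurable_cst|].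
  - exact: powR_ge0.
  rewrite ge0_integralZl; last 4 first.
  - exact: mE.
  - exact: measurable_funTS mIy.
  - by move=> x _; exact: Iy0.
  - exact: poweR_ge0.
  rewrite IG fubini_tonelli//.
  have GyE : (\int[mu]_y \int[mu]_x G (x, y) <= (D `^ q)%:E * N)%E.
    rewrite /N -ge0_integralZl_EFin; last 4 first.
    - exact: mfar.
    - by move=> y _; rewrite lee_fin.
    - by apply/measurable_EFinP; exact: measurable_funTS.
    - exact: powR_ge0.
    rewrite [leRHS]integral_mkcond; apply: ge0_le_integral_nomeas => y _.
      exact: integral_ge0.
    rewrite patchE; case: ifPn => [/set_mem yr|yr]; last first.
      rewrite integral0_eq// => x _; rewrite /G/= [\1_(far r) y]indicE (negbTE yr).
      by rewrite !(mulr0,mul0r).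
    have mKy : measurable_fun (E r) (fun x => (K x y `^ q)%:E).
      apply: measurable_funTS; apply/measurable_EFinP.
      apply: (measurableT_comp (measurable_powR q)).
      exact: (measurableT_comp mK2 (pair2_measurable y)).
    rewrite (_ : \int[mu]_x G (x, y) = (w y)%:E * \int[mu]_(x in E r) (K x y `^ q)%:E)%E.
      by rewrite muleC; apply: lee_wpmul2r; [rewrite lee_fin|exact: Kx].
    rewrite -ge0_integralZl_EFin//; last by move=> x _; rewrite lee_fin powR_ge0.
    rewrite [RHS]integral_mkcond; apply: eq_integral => x _.
    rewrite /G/= [\1_(far r) y]indicE mem_set// patchE indicE.
    by case: ifPn => _; rewrite ?mulr0// !mulr1 -EFinM mulrC.
  rewrite [leRHS]poweRM ?lee_fin ?mulr_ge0 ?powR_ge0// poweR_EFin.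
  rewrite [((2 * k) `^ gamma * D) `^ q]powRM ?powR_ge0//.
  rewrite [leRHS](_ : _ = (((2 * k) `^ gamma) `^ q)%:E * ((D `^ q)%:E * N `^ q))%E; last first.
    by rewrite EFinM muleA.
  apply: lee_wpmul2l; first by rewrite lee_fin powR_ge0.
  rewrite -(poweR_mulB1 N0 q1) muleCA; apply: lee_wpmul2l; first exact: poweR_ge0.
  exact: GyE.
apply: (@le_trans _ _ ((((2 * k) `^ gamma) * D)%:E * N)%E).
  have DN0 : (0 <= ((2 * k) `^ gamma * D)%:E * N)%E.
    by rewrite mule_ge0// lee_fin mulr_ge0// powR_ge0.
  rewrite -[leRHS](poweRe1 DN0) -[X in (_ <= _ `^ X)%E](mulfV (lt0r_neq0 q0)).
  rewrite poweRrM; apply: ge0_poweR_le; [by rewrite invr_ge0 ltW| |exact: main].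
  by apply: integral_ge0 => x _; exact: poweR_ge0.
rewrite (_ : _ * r `^ _ = ((2 * k) `^ gamma * D) * (2 `^ (b + 1) * v `^ (1 - p^-1))); last first.
  by rewrite /D /delta; ring.
rewrite [(_ * D * _)%:E]EFinM -muleA; apply: lee_wpmul2l => //.
by rewrite lee_fin mulr_ge0// powR_ge0.
Qed.

(** Brings the pointwise bound into the shape of [potential_le_mean], with 0 in place of gamma / s,
    so that both cases can be treated together. *)
Lemma potential_le_sup_mean p q : 0 < p -> 0 < q -> s^-1 + p^-1 = 1 ->
  exists2 C : R, 0 <= C & forall h r, measurable_fun [set: 'rV[R]_n] h -> 0 < r ->
    ((\int[mu]_(x in E r) (potential r h x `^ q)) `^ q^-1 <=
     (C * r `^ (gamma / q))%:E * tail_integral (- (gamma / p)) p r h)%E.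
Proof.
move=> p0 q0 sp; have [C C0 hC] := potential_le_sup p0 sp.
exists (C * v `^ q^-1); first by rewrite mulr_ge0 ?powR_ge0.
move=> h r mh r0; set tl := tail_integral _ _ _ _.
have tl0 : (0 <= tl)%E.
  by apply: integral_ge0 => t _; rewrite mule_ge0 ?Lq_ge0// lee_fin powR_ge0.
have Ctl0 : (0 <= C%:E * tl)%E by rewrite mule_ge0.
apply: (@le_trans _ _ ((\int[mu]_(x in E r) ((C%:E * tl) `^ q)) `^ q^-1)%E).
  apply: ge0_poweR_le; first by rewrite invr_ge0 ltW.
    by apply: integral_ge0 => x _; exact: poweR_ge0.
  apply: ge0_le_integral_nomeas => x xr; first exact: poweR_ge0.
  by apply: ge0_poweR_le; [exact: ltW|exact: potential_ge0|exact: hC].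
rewrite integral_cst//.
rewrite [X in ((_ * X) `^ _)%E](volE x0 r0) poweRM ?poweR_ge0 ?lee_fin//; last first.
  by rewrite mulr_ge0 ?powR_ge0// ltW.
rewrite -poweRrM divff ?gt_eqF// poweRe1// poweR_EFin powRM ?powR_ge0 ?(ltW v0)//.
rewrite -powRrM muleAC -EFinM; apply: eqW.
by rewrite mulrA.
Qed.

End potential.

(** * Oscillation of Campanato functions *)

Section campanato.
Context {R : realType} (n : nat).
Local Notation mu := (@lebesgue_rV R n).
Variables (P : 'M[R]_n) (rho : 'rV[R]_n -> R).
Hypothesis hrho : quasi_distance P rho.
Local Notation gamma := (\tr P).
Hypothesis gamma0 : 0 < gamma.
Variables (v k : R).
Hypotheses (v0 : 0 < v) (k1 : 1 <= k).
Hypothesis volE : forall x r, 0 < r ->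
  mu (ellipsoid rho x r) = (v * r `^ gamma)%:E.
Hypothesis tri : forall x y z, rho (x - y) <= k * (rho (x - z) + rho (y - z)).
Variable x0 : 'rV[R]_n.
Local Notation E := (ellipsoid rho x0).
Implicit Types (f b h : 'rV[R]_n -> R).

Let mE r : measurable (E r). Proof. exact: (measurable_ellipsoid hrho). Qed.

Lemma ellipsoid_sub_compact x r : exists2 K : set 'rV[R]_n, compact K & ellipsoid rho x r `<=` K.
Proof.
have [M M0 hM] := bounded_rho hrho r.
exists [set y : 'rV[R]_n | forall i, y ord0 i \in `[x ord0 i - M, x ord0 i + M]].
  apply: (@rV_compact _ _ (fun i => `[x ord0 i - M, x ord0 i + M]%classic)).
  by move=> i; exact: segment_compact.
move=> y; rewrite /ellipsoid/= => /ltW/hM xy i.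
rewrite in_itv/= -ler_distl; have := coord_le_enorm (x - y) i.
by rewrite !mxE distrC => /le_trans; apply.
Qed.

Lemma compact_sub_ellipsoid x (K : set 'rV[R]_n) : compact K ->
  exists2 N : nat, (0 < N)%N & K `<=` ellipsoid rho x N%:R.
Proof.
move=> /compact_bounded/bounded_enorm[M hM].
have [M' M'0 hM'] := rho_bounded hrho (\sum_(i < n) (`|x ord0 i| + M)).
exists (Num.truncn M').+1 => // y /hM yM; rewrite /ellipsoid/=.
apply: le_lt_trans (truncnS_gt _); apply: hM'.
apply: (le_trans (enorm_le_sum _)); apply: ler_sum => i _.
rewrite !mxE (le_trans (ler_normB _ _))// lerD2l.
exact: le_trans (coord_le_enorm _ _) yM.
Qed.

Lemma Lploc_Lq q h x r : 0 < q -> Lploc q h -> (Lq mu q (ellipsoid rho x r) h < +oo)%E.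
Proof.
move=> q0 [mh hK]; have [K cK EK] := ellipsoid_sub_compact x r.
apply: (@le_lt_trans _ _ (Lq mu q K h)); first exact: Lq_subset.
have := hK _ cK => /andP[_]; rewrite inE/= /finite_norm.
by rewrite Lnorm_patch.
Qed.

Lemma vol_ellipsoid r : 0 < r -> vol (E r) = v * r `^ gamma.
Proof. by move=> r0; rewrite /vol volE. Qed.

Let vr0 r : 0 < r -> 0 < v * r `^ gamma.
Proof. by move=> r0; rewrite mulr_gt0// powR_gt0. Qed.

Lemma Lq_integrable q h r : 1 <= q -> 0 < r -> measurable_fun (E r) h ->
  (Lq mu q (E r) h < +oo)%E -> mu.-integrable (E r) (EFin \o h).
Proof.
move=> q1 r0 mh hfin; apply/integrableP; split; first exact/measurable_EFinP.
have := Lq_ellipsoid_embed hrho volE r0 mh (@ltr01 R) q1.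
rewrite {1}/Lq invr1 poweRe1; last exact: int_powR_ge0.
under eq_integral do rewrite powRr1//.
move=> /le_lt_trans; apply; rewrite lte_mul_pinfty// lee_fin powR_ge0//.
Qed.

Lemma mean_dist q h (c r : R) : 1 <= q -> 0 < r -> measurable_fun (E r) h ->
  (Lq mu q (E r) h < +oo)%E ->
  (`|mean h (E r) - c|%:E <=
   ((v * r `^ gamma)^-1)%:E * Lq mu 1 (E r) (fun y => h y - c)%R)%E.
Proof.
move=> q1 r0 mh hfin; have ih := Lq_integrable q1 r0 mh hfin.
have mufin : (mu (E r) < +oo)%E by rewrite volE// ltry.
have ic : mu.-integrable (E r) (EFin \o cst c).
  apply/integrableP; split; first by apply/measurable_EFinP; exact: measurable_cst.
  rewrite [ltLHS](_ : _ = \int[mu]_(x in E r) cst `|c|%:E x)%E//.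
  by rewrite integral_cst// lte_mul_pinfty// lee_fin.
have iB : mu.-integrable (E r) (EFin \o (fun y => h y - c)).
  have := integrableB (mE r) ih ic; apply: eq_integrable => // y _.
have -> : mean h (E r) - c =
    (v * r `^ gamma)^-1 * \int[mu]_(y in E r) (h y - c).
  rewrite RintegralB// Rintegral_cst// mulrBr /mean vol_ellipsoid//; congr (_ - _).
  rewrite [fine _](vol_ellipsoid r0) mulrCA mulVf ?mulr1// gt_eqF//.
  exact: vr0.
rewrite normrM ger0_norm ?invr_ge0 ?(ltW (vr0 r0))// EFinM.
apply: lee_wpmul2l; first by rewrite lee_fin invr_ge0 (ltW (vr0 r0)).
rewrite /Lq invr1 poweRe1; last exact: int_powR_ge0.
under eq_integral do rewrite powRr1//.
apply: le_trans (le_abse_integral mu (mE r) (measurable_int _ iB)).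
by rewrite EFin_normr_Rintegral.
Qed.

Section oscillation.
Variables (q lambda B : R) (b : 'rV[R]_n -> R).
Hypotheses (q1 : 1 <= q) (lambda0 : 0 <= lambda) (B0 : 0 <= B).
Hypothesis mb : measurable_fun [set: 'rV[R]_n] b.
Hypothesis bfin : forall r, (Lq mu q (E r) b < +oo)%E.
Hypothesis osc : forall r, 0 < r ->
  (Lq mu q (E r) (fun y => b y - mean b (E r))%R <=
   (B * (v * r `^ gamma) `^ (q^-1 + lambda))%:E)%E.

Let q0 : 0 < q. Proof. exact: lt_le_trans q1. Qed.

Let mbc c A : measurable_fun A (fun y : 'rV[R]_n => b y - c).
Proof. by apply: measurable_funB => //; exact: measurable_funTS. Qed.

(** The factor 2^gamma is the ratio of the volumes of E(x0, 2 r) and E(x0, r); v^lambda comes from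
    the power lambda of the volume in the Campanato norm. *)
Let K0 : R := 2 `^ gamma * v `^ lambda.

Let K00 : 0 <= K0. Proof. by rewrite mulr_ge0// powR_ge0. Qed.

Let mean_double r t : 0 < r -> r <= t -> t <= 2 * r ->
  `|mean b (E r) - mean b (E t)| <= K0 * t `^ (gamma * lambda) * B.
Proof.
move=> r0 rt t2; have t0 : 0 < t by apply: lt_le_trans rt.
rewrite -lee_fin.
apply: (le_trans (mean_dist (mean b (E t)) q1 r0 (measurable_funTS mb) (bfin r))).
apply: (@le_trans _ _ (((v * r `^ gamma)^-1)%:E * (((v * t `^ gamma) `^ (1 - q^-1))%:E *
    (B * (v * t `^ gamma) `^ (q^-1 + lambda))%:E))%E).
  apply: lee_wpmul2l; first by rewrite lee_fin invr_ge0 (ltW (vr0 r0)).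
  apply: (@le_trans _ _ (Lq mu 1 (E t) (fun y => b y - mean b (E t))%R)).
    apply: Lq_subset => // y; rewrite /ellipsoid/= => /lt_le_trans; exact.
  have := Lq_ellipsoid_embed hrho volE t0 (@mbc (mean b (E t)) (E t)) (@ltr01 R) q1.
  rewrite invr1 => /le_trans; apply; apply: lee_wpmul2l; last exact: osc.
  by rewrite lee_fin powR_ge0.
rewrite -!EFinM lee_fin.
have -> : (v * r `^ gamma)^-1 * ((v * t `^ gamma) `^ (1 - q^-1) *
    (B * (v * t `^ gamma) `^ (q^-1 + lambda))) =
  (v * r `^ gamma)^-1 * (v * t `^ gamma) `^ (1 + lambda) * B.
  rewrite [X in _ * X](_ : _ = ((v * t `^ gamma) `^ (1 - q^-1) *
    (v * t `^ gamma) `^ (q^-1 + lambda)) * B); last by ring.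
  rewrite -powRD; last by rewrite (gt_eqF (vr0 t0)) implybT.
  by rewrite mulrA addrA subrK.
apply: ler_wpM2r => //.
rewrite powRD; last by rewrite (gt_eqF (vr0 t0)) implybT.
rewrite powRr1 ?(ltW (vr0 t0))// [(v * t `^ gamma) `^ lambda]powRM ?powR_ge0 ?(ltW v0)//.
rewrite -powRrM /K0 -[leRHS]mulrA [leLHS](_ : _ = (v * r `^ gamma)^-1 * (v * t `^ gamma) *
  (v `^ lambda * t `^ (gamma * lambda))); last by rewrite !mulrA.
apply: ler_wpM2r; first by rewrite mulr_ge0 ?powR_ge0.
rewrite ler_pdivrMl ?vr0// mulrAC -mulrA ler_pM2l//.
by rewrite -powRM ?(ltW r0)// ge0_ler_powR ?nnegrE ?(ltW gamma0) ?(ltW t0)// mulrC mulr_ge0// ltW.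
Qed.

(** Telescoping by halving [t]. Since lambda >= 0, the bounds for the smaller radii are dominated by
    the one at [t], so the steps add up to a multiple of their number even when lambda = 0. *)
Let mean_iter j r t : 0 < r -> r <= t -> t <= 2 ^+ j * r ->
  `|mean b (E r) - mean b (E t)| <= j%:R * (K0 * t `^ (gamma * lambda) * B).
Proof.
elim: j r t => [|j IH] r t r0 rt.
  rewrite expr0 mul1r => tr; have -> : t = r by apply/le_anti; rewrite tr rt.
  by rewrite subrr normr0 mul0r.
move=> tj; have t0 : 0 < t by apply: lt_le_trans rt.
have Kt : 0 <= K0 * t `^ (gamma * lambda) * B by rewrite !mulr_ge0 ?powR_ge0.
have [t2|t2] := leP t (2 * r).
  apply: (le_trans (mean_double r0 rt t2)).
  by rewrite ler_peMl// ler1n.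
have th0 : 0 < t / 2 by rewrite divr_gt0.
have rth : r <= t / 2 by rewrite ler_pdivlMr// mulrC ltW.
have thj : t / 2 <= 2 ^+ j * r by rewrite ler_pdivrMr// mulrC mulrA -exprS.
apply: (le_trans (ler_distD (mean b (E (t / 2))) _ _)).
rewrite -[j.+1]addn1 natrD mulrDl mul1r; apply: lerD.
  apply: (le_trans (IH _ _ r0 rth thj)); apply: ler_wpM2l => //.
  apply: ler_wpM2r => //; apply: ler_wpM2l => //.
  rewrite ge0_ler_powR ?nnegrE ?mulr_ge0 ?(ltW gamma0) ?(ltW th0) ?(ltW t0)//.
  by rewrite ler_pdivrMr// ler_peMr ?ler1n// ltW.
apply: mean_double => //; first by rewrite ler_pdivrMr// ler_peMr ?ler1n// ltW.
by rewrite mulrC divfK.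
Qed.

Let K1 : R := (1 + (ln 2)^-1) * K0.

Lemma mean_log r t : 0 < r -> r <= t ->
  `|mean b (E r) - mean b (E t)| <=
  K1 * (1 + ln (t / r)) * t `^ (gamma * lambda) * B.
Proof.
move=> r0 rt; have t0 : 0 < t by apply: lt_le_trans rt.
have ln2 : 0 < ln 2 :> R by rewrite ln_gt0// ltr1n.
have tr1 : 1 <= t / r by rewrite ler_pdivlMr// mul1r.
have lntr : 0 <= ln (t / r) by exact: ln_ge0.
pose y := ln (t / r) / ln 2.
have y0 : 0 <= y by rewrite divr_ge0// ltW.
(* A number of doublings that leads from [r] to at least [t]; it is at most 1 + ln (t / r) / ln 2,
   which explains the factor in [K1]. *)
pose j := (Num.truncn y).+1.
have tj : t <= 2 ^+ j * r.
  rewrite -ler_pdivrMr//; rewrite -[leLHS]lnK ?posrE ?divr_gt0//.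
  rewrite -[2 in leRHS]lnK ?posrE// -expRM_natl ler_expR.
  rewrite -ler_pdivrMr//; exact: ltW (truncnS_gt _).
apply: (le_trans (mean_iter r0 rt tj)).
have -> : K1 * (1 + ln (t / r)) * t `^ (gamma * lambda) * B =
    ((1 + (ln 2)^-1) * (1 + ln (t / r))) * (K0 * t `^ (gamma * lambda) * B).
  by rewrite /K1; ring.
apply: ler_wpM2r; first by rewrite !mulr_ge0 ?powR_ge0.
apply: (@le_trans _ _ (1 + y)).
  by rewrite /j -[_.+1]addn1 natrD addrC lerD2l truncn_le.
rewrite mulrDl !mul1r mulrDr mulr1 /y [ln (t / r) / _]mulrC.
by rewrite -addrA lerD2l -[leLHS]add0r lerD// -[leLHS]add0r lerD// invr_ge0 ltW.
Qed.

(** The first summand is the oscillation of b on E(x0, t) about its own mean, the second the drift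
    of the mean between the radii [r] and [t]. *)
Definition osc_const : R := v `^ (q^-1 + lambda) + K1 * v `^ q^-1.

Lemma osc_const_ge0 : 0 <= osc_const.
Proof.
have ln2 : 0 < ln 2 :> R by rewrite ln_gt0// ltr1n.
by rewrite addr_ge0 ?mulr_ge0 ?powR_ge0// addr_ge0// invr_ge0 ltW.
Qed.

Lemma campanato_log r t : 0 < r -> r <= t ->
  (Lq mu q (E t) (fun y => b y - mean b (E r))%R <=
   (osc_const * (1 + ln (t / r)) * t `^ (gamma / q + gamma * lambda) * B)%:E)%E.
Proof.
move=> r0 rt; have t0 : 0 < t by apply: lt_le_trans rt.
have lntr : 0 <= ln (t / r) by rewrite ln_ge0// ler_pdivlMr// mul1r.
rewrite (_ : (fun y => b y - mean b (E r)) = (fun y => (b y - mean b (E t)) +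
    cst (mean b (E t) - mean b (E r)) y)); last by apply/funext => y /=; ring.
apply: le_trans (Lq_minkowski mu (mE t) q1 (@mbc _ (E t)) (@measurable_cst _ _ _ _ _ _)) _.
rewrite Lq_cst//.
rewrite (_ : (mu (E t) `^ q^-1)%E = ((v * t `^ gamma) `^ q^-1)%:E); last first.
  by rewrite -poweR_EFin -(volE x0 t0).
apply: (@le_trans _ _ ((B * (v * t `^ gamma) `^ (q^-1 + lambda))%:E +
   ((K1 * (1 + ln (t / r)) * t `^ (gamma * lambda) * B) * (v * t `^ gamma) `^ q^-1)%:E)%E).
  apply: leeD; first exact: osc.
  rewrite -EFinM lee_fin; apply: ler_wpM2r; first exact: powR_ge0.
  by rewrite distrC; exact: mean_log.
rewrite -EFinD lee_fin !powRM ?(ltW v0) ?powR_ge0// -!powRrM mulrDr.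
have tE : t `^ (gamma / q + gamma * lambda) = t `^ (gamma * lambda) * t `^ (gamma / q).
  by rewrite addrC powRD// (gt_eqF t0) implybT.
rewrite !tE.
set a := t `^ (gamma * lambda); set c := t `^ (gamma * q^-1).
have ac0 : 0 <= a * c by rewrite mulr_ge0 ?powR_ge0.
rewrite /osc_const.
have -> : (v `^ (q^-1 + lambda) + K1 * v `^ q^-1) * (1 + ln (t / r)) * (a * c) * B =
   B * (v `^ (q^-1 + lambda) * (a * c)) +
   K1 * (1 + ln (t / r)) * a * B * (v `^ q^-1 * c) +
   v `^ (q^-1 + lambda) * ln (t / r) * (a * c) * B by ring.
by rewrite lerDl !mulr_ge0 ?powR_ge0.
Qed.

End oscillation.

Lemma LC_norm_ge0 q lambda b : (0 <= LC_norm rho q lambda x0 b)%E.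
Proof.
apply: (le_trans _ (ereal_sup_ubound _)); last by exists 1 => /=.
exact: poweR_ge0.
Qed.

Lemma LC_normP q lambda b : 0 < q -> (LC_norm rho q lambda x0 b < +oo)%E ->
  forall r, 0 < r -> (Lq mu q (E r) (fun y => b y - mean b (E r))%R <=
   (fine (LC_norm rho q lambda x0 b) * (v * r `^ gamma) `^ (q^-1 + lambda))%:E)%E.
Proof.
move=> q0 bfin r r0; set N := LC_norm _ _ _ _ _ in bfin *.
have vr := vr0 r0.
have le : (((((v * r `^ gamma) `^ (1 + lambda * q))^-1)%:E *
    \int[mu]_(y in E r) (`|b y - mean b (E r)| `^ q)%:E) `^ q^-1 <= N)%E.
  rewrite -(vol_ellipsoid r0); apply: ereal_sup_ubound => /=.
  by exists r.
have N0 : (0 <= N)%E by apply: le_trans le; exact: poweR_ge0.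
have Nfin : N \is a fin_num by rewrite ge0_fin_numE.
move: le; rewrite poweRM ?lee_fin ?invr_ge0 ?powR_ge0//; last exact: int_powR_ge0.
rewrite poweR_EFin -powRN -powRrM -[X in (_ * X)%E]/(Lq mu q (E r) _) => le.
rewrite EFinM fineK// muleC -lee_pdivrMl ?powR_gt0//.
apply: le_trans le; rewrite -powRN.
by rewrite (_ : - (1 + lambda * q) * q^-1 = - (q^-1 + lambda))//; field; rewrite gt_eqF.
Qed.

End campanato.

(** * Truncations *)

Section measurable_limn.
Context d (T : measurableType d) (R : realType).
Variable u : nat -> T -> R.
Hypothesis mu_ : forall N, measurable_fun [set: T] (u N).

Let cvg_setE : [set x | cvgn (fun N => u N x)] =
  \bigcap_k \bigcup_M \bigcap_N [set x | `|u (M + N)%N x - u M x| <= k.+1%:R^-1].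
Proof.
apply/seteqP; split => x /=.
  move=> ux k _; have k0 : 0 < k.+1%:R^-1 / 2 :> R by rewrite divr_gt0.
  have /cvgrPdist_le/(_ _ k0)[M _ hM] := ux.
  exists M => // N _ /=.
  rewrite (le_trans (ler_distD (limn (fun N => u N x)) _ _))// [leRHS]splitr.
  apply: lerD; last by apply: hM => /=.
  by rewrite distrC; apply: hM => /=; exact: leq_addr.
move=> hx; apply/cauchy_cvgP; apply: cauchy_exP => e e0.
have [k ke] := ex_natSinv_lt e0.
have [M _ hM] := hx k I; exists (u M x), M => // N /= MN.
rewrite /ball/= distrC; apply: le_lt_trans ke.
by have := hM (N - M)%N I; rewrite /= subnKC.
Qed.

Let measurable_cvg_set : measurable [set x | cvgn (fun N => u N x)].
Proof.
rewrite cvg_setE; apply: bigcapT_measurable => k.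
apply: bigcup_measurable => M _; apply: bigcapT_measurable => N.
rewrite (_ : mkset _ = (fun x => `|u (M + N)%N x - u M x|) @^-1` `]-oo, k.+1%:R^-1]).
  rewrite -[X in measurable X]setTI.
  have : measurable_fun [set: T] (fun x => `|u (M + N)%N x - u M x|).
    by apply: measurableT_comp => //; exact: measurable_funB.
  by apply.
by apply/seteqP; split => x /=; rewrite in_itv.
Qed.

(** The set of convergence is measurable by the Cauchy criterion, and outside it [limn] has its
    default value 0; so the function is the everywhere existing limit of the sequence multiplied by
    the indicator of that set. *)
Lemma measurable_limn : measurable_fun [set: T] (fun x => limn (fun N => u N x)).
Proof.
pose D := [set x | cvgn (fun N => u N x)].
apply/measurable_EFinP.
apply: (emeasurable_fun_cvg (fun N x => (\1_D x * u N x)%:E)) => [N|x _].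
  by apply/measurable_EFinP; apply: measurable_funM => //; exact: measurable_indic.
apply: cvg_EFin; first exact: nearW.
rewrite /comp/= indicE; have [/set_mem Dx|Dx] := boolP (x \in D).
  by under eq_fun do rewrite mul1r.
rewrite dvgP; last by move=> h; move/negP: Dx; apply; exact: mem_set.
by under eq_fun do rewrite mul0r; exact: cvg_cst.
Qed.

End measurable_limn.

Lemma limn_einf_ge (R : realType) (l : \bar R) (u : (\bar R)^nat) :
  (\forall N \near \oo, l <= u N)%E -> (l <= limn_einf u)%E.
Proof.
move=> [M _ lu]; rewrite limn_einf_lim; apply: lime_ge; first exact: is_cvg_einfs.
exists M => // N /= MN; apply: le_ereal_inf_tmp => _ [m /= Nm <-].
by apply: lu; exact: leq_trans Nm.
Qed.

(* the increments of [u] are dominated by those of the monotone bounded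
   sequence [a] *)
Lemma cvg_dominated_increments (R : realType) (u a : nat -> R) (M : nat) (c S : R) :
  0 <= c -> (forall N, a N <= S) ->
  (forall L N, (M <= L)%N -> (L <= N)%N -> `|u N - u L| <= c * (a N - a L)) ->
  (forall L N, (L <= N)%N -> a L <= a N) ->
  cvgn u.
Proof.
move=> c0 aS ua nda.
have cva : cvgn a.
  apply: nondecreasing_is_cvgn; first by move=> i j; exact: nda.
  by exists S => _ [N _ <-].
(* From the index [M] on, [c * a + u] is also nondecreasing and bounded, and [u] is the difference
   of two convergent sequences. *)
have cvw : cvgn (fun N => c * a (N + M)%N + u (N + M)%N).
  apply: nondecreasing_is_cvgn => [i j ij|].
    have := ua (i + M)%N (j + M)%N; rewrite leq_addl leq_add2r => /(_ isT ij).
    by rewrite ler_norml => /andP[h _]; lra.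
  exists (c * S + (u M + c * (S - a M))) => _ [N _ <-].
  apply: lerD; first by apply: ler_wpM2l.
  have := ua M (N + M)%N (leqnn M) (leq_addl _ _).
  rewrite ler_norml => /andP[_ h]; rewrite -lerBlDl (le_trans h)//.
  by apply: ler_wpM2l => //; rewrite lerD2r.
have cvaM : cvgn (fun N => c * a (N + M)%N).
  by apply: is_cvgMr; apply/cvg_ex; exists (limn a); rewrite cvg_shiftn.
have : cvgn (fun N => u (N + M)%N).
  rewrite (_ : (fun N => u (N + M)%N) =
    (fun N => (c * a (N + M)%N + u (N + M)%N) - c * a (N + M)%N)); last first.
    by apply/funext => N; rewrite addrAC subrr add0r.
  exact: is_cvgB.
by move=> /cvg_ex[l ul]; apply/cvg_ex; exists l; rewrite -(cvg_shiftn M).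
Qed.

(** * The operator on truncations and its extension *)

Section operator.
Context {R : realType} (n : nat).
Local Notation mu := (@lebesgue_rV R n).
Variables (P : 'M[R]_n) (rho : 'rV[R]_n -> R).
Hypothesis hrho : quasi_distance P rho.
Local Notation gamma := (\tr P).
Variables (v k : R).
Hypotheses (v0 : 0 < v) (k1 : 1 <= k).
Hypothesis volE : forall x r, 0 < r ->
  mu (ellipsoid rho x r) = (v * r `^ gamma)%:E.
Hypothesis tri : forall x y z, rho (x - y) <= k * (rho (x - z) + rho (y - z)).
Variables (x0 : 'rV[R]_n) (Omega : 'rV[R]_n -> R).
Hypothesis mOmega : measurable_fun [set: 'rV[R]_n] Omega.
Variables (T : ('rV[R]_n -> R) -> 'rV[R]_n -> R) (c0 : R).
Hypothesis c00 : 0 <= c0.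
Hypothesis Tlin : linear_ae T.
Hypothesis Tsize : forall f, f \in Lfun mu 1%E -> compact (supp f) ->
  forall x, ~ supp f x -> (`|T f x|%:E <= c0%:E * \int[mu]_y
    (`|Omega (x - y)| / rho (x - y) `^ gamma * `|f y|)%:E)%E.
Hypothesis Tbounded : forall q : R, 1 < q -> Lq_bounded T q.
Local Notation E := (ellipsoid rho x0).
Local Notation E0 := (ellipsoid rho 0).
Local Notation far := (far rho k x0).
Local Notation potential := (potential P rho k x0 Omega).
Implicit Types (f h : 'rV[R]_n -> R) (A : set 'rV[R]_n).

Let mell x r : measurable (ellipsoid rho x r).
Proof. exact: (measurable_ellipsoid hrho). Qed.

Let kernel (x y : 'rV[R]_n) : R := `|Omega (x - y)| / rho (x - y) `^ gamma.

Let kernel_ge0 x y : 0 <= kernel x y.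
Proof. by rewrite divr_ge0// powR_ge0. Qed.

Let measurable_kernel x h : measurable_fun [set: 'rV[R]_n] h ->
  measurable_fun [set: 'rV[R]_n] (fun y => (kernel x y * `|h y|)%:E).
Proof.
move=> mh; apply/measurable_EFinP.
exact: (measurableT_comp (measurable_potential_kernel hrho mOmega mh)
         (pair1_measurable x)).
Qed.

Lemma supp_patch_compact A h (K : set 'rV[R]_n) : compact K -> A `<=` K ->
  compact (supp (h \_ A)).
Proof.
move=> cK AK; have cl : closed K by apply: compact_closed cK; exact: norm_hausdorff.
apply: (subclosed_compact _ cK); first exact: closed_closure.
apply: (@subset_trans _ (closure K)); last exact: cl.
apply: closure_subset => y /=; rewrite patchE; case: ifPn => [/set_mem/AK//|_].
by rewrite eqxx.
Qed.

(** The size condition requires x to avoid the closed support, hence a whole cube around x to avoid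
    [A]. On a cube where rho (x - y) < r, the quasi-triangle inequality gives rho (x0 - y) < 2 k r,
    which excludes [far r]. *)
Lemma not_supp_patch r x h A : 0 < r -> E r x -> A `<=` far r ->
  ~ supp (h \_ A) x.
Proof.
move=> r0 xr Afar; have [d d0 hd] := rho_small hrho r0.
have n1 : 0 < n%:R + 1 :> R by rewrite ltr_wpDl.
have e0 : 0 < d / (n%:R + 1) by rewrite divr_gt0.
move=> /(_ (ball x (d / (n%:R + 1))))[]; first exact: nbhsx_ballx.
move=> y [/=]; rewrite patchE; case: ifPn => [/set_mem/Afar yr _|_]; last first.
  by rewrite eqxx.
rewrite rV_ballE// => xy.
have dxy : enorm (x - y) < d.
  apply: (le_lt_trans (enorm_le_sum _)).
  apply: (@le_lt_trans _ _ (\sum_(i < n) (d / (n%:R + 1)))).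
    by apply: ler_sum => i _; rewrite !mxE; exact: ltW.
  rewrite sumr_const card_ord -[ltLHS]mulr_natr mulrAC ltr_pdivrMr//.
  by rewrite ltr_pM2l// ltrDl.
have k0 : 0 < k by exact: lt_le_trans k1.
move: yr xr; rewrite /far/ellipsoid/= => yr xr.
have := tri x0 y x; rewrite (qd_sym hrho y x).
have := hd _ dxy.
have : k * (rho (x0 - x) + rho (x - y)) < k * (r + r).
  by rewrite ltr_pM2l// ltrD//; exact: hd.
lra.
Qed.

Section truncated.
Variables (p0 : R) (h : 'rV[R]_n -> R).
Hypotheses (p01 : 1 < p0) (hloc : Lploc p0 h).

Let p00 : 0 < p0. Proof. exact: lt_trans p01. Qed.
Let mh : measurable_fun [set: 'rV[R]_n] h. Proof. exact: hloc.1. Qed.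

Lemma Lfun_cut A x r : measurable A -> A `<=` ellipsoid rho x r ->
  h \_ A \in Lfun mu p0%:E.
Proof.
move=> mA AE; apply/(Lfun_patchP mu mA p00 (measurable_funTS mh)).
by apply: le_lt_trans (Lploc_Lq hrho x r p00 hloc); exact: Lq_subset.
Qed.

Lemma Lfun1_cut A x r : 0 < r -> measurable A -> A `<=` ellipsoid rho x r ->
  h \_ A \in Lfun mu 1%E.
Proof.
move=> r0 mA AE; apply/(Lfun_patchP mu mA (@ltr01 R) (measurable_funTS mh)).
apply: (@le_lt_trans _ _ (Lq mu 1 (ellipsoid rho x r) h)); first exact: Lq_subset.
apply: le_lt_trans (Lq_ellipsoid_embed hrho volE r0 (measurable_funTS mh) (@ltr01 R) (ltW p01)) _.
apply: lte_mul_pinfty => //; first by rewrite lee_fin powR_ge0.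
exact: (Lploc_Lq hrho x r p00 hloc).
Qed.

Lemma op_domain_cut A x r : measurable A -> A `<=` ellipsoid rho x r ->
  op_domain (h \_ A).
Proof. by move=> mA AE; left; exists p0 => //; exact: Lfun_cut AE. Qed.

Lemma T_cutD A B x r : measurable A -> measurable B -> A `<=` B ->
  B `<=` ellipsoid rho x r ->
  {ae mu, forall y, T (h \_ B) y - T (h \_ A) y = T (h \_ (B `\` A)) y}.
Proof.
move=> mA mB AB BE.
have mBA : measurable (B `\` A) by exact: measurableD.
have BAE : B `\` A `<=` ellipsoid rho x r by move=> y [/BE].
have AE : A `<=` ellipsoid rho x r by move=> y /AB /BE.
have hE : (fun y => 1 * (h \_ A) y + (h \_ (B `\` A)) y) = h \_ B.
  apply/funext => y; rewrite mul1r !patchE in_setD.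
  have [/set_mem/AB/mem_set ->|Ay] := boolP (y \in A); first by rewrite andbF addr0.
  by rewrite add0r andbT.
have := @Tlin 1 _ _ (op_domain_cut mA AE) (op_domain_cut mBA BAE).
rewrite hE => /(_ (op_domain_cut mB BE)).
by apply: filterS => y ->; rewrite mul1r addrAC subrr add0r.
Qed.

Lemma T_cut_le r x A y t : 0 < r -> E r x -> measurable A -> A `<=` far r ->
  0 < t -> A `<=` ellipsoid rho y t ->
  (`|T (h \_ A) x|%:E <= c0%:E * \int[mu]_(z in A) (kernel x z * `|h z|)%:E)%E.
Proof.
move=> r0 xr mA Afar t0 At; have [K cK EK] := ellipsoid_sub_compact hrho y t.
have AK : A `<=` K by move=> z /At /EK.
apply: (le_trans (Tsize (Lfun1_cut t0 mA At) (supp_patch_compact cK AK)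
  (not_supp_patch r0 xr Afar))).
apply: lee_wpmul2l => //; rewrite [leRHS]integral_mkcond.
apply: ge0_le_integral_nomeas => z _.
  by rewrite lee_fin mulr_ge0//; exact: kernel_ge0.
by rewrite !patchE; case: ifPn => // _; rewrite normr0 mulr0.
Qed.

Let u N x := T (h \_ (E0 N%:R)) x.

Let measurable_u N : measurable_fun [set: 'rV[R]_n] (u N).
Proof.
have [C hC] := Tbounded p01.
by have [/andP[/[!inE]/= ? _] _] := hC _ (Lfun_cut (mell 0 N%:R) (@subset_refl _ _)).
Qed.

(** Truncations are centred at 0, the near and far parts at [x0]; this reconciles the two
    families. *)
Lemma ellipsoid_exhaust r : exists2 M : nat, (0 < M)%N & E r `<=` E0 M%:R.
Proof.
have [K cK EK] := ellipsoid_sub_compact hrho x0 r.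
have [M M0 KM] := compact_sub_ellipsoid hrho 0 cK.
by exists M => // y /EK /KM.
Qed.

Let E0_le (M N : nat) : (M <= N)%N -> E0 M%:R `<=` E0 N%:R.
Proof. by move=> MN y; rewrite /ellipsoid/= => /lt_le_trans; apply; rewrite ler_nat. Qed.

Let farC r : ~` (far r) = E (2 * k * r).
Proof.
by apply/seteqP; split => y; rewrite /far/ellipsoid/= ltNge => /negP.
Qed.

Hypothesis pot_fin : forall r, 0 < r ->
  {ae mu, forall x, E r x -> (potential r h x < +oo)%E}.

(** From the index [M] on, the truncations contain the near part, so every later change is supported
    in the far region, where the size condition applies. The increments of T are then dominated by
    those of the kernel integrals over [F N], which increase and stay below the finite potential. *)
Let cut_near r : 0 < r ->
  {ae mu, forall x, E r x -> exists l : R, [/\ (fun N => u N x) @ \oo --> l &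
     (`|l - T (h \_ (E (2 * k * r))) x|%:E <= c0%:E * potential r h x)%E]}.
Proof.
move=> r0; have [M M0 EM] := ellipsoid_exhaust (2 * k * r).
have H1 : {ae mu, forall x, forall N, (M <= N)%N ->
    u N x - T (h \_ (E (2 * k * r))) x = T (h \_ (E0 N%:R `\` E (2 * k * r))) x}.
  apply: ae_foralln => N; have [MN|NM] := leqP M N; last first.
    exact: aeW.
  have sub : E (2 * k * r) `<=` E0 N%:R by move=> y /EM; exact: E0_le.
  by apply: filterS (T_cutD (mell _ _) (mell _ _) sub (@subset_refl _ _)).
have H2 : {ae mu, forall x, forall L N, (L <= N)%N ->
    u N x - u L x = T (h \_ (E0 N%:R `\` E0 L%:R)) x}.
  apply: ae_foralln => L; apply: ae_foralln => N.
  have [LN|NL] := leqP L N; last first.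
    exact: aeW.
  by apply: filterS (T_cutD (mell _ _) (mell _ _) (E0_le LN) (@subset_refl _ _)).
have := pot_fin r0.
apply: filterS3 H1 H2 => x h1 h2 pfin xr; have {}pfin := pfin xr.
pose F N := far r `&` E0 N%:R.
have mF N : measurable (F N).
  by apply: measurableI; [exact: (measurable_far hrho)|exact: mell].
pose I A := (\int[mu]_(z in A) (kernel x z * `|h z|)%:E)%E.
have I0 A : (0 <= I A)%E by apply: integral_ge0 => z _; rewrite lee_fin mulr_ge0.
have I_le A B : A `<=` B -> (I A <= I B)%E.
  by move=> AB; apply: ge0_subset_integral_nomeas => // z; rewrite lee_fin mulr_ge0.
have IF N : (I (F N) <= potential r h x)%E by apply: I_le => z [].
have Ifin N : I (F N) \is a fin_num.
  by rewrite ge0_fin_numE// (le_lt_trans (IF N)).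
have pf : potential r h x \is a fin_num.
  by rewrite ge0_fin_numE// potential_ge0.
pose a N := fine (I (F N)).
have aE N : (a N)%:E = I (F N) by rewrite fineK.
have Mpos N : (M <= N)%N -> (0 : R) < N%:R.
  by move=> MN; rewrite ltr0n (leq_trans M0).
have inc L N : (M <= L)%N -> (L <= N)%N -> `|u N x - u L x| <= c0 * (a N - a L).
  move=> ML LN; rewrite h2// -lee_fin.
  have subfar : E0 N%:R `\` E0 L%:R `<=` far r.
    move=> z [_ zL]; rewrite -[far r]setCK farC => zE.
    by apply: zL; apply: (E0_le ML); exact: EM.
  have mNL : measurable (E0 N%:R `\` E0 L%:R) by apply: measurableD.
  have subN : E0 N%:R `\` E0 L%:R `<=` E0 N%:R by move=> z [].
  apply: (le_trans (T_cut_le r0 xr mNL subfar (Mpos _ (leq_trans ML LN)) subN)).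
  rewrite EFinM; apply: lee_wpmul2l => //; rewrite EFinB !aE.
  rewrite leeBrDr// -[X in (X <= _)%E]/(I _ + I _)%E.
  rewrite /I -ge0_integral_setU//.
  - by apply: I_le => z [[z1 z2]|[z1 z2]]; split => //; [exact: subfar|exact: (E0_le LN)].
  - by apply: measurable_funTS; exact: measurable_kernel.
  - by move=> z _; rewrite lee_fin mulr_ge0.
  - by apply/eqP; apply/seteqP; split => // z [[_ z1] [_ z2]].
have nda L N : (L <= N)%N -> a L <= a N.
  by move=> LN; rewrite -lee_fin !aE; apply: I_le => z [? ?]; split => //; exact: (E0_le LN).
have aS N : a N <= fine (potential r h x) by rewrite -lee_fin aE fineK.
have cvu := cvg_dominated_increments c00 aS inc nda.
exists (limn (fun N => u N x)); split => //.
rewrite -(fineK pf) -EFinM lee_fin.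
have cvd : (fun N => `|u N x - T (h \_ (E (2 * k * r))) x|) @ \oo -->
    `|limn (fun N => u N x) - T (h \_ (E (2 * k * r))) x|.
  by apply: cvg_norm; apply: cvgB => //; exact: cvg_cst.
rewrite -(cvg_lim (@norm_hausdorff _ _) cvd).
apply: limr_le; first by apply/cvg_ex; eexists; exact: cvd.
exists M => // N /= MN; rewrite h1// -lee_fin.
have mN : measurable (E0 N%:R `\` E (2 * k * r)) by apply: measurableD.
have subfar : E0 N%:R `\` E (2 * k * r) `<=` far r.
  by move=> z [_]; rewrite -farC => /contrapT.
have subN : E0 N%:R `\` E (2 * k * r) `<=` E0 N%:R by move=> z [].
apply: (le_trans (T_cut_le r0 xr mN subfar (Mpos _ MN) subN)).
rewrite EFinM fineK//; apply: lee_wpmul2l => //.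
exact: I_le.
Qed.

Let exhaust_ae (Q : 'rV[R]_n -> Prop) :
  (forall r, 0 < r -> {ae mu, forall x, E r x -> Q x}) -> {ae mu, forall x, Q x}.
Proof.
move=> hQ; have := @ae_foralln _ _ _ mu (fun N x => E N.+1%:R x -> Q x).
move=> /(_ (fun N => hQ N.+1%:R (ltr0Sn R N))).
apply: filterS => x; apply; rewrite /ellipsoid/=; exact: truncnS_gt.
Qed.

Let cvg_u : {ae mu, forall x, cvgn (fun N => u N x)}.
Proof.
apply: exhaust_ae => r r0; apply: filterS (cut_near r0) => x hx /hx[l [ul _]].
by apply/cvg_ex; exists l.
Qed.

Let LqTP q f : 1 < q -> f \in Lfun mu q%:E ->
  measurable_fun setT f /\ (Lq mu q setT f < +oo)%E.
Proof.
move=> q1 fq; have q0 : 0 < q by exact: lt_trans q1.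
exact/(LfunTP mu f q0).
Qed.

(** The difference T h - u_N is T of the tail of h, so its L_q norm tends to 0. Fatou's lemma gives
    lower limit 0 for |T h - u_N|^q almost everywhere; as u_N is already known to converge almost
    everywhere, its limit must be T h. *)
Let lim_T_Lq q : 1 < q -> h \in Lfun mu q%:E ->
  {ae mu, forall x, (fun N => u N x) @ \oo --> T h x}.
Proof.
move=> q1 hq; have q0 : 0 < q by exact: lt_trans q1.
have [_ hfin] := LqTP q1 hq.
have [C hC] := Tbounded q1.
have cutq A : measurable A -> h \_ A \in Lfun mu q%:E.
  move=> mA; apply/(Lfun_patchP mu mA q0 (measurable_funTS mh)).
  by apply: le_lt_trans hfin; exact: Lq_subset.
pose g N := h \_ (~` E0 N%:R).
have mEC N : measurable (~` E0 N%:R) by exact: measurableC.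
have [mTh _] := LqTP q1 (hC _ hq).1.
have diff : {ae mu, forall x, forall N, T h x - u N x = T (g N) x}.
  apply: ae_foralln => N.
  have hE : (fun y => 1 * (h \_ (E0 N%:R)) y + g N y) = h.
    apply/funext => y; rewrite mul1r /g !patchE in_setC.
    by case: (y \in _) => /=; rewrite ?addr0 ?add0r.
  have d1 : op_domain (h \_ (E0 N%:R)) by left; exists q => //; exact: cutq.
  have d2 : op_domain (g N) by left; exists q => //; exact: cutq.
  have d3 : op_domain h by left; exists q.
  have := @Tlin 1 _ _ d1 d2; rewrite hE => /(_ d3).
  by apply: filterS => y ->; rewrite mul1r addrAC subrr add0r.
pose G N x := (`|T h x - u N x| `^ q)%:E.
have mG N : measurable_fun [set: 'rV[R]_n] (G N).
  apply/measurable_EFinP; apply: (measurableT_comp (measurable_powR q)).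
  by apply: measurableT_comp => //; apply: measurable_funB => //; exact: measurable_u.
pose J A := (\int[mu]_(x in A) (`|h x| `^ q)%:E)%E.
have Jfin : (J setT < +oo)%E.
  by rewrite /J -(Lq_powR mu setT h (lt0r_neq0 q0)) poweR_lty.
have mhq : measurable_fun [set: 'rV[R]_n] (fun x => (`|h x| `^ q)%:E).
  apply/measurable_EFinP; apply: (measurableT_comp (measurable_powR q)).
  exact: measurableT_comp.
have Jle A : (J A <= J setT)%E.
  by apply: ge0_subset_integral_nomeas => // x; rewrite lee_fin powR_ge0.
have Jn A : J A \is a fin_num.
  by rewrite ge0_fin_numE; [exact: le_lt_trans (Jle A) Jfin|exact: int_powR_ge0].
have JC N : J (~` E0 N%:R) = (J setT - J (E0 N%:R))%E.
  rewrite /J -(setUv (E0 N%:R)) ge0_integral_setU//.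
  - by rewrite addeAC subee ?add0e//; exact: Jn.
  - by rewrite setUv.
  - by apply/eqP; exact: setICr.
have JC0 : (fun N => J (~` E0 N%:R)) @ \oo --> 0%E.
  under eq_fun do rewrite JC.
  rewrite -(subee (Jn setT)); apply: cvgeB => //.
  - by rewrite fin_num_adde_defl// fin_numN.
  - exact: cvg_cst.
  have -> : setT = \bigcup_N E0 N%:R.
    apply/seteqP; split => // x _; exists (Num.truncn (rho (0 - x))).+1 => //.
    by rewrite /ellipsoid/=; exact: truncnS_gt.
  apply: ge0_nondecreasing_set_cvg_integral => //.
  - by move=> i j ij; apply/subsetPset; exact: E0_le.
  - by move=> i; exact: measurable_funTS.
have intG N : (\int[mu]_x G N x <= (`|C| `^ q)%:E * J (~` E0 N%:R))%E.
  have -> : (\int[mu]_x G N x = Lq mu q setT (T (g N)) `^ q)%E.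
    rewrite (Lq_powR _ _ _ (lt0r_neq0 q0)).
    apply: ge0_ae_eq_integral => //.
    - apply/measurable_EFinP; apply: (measurableT_comp (measurable_powR q)).
      by apply: measurableT_comp => //; have [] := LqTP q1 (hC _ (cutq _ (mEC N))).1.
    - by move=> x _; rewrite lee_fin powR_ge0.
    - by apply: filterS diff => x hx _; rewrite /G hx.
  have := (hC _ (cutq _ (mEC N))).2; rewrite !LnormT// => TC.
  have {}TC : (Lq mu q setT (T (g N)) <= `|C|%:E * Lq mu q setT (g N))%E.
    apply: (le_trans TC); apply: lee_wpmul2r; first exact: Lq_ge0.
    by rewrite lee_fin ler_norm.
  apply: (@le_trans _ _ ((`|C|%:E * Lq mu q setT (g N)) `^ q)%E).
    by apply: ge0_poweR_le; [exact: ltW|exact: Lq_ge0|exact: TC].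
  rewrite poweRM ?Lq_ge0// poweR_EFin; apply: lee_wpmul2l.
    by rewrite lee_fin powR_ge0.
  rewrite (Lq_powR _ _ _ (lt0r_neq0 q0)) /J [leRHS]integral_mkcond.
  apply: ge0_le_integral_nomeas => x _; first by rewrite lee_fin powR_ge0.
  by rewrite /g !patchE; case: ifPn => // _; rewrite normr0 powR0// gt_eqF.
have fat : (\int[mu]_x limn_einf (fun N => G N x) = 0)%E.
  apply/le_anti/andP; split; last first.
    apply: integral_ge0 => x _; apply: limn_einf_ge.
    by apply: nearW => N; rewrite lee_fin powR_ge0.
  apply: (le_trans (fatou mu measurableT mG _)).
    by move=> N x _; rewrite lee_fin powR_ge0.
  have cv0 : (fun N => \int[mu]_x G N x)%E @ \oo --> 0%E.
    apply: (@squeeze_cvge _ _ _ _ (fun=> 0%E) _ (fun N => (`|C| `^ q)%:E * J (~` E0 N%:R))%E).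
    - by apply: nearW => N; rewrite intG andbT integral_ge0// => x _; rewrite lee_fin powR_ge0.
    - exact: cvg_cst.
    - by rewrite -[X in _ --> X](mule0 (`|C| `^ q)%:E); apply: cvgeZl.
  by rewrite (cvg_limn_einf_sup cv0).1.
have mli : measurable_fun [set: 'rV[R]_n] (fun x => limn_einf (fun N => G N x)).
  apply: (emeasurable_fun_cvg (fun N x => einfs (G^~ x) N)) => [N|x _].
    exact: measurable_fun_einfs.
  by rewrite limn_einf_lim; exact: is_cvg_einfs.
have : ae_eq mu setT (fun x => limn_einf (fun N => G N x)) (cst 0%E).
  apply/ae_eq_integral_abs => //.
  rewrite -[RHS]fat; apply: eq_integral => x _; rewrite gee0_abs//.
  by apply: limn_einf_ge; apply: nearW => N; rewrite lee_fin powR_ge0.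
apply: filterS2 cvg_u => x ux /(_ I) Gx.
have [Tl|Tl] := eqVneq (T h x) (limn (fun N => u N x)); first by rewrite Tl.
have d0 : 0 < `|T h x - limn (fun N => u N x)| by rewrite normr_gt0 subr_eq0.
have cvd : (fun N => `|T h x - u N x|) @ \oo --> `|T h x - limn (fun N => u N x)|.
  by apply: cvg_norm; apply: cvgB => //; exact: cvg_cst.
move: d0 cvd; set d := `|T h x - limn _| => d0 cvd.
have : (((d / 2) `^ q)%:E <= limn_einf (fun N => G N x))%E.
  apply: limn_einf_ge.
  have d2 : d / 2 < d by rewrite ltr_pdivrMr// ltr_pMr// ltr1n.
  have : \forall N \near \oo, d / 2 < `|T h x - u N x| by exact: cvgr_gt cvd _ d2.
  apply: filterS => N /ltW dN.
  by rewrite /G lee_fin ge0_ler_powR ?nnegrE ?divr_ge0 ?(ltW d0) ?(ltW q0).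
by rewrite Gx lee_fin leNgt powR_gt0// divr_gt0.
Qed.

Lemma truncations_cvg_cut : truncations_cvg rho T h.
Proof.
rewrite /truncations_cvg /extension; case: asboolP => [[[q q1 hq]|[h1 ch]]|hnd].
- exact: lim_T_Lq q1 hq.
(* For compact support the truncations are eventually equal to [h] itself. *)
- have [N N0 KN] := compact_sub_ellipsoid hrho 0 ch.
  apply: aeW => x; apply: cvg_near_cst; exists N => // M /= NM.
  rewrite /truncations; congr (T _ _); apply/funext => y; rewrite patchE.
  case: ifPn => // /negP yM; apply/esym/eqP; apply/negPn/negP => hy; apply: yM.
  by apply: mem_set; apply: (E0_le NM); apply: KN; exact: subset_closure.
- exact: cvg_u.
Qed.

Lemma extension_cut_le r : 0 < r ->
  {ae mu, forall x, E r x ->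
    (`|extension rho T h x - T (h \_ (E (2 * k * r))) x|%:E <=
     c0%:E * potential r h x)%E}.
Proof.
move=> r0; apply: filterS2 truncations_cvg_cut (cut_near r0) => x tx hx /hx[l [ul]].
suff -> : l = extension rho T h x by [].
exact: (cvg_unique (@norm_hausdorff _ _) ul tx).
Qed.

Lemma measurable_extension : measurable_fun [set: 'rV[R]_n] (extension rho T h).
Proof.
rewrite /extension; case: asboolP => [[[q q1 hq]|[h1 ch]]|hnd].
- by have [C hC] := Tbounded q1; have [] := LqTP q1 (hC _ hq).1.
- have [N N0 KN] := compact_sub_ellipsoid hrho 0 ch.
  rewrite (_ : T h = u N); first exact: measurable_u.
  rewrite /u; congr T; apply/funext => y; rewrite patchE.
  case: ifPn => // /negP yM; apply/eqP; apply/negPn/negP => hy; apply: yM.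
  by apply: mem_set; apply: KN; exact: subset_closure.
- exact: measurable_limn measurable_u.
Qed.

End truncated.

End operator.

(** * The commutator estimate *)

Definition log_weight (R : realType) (a r t : R) : R :=
  (1 + ln (t / r)) * t `^ (- a).

Lemma ae_mrestr d (T : measurableType d) (R : realType)
    (m : {measure set T -> \bar R}) (D : set T) (mD : measurable D) (Q : T -> Prop) :
  (forall x, D x -> Q x) -> {ae mrestr m mD, forall x, Q x}.
Proof.
move=> DQ; exists (~` D); split; first exact: measurableC.
  by rewrite /mrestr setICl measure0.
by move=> x nQ Dx; apply/nQ/DQ.
Qed.

(** * Local Morrey norms and the integral condition on the weights *)

Section morrey.
Context {R : realType} (n : nat).
Local Notation mu := (@lebesgue_rV R n).
Local Notation leb := (@lebesgue_measure R).
Variables (P : 'M[R]_n) (rho : 'rV[R]_n -> R).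
Hypothesis hrho : quasi_distance P rho.
Local Notation gamma := (\tr P).
Variable v : R.
Hypothesis v0 : 0 < v.
Hypothesis volE : forall x r, 0 < r ->
  mu (ellipsoid rho x r) = (v * r `^ gamma)%:E.
Variables (x0 : 'rV[R]_n) (q : R) (phi : 'rV[R]_n -> R -> R).
Hypotheses (q1 : 1 < q) (phi0 : forall x r, 0 < r -> 0 < phi x r).
Local Notation E := (ellipsoid rho x0).

Let q0 : 0 < q. Proof. exact: lt_trans q1. Qed.

Let normalization r : 0 < r ->
  vol (E r) `^ (- q^-1) = (v `^ q^-1 * r `^ (gamma / q))^-1.
Proof.
move=> r0; rewrite (vol_ellipsoid volE)// powRN powRM ?powR_ge0 ?(ltW v0)//.
by rewrite -powRrM.
Qed.

Let v_r_gt0 r : 0 < r -> 0 < v `^ q^-1 * r `^ (gamma / q).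
Proof. by move=> r0; rewrite mulr_gt0 ?powR_gt0. Qed.

Lemma LM_norm_ge0 f : (0 <= LM_norm rho q phi x0 f)%E.
Proof.
apply: (le_trans _ (ereal_sup_ubound _)); last by exists 1 => /=.
rewrite mule_ge0 ?Lnorm_ge0// lee_fin mulr_ge0 ?powR_ge0// invr_ge0.
exact/ltW/phi0.
Qed.

Lemma LM_normP f : (LM_norm rho q phi x0 f < +oo)%E -> forall r, 0 < r ->
  (Lq mu q (E r) f <=
   (fine (LM_norm rho q phi x0 f) * v `^ q^-1 * (phi x0 r * r `^ (gamma / q)))%:E)%E.
Proof.
move=> foo r r0; have fE : LM_norm rho q phi x0 f \is a fin_num.
  by rewrite ge0_fin_numE// LM_norm_ge0.
have : (((phi x0 r)^-1 * vol (E r) `^ (- q^-1))%:E * Lq mu q (E r) f <=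
    LM_norm rho q phi x0 f)%E.
  by rewrite -Lnorm_patch//; apply: ereal_sup_ubound; exists r.
rewrite normalization// -{1}(fineK fE) -invfM => h.
have c0 : 0 < phi x0 r * (v `^ q^-1 * r `^ (gamma / q)).
  by rewrite mulr_gt0 ?v_r_gt0 ?phi0.
move: h; rewrite -(@lee_pmul2l _ (phi x0 r * (v `^ q^-1 * r `^ (gamma / q)))%:E)//.
rewrite muleA -EFinM divff ?gt_eqF// mul1e -EFinM => /le_trans; apply.
by rewrite lee_fin; apply: eqW; ring.
Qed.

Lemma LM_norm_le f A : 0 <= A -> (forall r, 0 < r ->
    (Lq mu q (E r) f <= (A * phi x0 r * r `^ (gamma / q))%:E)%E) ->
  (LM_norm rho q phi x0 f <= (A / v `^ q^-1)%:E)%E.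
Proof.
move=> A0 hA; apply: ge_ereal_sup => _ [r r0 <-].
rewrite Lnorm_patch// normalization// -invfM.
have c0 : 0 < phi x0 r * (v `^ q^-1 * r `^ (gamma / q)).
  by rewrite mulr_gt0 ?v_r_gt0 ?phi0.
apply: (@le_trans _ _ ((phi x0 r * (v `^ q^-1 * r `^ (gamma / q)))^-1%:E *
    (A * phi x0 r * r `^ (gamma / q))%:E)%E).
  by apply: lee_wpmul2l; [rewrite lee_fin invr_ge0 ltW|exact: hA].
rewrite -EFinM lee_fin mulrC ler_pdivrMr//; apply: eqW.
have ? : v `^ q^-1 != 0 by rewrite gt_eqF// powR_gt0.
by field.
Qed.

(* the local norms of [f] increase with the radius, so that each of them is
   bounded by the essential infimum over the larger radii *)
Lemma log_tail_le a f r : measurable_fun [set: 'rV[R]_n] f ->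
  (LM_norm rho q phi x0 f < +oo)%E -> 0 < r ->
  (\int[leb]_(t in `]r, +oo[) ((log_weight a r t)%:E * Lq mu q (E t) f) <=
   (fine (LM_norm rho q phi x0 f) * v `^ q^-1)%:E *
   morrey_integral phi x0 (gamma / q) a r)%E.
Proof.
move=> mf foo r0; set M := _ * v `^ _.
have M0 : 0 <= M by rewrite mulr_ge0 ?powR_ge0// fine_ge0// LM_norm_ge0.
have W_le t tau : 0 < tau -> t < tau ->
    (Lq mu q (E t) f <= (M * (phi x0 tau * tau `^ (gamma / q)))%:E)%E.
  move=> tau0 ttau; apply: (le_trans _ (LM_normP foo tau0)).
  by apply: Lq_subset => // y; rewrite /ellipsoid/= => /lt_trans; apply.
have log0 t : r < t -> 0 <= log_weight a r t.
  move=> rt; rewrite mulr_ge0 ?powR_ge0// addr_ge0// ln_ge0//.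
  by rewrite ler_pdivlMr// mul1r ltW.
(* The factor [M] will be divided out; if it is 0, all local norms of [f] vanish. *)
move: M0; rewrite le_eqVlt => /orP[/eqP M0|M0].
  rewrite -M0 mul0e integral0_eq// => t /=; rewrite in_itv/= andbT => rt.
  have : (Lq mu q (E t) f <= 0)%E.
    have := @W_le t (t + 1); rewrite -M0 mul0r; apply; last by rewrite ltrDl.
    by rewrite addr_gt0// (lt_trans r0).
  by rewrite le_eqVlt ltNge Lq_ge0 orbF => /eqP ->; rewrite mule0.
have mJ : measurable_fun `]r, +oo[%classic
    (fun t => (log_weight a r t)%:E * Lq mu q (E t) f)%E.
  apply: measurable_funTS; apply: emeasurable_funM.
    apply/measurable_EFinP; apply: measurable_funM; last exact: measurable_powR.
    apply: measurable_funD => //; apply: measurableT_comp => //.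
    exact: measurable_funM.
  exact: (measurable_Lq_ellipsoid hrho).
rewrite -[leRHS]muleC -lee_pdivrMr// muleC -ge0_integralZl//; last 2 first.
- move=> t /=; rewrite in_itv/= andbT => rt.
  by rewrite mule_ge0 ?Lq_ge0// lee_fin log0.
- by rewrite lee_fin invr_ge0 ltW.
apply: ge0_le_integral_nomeas => t /=; rewrite in_itv/= andbT => rt.
  by rewrite !mule_ge0 ?Lq_ge0// lee_fin ?log0// invr_ge0 ltW.
have t0 : 0 < t by exact: lt_trans rt.
rewrite /log_weight powRN EFinM muleCA -!muleA.
apply: lee_wpmul2l.
  rewrite lee_fin addr_ge0// ln_ge0//.
  by rewrite ler_pdivlMr// mul1r ltW.
rewrite [leLHS]muleC; apply: lee_wpmul2r.
  by rewrite lee_fin invr_ge0 powR_ge0.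
apply/ess_infP; apply: ae_mrestr => tau /=; rewrite in_itv/= andbT => ttau.
rewrite lee_pdivrMl// -EFinM; apply: W_le => //.
exact: lt_trans ttau.
Qed.

End morrey.

(** * The common estimate with the parameter delta *)

Section commutator_estimate.
Context {R : realType} (n : nat).
Local Notation mu := (@lebesgue_rV R n).
Local Notation leb := (@lebesgue_measure R).
Variables (P : 'M[R]_n) (rho : 'rV[R]_n -> R).
Hypothesis hrho : quasi_distance P rho.
Local Notation gamma := (\tr P).
Hypothesis gamma0 : 0 < gamma.
Variables (v k : R).
Hypotheses (v0 : 0 < v) (k1 : 1 <= k).
Hypothesis volE : forall x r, 0 < r ->
  mu (ellipsoid rho x r) = (v * r `^ gamma)%:E.
Hypothesis tri : forall x y z, rho (x - y) <= k * (rho (x - z) + rho (y - z)).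
Variables (x0 : 'rV[R]_n) (Omega : 'rV[R]_n -> R).
Hypothesis mOmega : measurable_fun [set: 'rV[R]_n] Omega.
Variables (T : ('rV[R]_n -> R) -> 'rV[R]_n -> R) (c0 : R).
Hypothesis c00 : 0 <= c0.
Hypothesis Tlin : linear_ae T.
Hypothesis Tsize : forall f, f \in Lfun mu 1%E -> compact (supp f) ->
  forall x, ~ supp f x -> (`|T f x|%:E <= c0%:E * \int[mu]_y
    (`|Omega (x - y)| / rho (x - y) `^ gamma * `|f y|)%:E)%E.
Hypothesis Tbounded : forall q : R, 1 < q -> Lq_bounded T q.
Variables (p p1 p2 lambda delta : R).
Hypotheses (hp : 1 < p) (hp1 : 1 < p1) (hp2 : 1 < p2)
  (hpp : p^-1 = p1^-1 + p2^-1).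
Hypotheses (lambda0 : 0 <= lambda) (lambda1 : gamma * lambda < 1)
  (delta_le : delta <= gamma / p1).
Local Notation E := (ellipsoid rho x0).
Local Notation potential := (potential P rho k x0 Omega).
Variable CU : R.
Hypothesis CU0 : 0 <= CU.
Hypothesis potential_le : forall q, q = p \/ q = p1 -> forall h r,
  measurable_fun [set: 'rV[R]_n] h -> 0 < r ->
  ((\int[mu]_(x in E r) (potential r h x `^ q)) `^ q^-1 <=
   (CU * r `^ (gamma / q - delta))%:E *
   tail_integral rho x0 (delta - gamma / p) p r h)%E.
Variable CT : R.
Hypothesis CT0 : 0 <= CT.
Hypothesis T_le : forall q, q = p \/ q = p1 -> forall h, h \in Lfun mu q%:E ->
  (Lnorm mu q%:E (EFin \o T h) <= CT%:E * Lnorm mu q%:E (EFin \o h))%E.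
Implicit Types (f h b : 'rV[R]_n -> R) (r t A : R).

Let p0 : 0 < p. Proof. exact: lt_trans hp. Qed.
Let p10 : 0 < p1. Proof. exact: lt_trans hp1. Qed.
Let p20 : 0 < p2. Proof. exact: lt_trans hp2. Qed.
Let k0 : 0 < k. Proof. exact: lt_le_trans k1. Qed.
Let mell x r : measurable (ellipsoid rho x r).
Proof. exact: (measurable_ellipsoid hrho). Qed.

(** [e2] is the growth exponent of b - m in L_p2, and [c] is the power of t in the hypothesis on the
    weights; [exponentE] says that the tail integral of a function with this growth has exactly that
    power. *)
Let e2 := gamma / p2 + gamma * lambda.
Let c := gamma / p1 - delta + 1 - gamma * lambda.

Let c_ge0 : 0 <= c. Proof. by rewrite /c; move: lambda1 delta_le; lra. Qed.

Let exponentE : delta - gamma / p - 1 + e2 = - c.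
Proof. by rewrite /e2 /c hpp mulrDr; ring. Qed.

Let ln_ge0 r t : 0 < r -> r <= t -> 0 <= ln (t / r).
Proof. by move=> r0 rt; apply: ln_ge0; rewrite ler_pdivlMr// mul1r. Qed.

Let log_weight_ge0 r t : 0 < r -> r <= t -> 0 <= log_weight c r t.
Proof. by move=> r0 rt; rewrite mulr_ge0 ?powR_ge0// addr_ge0// ln_ge0. Qed.

Let measurable_log_weight r : measurable_fun [set: R] (log_weight c r).
Proof.
apply: measurable_funM; last exact: measurable_powR.
apply: measurable_funD => //; apply: measurableT_comp => //.
exact: measurable_funM.
Qed.

Let CL := (4 * k) `^ c / (2 * k).
Let CL0 : 0 <= CL.
Proof. by rewrite divr_ge0 ?powR_ge0// mulr_ge0// ltW. Qed.

Let K := osc_const P v p2 lambda.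
Let K0 : 0 <= K. Proof. exact: osc_const_ge0. Qed.

(** One summand for each of four pieces, in this order: (b - m) T of the near part of f, b - m times
    the potential of f, T of the near part of (b - m) f, the potential of (b - m) f. *)
Definition commutator_const : R := CT * CL * K + c0 * CU * v `^ p2^-1 * K +
  (CT * CL * (1 + ln (2 * k)) * (2 * k) `^ e2 * K + c0 * CU * K).

Lemma commutator_const_ge0 : 0 <= commutator_const.
Proof.
have ? : 0 <= ln (2 * k) by apply: exp.ln_ge0; move: k1; lra.
have ? : 0 <= 1 + ln (2 * k) by exact: addr_ge0.
rewrite /commutator_const; apply: addr_ge0; apply: addr_ge0.
all: by repeat (apply: mulr_ge0 => //); exact: powR_ge0.
Qed.

Section data.
Variables (b f : 'rV[R]_n -> R) (B : R).
Hypotheses (hf : Lploc p1 f) (hb : Lploc p2 b) (B0 : 0 <= B).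
Hypothesis osc : forall r, 0 < r ->
  (Lq mu p2 (E r) (fun y => b y - mean b (E r))%R <=
   (B * (v * r `^ gamma) `^ (p2^-1 + lambda))%:E)%E.
Let mf : measurable_fun [set: 'rV[R]_n] f. Proof. exact: hf.1. Qed.
Let mb : measurable_fun [set: 'rV[R]_n] b. Proof. exact: hb.1. Qed.

Let W t := Lq mu p1 (E t) f.
Let J r := (\int[leb]_(t in `]r, +oo[) ((log_weight c r t)%:E * W t))%E.

Hypothesis Jfin : forall r, 0 < r -> (J r < +oo)%E.

Let W0 t : (0 <= W t)%E. Proof. exact: Lq_ge0. Qed.
Let Wfin t : (W t < +oo)%E. Proof. exact: (Lploc_Lq hrho). Qed.
Let W_le r t : r <= t -> (W r <= W t)%E.
Proof.
move=> rt; apply: Lq_subset => // y; rewrite /ellipsoid/= => yr.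
exact: lt_le_trans rt.
Qed.

Let measurable_J r : measurable_fun `]r, +oo[%classic
  (fun t => (log_weight c r t)%:E * W t)%E.
Proof.
apply: measurable_funTS; apply: emeasurable_funM; last exact: (measurable_Lq_ellipsoid hrho).
exact/measurable_EFinP.
Qed.

Let J0 r : 0 < r -> (0 <= J r)%E.
Proof.
move=> r0; apply: integral_ge0 => t /=; rewrite in_itv/= andbT => /ltW rt.
by rewrite mule_ge0// lee_fin log_weight_ge0.
Qed.

(** A bound of the L_p norms of [h] by the L_p1 norms of [f]; it is all that the potential estimates
    require of [h]. *)
Let dom A r h := forall t, r <= t ->
  (Lq mu p (E t) h <= (A * (1 + ln (t / r)) * t `^ e2)%:E * W t)%E.

Let dom_tail A r h : 0 <= A -> 0 < r -> dom A r h ->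
  (tail_integral rho x0 (delta - gamma / p) p r h <= A%:E * J r)%E.
Proof.
move=> A0 r0 dh; rewrite /J -ge0_integralZl//; last 2 first.
- exact: measurable_J.
- move=> t /=; rewrite in_itv/= andbT => /ltW rt.
  by rewrite mule_ge0// lee_fin log_weight_ge0.
apply: ge0_le_integral_nomeas => t /=; rewrite in_itv/= andbT => rt.
  by rewrite mule_ge0 ?Lq_ge0// lee_fin powR_ge0.
have t0 : 0 < t by exact: lt_trans rt.
apply: (@le_trans _ _ ((t `^ (delta - gamma / p - 1))%:E *
  ((A * (1 + ln (t / r)) * t `^ e2)%:E * W t))%E).
  by apply: lee_wpmul2l; [rewrite lee_fin powR_ge0|exact: dh (ltW rt)].
rewrite !muleA -!EFinM; apply: lee_wpmul2r => //; rewrite lee_fin.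
rewrite mulrCA -powRD; last by rewrite (gt_eqF t0) implybT.
by rewrite exponentE /log_weight mulrA.
Qed.

Let dom_potential q A r h : q = p \/ q = p1 -> 0 <= A -> 0 < r ->
  measurable_fun [set: 'rV[R]_n] h -> dom A r h ->
  ((\int[mu]_(x in E r) (potential r h x `^ q)) `^ q^-1 <=
   (CU * A * r `^ (gamma / q - delta))%:E * J r)%E.
Proof.
move=> hq A0 r0 mh dh; apply: (le_trans (potential_le hq mh r0)).
rewrite -[(CU * A * _)]mulrAC [(_ * A)%:E]EFinM -muleA; apply: lee_wpmul2l.
  by rewrite lee_fin mulr_ge0// powR_ge0.
exact: dom_tail.
Qed.


(** Passing from L_p1 to L_p produces t^(gamma / p2) only. The missing power is supplied by 1 <=
    r^(- gamma lambda) t^(gamma lambda), valid for r <= t, and the negative power of r is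
    compensated later by the oscillation of b on E(x0, r). *)
Let dom_f r : 0 < r -> dom (v `^ p2^-1 * r `^ (- (gamma * lambda))) r f.
Proof.
move=> r0 t rt; have t0 : 0 < t by exact: lt_le_trans rt.
have p12 : p <= p1.
  by rewrite -lef_pV2 ?posrE// hpp lerDl invr_ge0 ltW.
apply: (le_trans (Lq_ellipsoid_embed hrho volE t0 (measurable_funTS mf) p0 p12)).
rewrite -/(W t); apply: lee_wpmul2r => //; rewrite lee_fin hpp addrAC subrr add0r.
rewrite powRM ?powR_ge0 ?(ltW v0)// -powRrM -!mulrA; apply: ler_wpM2l.
  exact: powR_ge0.
rewrite /e2 powRD; last by rewrite (gt_eqF t0) implybT.
have h1 : 1 <= r `^ (- (gamma * lambda)) * t `^ (gamma * lambda).
  rewrite powRN mulrC ler_pdivlMr ?powR_gt0// mul1r.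
  by rewrite ge0_ler_powR ?nnegrE ?mulr_ge0 ?(ltW gamma0) ?(ltW r0) ?(ltW t0).
rewrite mulrCA [_ * t `^ (gamma * lambda)]mulrC mulrA mulrA.
rewrite -[_ * t `^ (gamma * lambda)]mulrA ler_peMl ?powR_ge0//.
by rewrite mulr_ege1// lerDl ln_ge0.
Qed.

Let bfin r : (Lq mu p2 (E r) b < +oo)%E. Proof. exact: (Lploc_Lq hrho). Qed.

Let osc_log r t : 0 < r -> r <= t ->
  (Lq mu p2 (E t) (fun y => b y - mean b (E r))%R <=
   (K * (1 + ln (t / r)) * t `^ e2 * B)%:E)%E.
Proof. exact: (campanato_log hrho gamma0 v0 volE (ltW hp2) lambda0 B0 mb bfin osc). Qed.

Let mbm m : measurable_fun [set: 'rV[R]_n] (fun y => b y - m).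
Proof. exact: measurable_funB. Qed.

Let hm m y := (b y - m) * f y.

Let mhm m : measurable_fun [set: 'rV[R]_n] (hm m).
Proof. exact: measurable_funM. Qed.

Let dom_h2 r : 0 < r -> dom (K * B) r (hm (mean b (E r))).
Proof.
move=> r0 t rt; have t0 : 0 < t by exact: lt_le_trans rt.
have hpp' : p^-1 = p2^-1 + p1^-1 by rewrite hpp addrC.
apply: (le_trans (Lq_hoelder mu (mell x0 t) (measurable_funTS (mbm (mean b (E r))))
  (measurable_funTS mf) p0 p20 p10 hpp')).
rewrite -/(W t); apply: lee_wpmul2r => //; apply: (le_trans (osc_log r0 rt)).
by rewrite lee_fin; apply: eqW; ring.
Qed.

(** The mean of b changes with the radius, whereas the limits of truncations are needed for a fixed
    [m], in particular m = 0 for b f, at every radius. The difference of the two constants is a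
    multiple of [f], covered by [dom_f]. *)
Let dom_hm m r : 0 < r -> dom
  (K * B + `|mean b (E r) - m| * (v `^ p2^-1 * r `^ (- (gamma * lambda)))) r (hm m).
Proof.
move=> r0 t rt.
rewrite (_ : hm m = (fun y => hm (mean b (E r)) y + (mean b (E r) - m) * f y)); last first.
  by apply/funext => y; rewrite /hm -mulrDl addrA subrK.
have mmf : measurable_fun [set: 'rV[R]_n] (fun y => (mean b (E r) - m) * f y).
  exact: measurable_funM.
apply: (le_trans (Lq_minkowski mu (mell x0 t) (ltW hp) (measurable_funTS (mhm (mean b (E r))))
  (measurable_funTS mmf))).
rewrite LqZ//; last exact: measurable_funTS.
rewrite (mulrDl (K * B)) (mulrDl (K * B * _)) EFinD muleDl//; last first.
  by rewrite ge0_fin_numE.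
apply: leeD; first exact: dom_h2.
rewrite -!mulrA EFinM -muleA; apply: lee_wpmul2l => //.
rewrite !mulrA; exact: dom_f.
Qed.

(** [W] increases, so its value at 2 k r is at most its values on []2 k r, 4 k r]], an interval of
    length 2 k r on which t^(- c) >= (4 k r)^(- c); this part of [J r] accounts for [CL]. *)
Let local_le r : 0 < r -> (W (2 * k * r) <= (CL * r `^ (c - 1))%:E * J r)%E.
Proof.
move=> r0.
have kr0 : 0 < k * r by rewrite mulr_gt0.
have rk : r <= 2 * k * r by rewrite ler_peMl ?(ltW r0)//; move: k1; lra.
have JW : (((4 * k * r) `^ (- c) * (2 * k * r))%:E * W (2 * k * r) <= J r)%E.
  have sub : (`](2 * k * r), (4 * k * r)]%classic : set R) `<=` `]r, +oo[%classic.
    move=> t /=; rewrite !in_itv/= andbT => /andP[h1 _].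
    exact: le_lt_trans h1.
  apply: (@le_trans _ _ (\int[leb]_(t in `](2 * k * r)%R, (4 * k * r)%R])
     ((log_weight c r t)%:E * W t))%E); last first.
    apply: ge0_subset_integral => //=; first exact: measurable_J.
    move=> t /=; rewrite in_itv/= andbT => /ltW rt.
    by rewrite mule_ge0// lee_fin log_weight_ge0.
  apply: (@le_trans _ _ (\int[leb]_(t in `](2 * k * r)%R, (4 * k * r)%R])
     (((4 * k * r) `^ (- c))%:E * W (2 * k * r)))%E).
    rewrite integral_cst//= lebesgue_measure_itv/= lte_fin.
    rewrite ifT; last by lra.
    rewrite -EFinB EFinM -!muleA [(W _ * _)%E]muleC; apply: lee_wpmul2l.
      by rewrite lee_fin powR_ge0.
    by apply: lee_wpmul2r => //; rewrite lee_fin; lra.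
  apply: ge0_le_integral_nomeas => t /=; rewrite in_itv/= => /andP[h1 h4].
    by rewrite mule_ge0// lee_fin powR_ge0.
  have rt : r <= t by rewrite (le_trans rk)// ltW.
  have t0 : 0 < t by exact: lt_le_trans rt.
  apply: lee_pmul => //; rewrite ?lee_fin ?powR_ge0//; last exact/W_le/ltW.
  rewrite /log_weight; apply: (le_trans (powRN_le t0 h4 c_ge0)).
  by rewrite ler_peMl ?powR_ge0// lerDl ln_ge0.
have H : (4 * k) `^ c / (2 * k) * r `^ (c - 1) * ((4 * k * r) `^ (- c) * (2 * k * r)) = 1.
  rewrite powRN [(4 * k * r) `^ c]powRM ?mulr_ge0 ?(ltW k0) ?(ltW r0)// [r `^ (c - 1)]powRD; last first.
    by rewrite (gt_eqF r0) implybT.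
  rewrite powR_inv1 ?(ltW r0)//.
  have ? : (4 * k) `^ c != 0 by rewrite gt_eqF// powR_gt0// mulr_gt0.
  have ? : r `^ c != 0 by rewrite gt_eqF// powR_gt0.
  have ? : r != 0 by rewrite gt_eqF.
  have ? : k != 0 by rewrite gt_eqF.
  by field; do ?[apply/andP; split].
apply: (@le_trans _ _ (((4 * k) `^ c / (2 * k) * r `^ (c - 1))%:E *
   (((4 * k * r) `^ (- c) * (2 * k * r))%:E * W (2 * k * r)))%E).
  by rewrite muleA -EFinM H mul1e.
apply: lee_wpmul2l => //; rewrite lee_fin !mulr_ge0 ?powR_ge0// invr_ge0 mulr_ge0//.
exact: ltW.
Qed.

Let pot_fin A r h : 0 <= A -> 0 < r -> measurable_fun [set: 'rV[R]_n] h ->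
  dom A r h -> {ae mu, forall x, E r x -> (potential r h x < +oo)%E}.
Proof.
move=> A0 r0 mh dh.
have mpot : measurable_fun (E r) (fun x => potential r h x `^ p)%E.
  apply: measurable_funTS; apply: (measurableT_comp (measurable_poweR p)).
  exact: (measurable_potential hrho).
have pot0 x : (0 <= potential r h x)%E by exact: potential_ge0.
have : mu.-integrable (E r) (fun x => potential r h x `^ p)%E.
  apply/integrableP; split => //.
  under eq_integral do rewrite gee0_abs ?poweR_ge0//.
  have pV : p^-1 != 0 by rewrite invr_eq0 gt_eqF.
  apply: (lty_poweRy pV); apply: (le_lt_trans (dom_potential (or_introl erefl) A0 r0 mh dh)).
  by apply: lte_mul_pinfty; rewrite ?lee_fin ?mulr_ge0 ?powR_ge0//; exact: Jfin.
move=> /(integrable_ae (mell x0 r)); apply: filterS => x hx /hx xfin.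
have pn : p != 0 by rewrite gt_eqF.
by apply: (lty_poweRy pn); rewrite ltey_eq xfin.
Qed.

Let f_const_ge0 r : 0 <= v `^ p2^-1 * r `^ (- (gamma * lambda)).
Proof. by rewrite mulr_ge0 ?powR_ge0. Qed.

Let hm_const_ge0 m r : 0 <=
  K * B + `|mean b (E r) - m| * (v `^ p2^-1 * r `^ (- (gamma * lambda))).
Proof.
have ? : 0 <= K * B by exact: mulr_ge0.
by rewrite addr_ge0// mulr_ge0.
Qed.

Let hm_fin m t : (Lq mu p (E t) (hm m) < +oo)%E.
Proof.
pose M := Num.max 1 t.
apply: (@le_lt_trans _ _ (Lq mu p (E M) (hm m))).
  apply: Lq_subset => // y; rewrite /ellipsoid/= => yt.
  by rewrite (lt_le_trans yt)// le_max lexx orbT.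
have M1 : 1 <= M by rewrite le_max lexx.
apply: (le_lt_trans (dom_hm m ltr01 M1)); apply: lte_mul_pinfty => //.
rewrite lee_fin; apply: mulr_ge0; last exact: powR_ge0.
by apply: mulr_ge0; rewrite ?hm_const_ge0// addr_ge0 ?ln_ge0.
Qed.

Let Lploc_fin h : measurable_fun [set: 'rV[R]_n] h ->
  (forall t, 0 < t -> (Lq mu p (E t) h < +oo)%E) -> Lploc p h.
Proof.
move=> mh hfin; split=> // A cA.
have [N N0 AN] := compact_sub_ellipsoid hrho x0 cA.
have mA : measurable A.
  by apply: closed_measurable_rV; apply: compact_closed cA; exact: norm_hausdorff.
apply/(Lfun_patchP mu mA p0 (measurable_funTS mh)).
by apply: (le_lt_trans _ (hfin N%:R _)); rewrite ?ltr0n//; exact: Lq_subset.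
Qed.

Let Lploc_hm m : Lploc p (hm m).
Proof. exact: Lploc_fin. Qed.

Let pot_f_fin r : 0 < r -> {ae mu, forall x, E r x -> (potential r f x < +oo)%E}.
Proof. by move=> r0; exact: pot_fin (f_const_ge0 r) r0 mf (dom_f r0). Qed.

Let pot_hm_fin m r : 0 < r ->
  {ae mu, forall x, E r x -> (potential r (hm m) x < +oo)%E}.
Proof.
by move=> r0; exact: pot_fin (hm_const_ge0 m r) r0 (mhm m) (dom_hm m r0).
Qed.

Let truncations_cvg_f : truncations_cvg rho T f.
Proof.
exact: (truncations_cvg_cut hrho k1 volE tri mOmega c00 Tlin Tsize Tbounded hp1 hf pot_f_fin).
Qed.

Let truncations_cvg_hm m : truncations_cvg rho T (hm m).
Proof.
exact: (truncations_cvg_cut hrho k1 volE tri mOmega c00 Tlin Tsize Tbounded hp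
  (Lploc_hm m) (pot_hm_fin m)).
Qed.

Let bfE : (fun y => b y * f y) = hm 0.
Proof. by apply/funext => y; rewrite /hm subr0. Qed.

(** On the truncations this is linearity of T on its domain. It passes to the extension because the
    limits for f, (b - m) f and b f all exist almost everywhere. *)
Let commutatorE m : {ae mu, forall x, commutator rho T b f x =
  (b x - m) * extension rho T f x - extension rho T (hm m) x}.
Proof.
have lin : {ae mu, forall x, forall N, truncations rho T (hm 0) x N =
    m * truncations rho T f x N + truncations rho T (hm m) x N}.
  apply: ae_foralln => N.
  have sub := @subset_refl _ (ellipsoid rho 0 N%:R).
  have hE : (fun y => m * (f \_ (ellipsoid rho 0 N%:R)) y +
      (hm m \_ (ellipsoid rho 0 N%:R)) y) = hm 0 \_ (ellipsoid rho 0 N%:R).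
    apply/funext => y; rewrite !patchE; case: ifPn => _; rewrite ?mulr0 ?addr0//.
    by rewrite /hm -mulrDl subr0 addrC subrK.
  have := @Tlin m _ _ (op_domain_cut hrho hp1 hf (mell 0 N%:R) sub)
    (op_domain_cut hrho hp (Lploc_hm m) (mell 0 N%:R) sub).
  by rewrite hE => /(_ (op_domain_cut hrho hp (Lploc_hm 0) (mell 0 N%:R) sub)).
have tf := truncations_cvg_f; have tm := truncations_cvg_hm m.
have t0 := truncations_cvg_hm 0.
near=> x.
have hx : forall N, truncations rho T (hm 0) x N =
    m * truncations rho T f x N + truncations rho T (hm m) x N by near: x.
have cf : truncations rho T f x @ \oo --> extension rho T f x by near: x.
have cm : truncations rho T (hm m) x @ \oo --> extension rho T (hm m) x by near: x.
have c0' : truncations rho T (hm 0) x @ \oo --> extension rho T (hm 0) x by near: x.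
have : truncations rho T (hm 0) x @ \oo -->
    m * extension rho T f x + extension rho T (hm m) x.
  rewrite (_ : truncations rho T (hm 0) x = fun N =>
    m * truncations rho T f x N + truncations rho T (hm m) x N); last exact/funext.
  by apply: cvgD => //; apply: cvgMr.
move=> /(cvg_unique (@norm_hausdorff _ _) c0') e.
by rewrite /commutator bfE e; ring.
Unshelve. all: by end_near. Qed.

(** [fine] sends the value +oo to 0, so the inequality holds whether or not the potential is
    finite. *)
Let Lq_potential_le q r h : 0 < q -> measurable_fun [set: 'rV[R]_n] h ->
  (Lq mu q (E r) (fun x => fine (potential r h x)) <=
   (\int[mu]_(x in E r) (potential r h x `^ q)) `^ q^-1)%E.
Proof.
move=> q0 mh; apply: ge0_poweR_le; [by rewrite invr_ge0 ltW|exact: int_powR_ge0|].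
apply: ge0_le_integral_nomeas => x _; first by rewrite lee_fin powR_ge0.
have := potential_ge0 P rho k x0 Omega r h x.
case: (potential r h x) => [a a0||]//=; first by rewrite ger0_norm.
by move=> _; rewrite gt_eqF// leey.
Qed.

Let Lq_T_cut q (A : set 'rV[R]_n) r h : q = p \/ q = p1 -> Lploc q h ->
  (Lq mu q A (T (h \_ (E r))) <= CT%:E * Lq mu q (E r) h)%E.
Proof.
move=> hq hl; have q1 : 1 < q by case: hq => ->.
have q0 : 0 < q by exact: lt_trans q1.
apply: (@le_trans _ _ (Lq mu q setT (T (h \_ (E r))))); first exact: Lq_subset.
rewrite -LnormT//; apply: (le_trans (T_le hq (Lfun_cut hrho q1 hl (mell _ _) (@subset_refl _ _)))).
by rewrite Lnorm_patch.
Qed.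

Let measurable_T_cut q r h : 1 < q -> Lploc q h ->
  measurable_fun [set: 'rV[R]_n] (T (h \_ (E r))).
Proof.
move=> q1 hl; have [C hC] := Tbounded q1.
have [/andP[/[!inE]/= ? _] _] :=
  hC _ (Lfun_cut hrho q1 hl (mell x0 r) (@subset_refl _ _)).
by [].
Qed.

Let measurable_pot r h : measurable_fun [set: 'rV[R]_n] h ->
  measurable_fun [set: 'rV[R]_n] (fun x => fine (potential r h x)).
Proof.
move=> mh; apply: (measurableT_comp (fine_measurable measurableT)).
exact: (measurable_potential hrho).
Qed.

Let measurable_commutator : measurable_fun [set: 'rV[R]_n] (commutator rho T b f).
Proof.
apply: measurable_funB.
  by apply: measurable_funM => //; exact: (measurable_extension hrho Tbounded hp1 hf).
by rewrite bfE; exact: (measurable_extension hrho Tbounded hp (Lploc_hm 0)).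
Qed.

Let Lq_ae_le_add (A : set 'rV[R]_n) h (g1 g2 : 'rV[R]_n -> R) : measurable A -> measurable_fun A h ->
  measurable_fun A g1 -> measurable_fun A g2 ->
  {ae mu, forall x, A x -> `|h x| <= `|g1 x| + `|g2 x|} ->
  (Lq mu p A h <= Lq mu p A g1 + Lq mu p A g2)%E.
Proof.
move=> mA mh mg1 mg2 hle.
have m1 : measurable_fun A (fun x => `|g1 x|) by exact: measurableT_comp.
have m2 : measurable_fun A (fun x => `|g2 x|) by exact: measurableT_comp.
have p0' : 0 < p := p0.
rewrite (@eq_Lq _ _ _ mu _ _ g1 (fun x => `|g1 x|))//; last by move=> x _; rewrite normr_id.
rewrite (@eq_Lq _ _ _ mu _ _ g2 (fun x => `|g2 x|))//; last by move=> x _; rewrite normr_id.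
apply: (le_trans _ (Lq_minkowski mu mA (ltW hp) m1 m2)).
apply: (Lq_ae_le mA p0' mh); first exact: measurable_funD.
apply: filterS hle => x hx /hx h1.
by rewrite [leRHS]ger0_norm// addr_ge0.
Qed.

Let D := gamma / p - delta.

Lemma commutator_le r : 0 < r -> (Lq mu p (E r) (commutator rho T b f) <=
  (commutator_const * B * r `^ D)%:E * J r)%E.
Proof.
move=> r0; pose m := mean b (E r).
have rr : r <= r by [].
have k20 : 0 < 2 * k by rewrite mulr_gt0.
have r2 : r <= 2 * k * r by rewrite ler_peMl ?(ltW r0)//; move: k1; lra.
have hpp' : p^-1 = p2^-1 + p1^-1 by rewrite hpp addrC.
pose Tf := T (f \_ (E (2 * k * r))).
pose Th := T (hm m \_ (E (2 * k * r))).
pose Pf x := fine (potential r f x).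
pose Ph x := fine (potential r (hm m) x).
have mTf : measurable_fun [set: 'rV[R]_n] Tf by exact: measurable_T_cut hp1 hf.
have mTh : measurable_fun [set: 'rV[R]_n] Th by exact: measurable_T_cut hp (Lploc_hm m).
have mPf : measurable_fun [set: 'rV[R]_n] Pf by exact: measurable_pot.
have mPh : measurable_fun [set: 'rV[R]_n] Ph by exact: measurable_pot.
have ae_le : {ae mu, forall x, E r x -> `|commutator rho T b f x| <=
    (`|(b x - m) * Tf x| + `|c0 * ((b x - m) * Pf x)|) + (`|Th x| + `|c0 * Ph x|)}.
  have ef := extension_cut_le hrho k1 volE tri mOmega c00 Tlin Tsize Tbounded
    hp1 hf pot_f_fin r0.
  have eh := extension_cut_le hrho k1 volE tri mOmega c00 Tlin Tsize Tbounded
    hp (Lploc_hm m) (pot_hm_fin m) r0.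
  have pf := pot_f_fin r0; have ph := pot_hm_fin m r0; have cE := commutatorE m.
  near=> x => xr.
  have pfx : (potential r f x < +oo)%E by move: xr; near: x.
  have phx : (potential r (hm m) x < +oo)%E by move: xr; near: x.
  have efx : (`|extension rho T f x - Tf x|%:E <= c0%:E * potential r f x)%E.
    by move: xr; near: x.
  have ehx : (`|extension rho T (hm m) x - Th x|%:E <= c0%:E * potential r (hm m) x)%E.
    by move: xr; near: x.
  have -> : commutator rho T b f x =
    (b x - m) * extension rho T f x - extension rho T (hm m) x by near: x.
  have ef' : `|extension rho T f x - Tf x| <= c0 * Pf x.
    by rewrite -lee_fin EFinM fineK// ge0_fin_numE// potential_ge0.
  have eh' : `|extension rho T (hm m) x - Th x| <= c0 * Ph x.
    by rewrite -lee_fin EFinM fineK// ge0_fin_numE// potential_ge0.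
  have -> : (b x - m) * extension rho T f x - extension rho T (hm m) x =
    ((b x - m) * Tf x + (b x - m) * (extension rho T f x - Tf x)) -
    (Th x + (extension rho T (hm m) x - Th x)) by ring.
  apply: (le_trans (ler_normB _ _)); apply: lerD.
    apply: (le_trans (ler_normD _ _)); apply: lerD => //.
    rewrite mulrCA !normrM; apply: ler_wpM2l => //.
    by rewrite -normrM (le_trans ef')// ler_norm.
  apply: (le_trans (ler_normD _ _)); apply: lerD => //.
  by rewrite (le_trans eh')// ler_norm.
have mg1 : measurable_fun (E r) (fun x => (b x - m) * Tf x).
  by apply: measurable_funTS; exact: measurable_funM.
have mbP : measurable_fun (E r) (fun x => (b x - m) * Pf x).
  by apply: measurable_funTS; exact: measurable_funM.
have mg2 : measurable_fun (E r) (fun x => c0 * ((b x - m) * Pf x)).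
  exact: measurable_funM.
have mg4 : measurable_fun (E r) (fun x => c0 * Ph x).
  by apply: measurable_funTS; exact: measurable_funM.
have J0r := J0 r0.
have oscr : (Lq mu p2 (E r) (fun y => b y - m)%R <= (K * B * r `^ e2)%:E)%E.
  apply: (le_trans (osc_log r0 rr)).
  by rewrite divff ?gt_eqF// ln1 addr0 mulr1 mulrAC.
(* Collecting powers of [r]: b - m contributes [e2], the near part [c - 1], and the potential of [f]
   the two exponents bracketed in [a3]. *)
have a2 : e2 + (c - 1) = D by rewrite /D /e2 /c hpp; ring.
have a3 : e2 + (- (gamma * lambda) + (gamma / p1 - delta)) = D.
  by rewrite /D /e2 hpp; ring.
have r_pow x y z : x + y = z -> r `^ x * r `^ y = r `^ z.
  by move=> <-; rewrite powRD// (gt_eqF r0) implybT.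
have b1 : (Lq mu p (E r) (fun x => (b x - m) * Tf x)%R <=
    (CT * CL * K * B * r `^ D)%:E * J r)%E.
  apply: (le_trans (Lq_hoelder mu (mell x0 r) (measurable_funTS (mbm m))
    (measurable_funTS mTf) p0 p20 p10 hpp')).
  apply: (@le_trans _ _ ((K * B * r `^ e2)%:E *
     (CT%:E * ((CL * r `^ (c - 1))%:E * J r)))%E).
    apply: lee_pmul; rewrite ?Lq_ge0//.
    apply: (le_trans (Lq_T_cut _ _ (or_intror erefl) hf)).
    by apply: lee_wpmul2l; [rewrite lee_fin|exact: local_le].
  rewrite !muleA -!EFinM -(r_pow _ _ _ a2); apply: lee_wpmul2r => //.
  by rewrite lee_fin; apply: eqW; ring.
have b2 : (Lq mu p (E r) (fun x => c0 * ((b x - m) * Pf x))%R <=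
    (c0 * CU * v `^ p2^-1 * K * B * r `^ D)%:E * J r)%E.
  rewrite LqZ// ger0_norm//.
  apply: (@le_trans _ _ (c0%:E * ((K * B * r `^ e2)%:E *
     ((CU * (v `^ p2^-1 * r `^ (- (gamma * lambda))) *
       r `^ (gamma / p1 - delta))%:E * J r)))%E).
    apply: lee_wpmul2l; first by rewrite lee_fin.
    apply: (le_trans (Lq_hoelder mu (mell x0 r) (measurable_funTS (mbm m))
      (measurable_funTS mPf) p0 p20 p10 hpp')).
    apply: lee_pmul; rewrite ?Lq_ge0//.
    apply: (le_trans (Lq_potential_le _ p10 mf)).
    exact: (dom_potential (or_intror erefl) (f_const_ge0 r) r0 mf (dom_f r0)).
  rewrite !muleA -!EFinM -(r_pow _ _ _ a3) -(r_pow (- (gamma * lambda)) _ _ erefl).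
  apply: lee_wpmul2r => //.
  by rewrite lee_fin; apply: eqW; ring.
(* The factors with 2 k are the growth bound for (b - m) f evaluated at t = 2 k r. *)
have b3 : (Lq mu p (E r) Th <=
    (CT * CL * (1 + ln (2 * k)) * (2 * k) `^ e2 * K * B * r `^ D)%:E * J r)%E.
  apply: (le_trans (Lq_T_cut _ _ (or_introl erefl) (Lploc_hm m))).
  apply: (@le_trans _ _ (CT%:E * ((K * B * (1 + ln (2 * k)) *
     ((2 * k) `^ e2 * r `^ e2))%:E * ((CL * r `^ (c - 1))%:E * J r)))%E).
    apply: lee_wpmul2l; first by rewrite lee_fin.
    apply: (le_trans (dom_h2 r0 r2)).
    rewrite mulfK ?gt_eqF// powRM ?(ltW k20) ?(ltW r0)//.
    apply: lee_wpmul2l; last exact: local_le.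
    have ? : 0 <= ln (2 * k) by apply: exp.ln_ge0; move: k1; lra.
    have ? : 0 <= 1 + ln (2 * k) by exact: addr_ge0.
    have ? : 0 <= K * B by exact: mulr_ge0.
    rewrite lee_fin; apply: mulr_ge0; first exact: mulr_ge0.
    by apply: mulr_ge0; exact: powR_ge0.
  rewrite !muleA -!EFinM -(r_pow _ _ _ a2); apply: lee_wpmul2r => //.
  by rewrite lee_fin; apply: eqW; ring.
have b4 : (Lq mu p (E r) (fun x => c0 * Ph x)%R <=
    (c0 * CU * K * B * r `^ D)%:E * J r)%E.
  rewrite LqZ//; last exact: measurable_funTS.
  rewrite ger0_norm//.
  apply: (@le_trans _ _ (c0%:E * ((CU * (K * B) * r `^ D)%:E * J r))%E).
    apply: lee_wpmul2l; first by rewrite lee_fin.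
    apply: (le_trans (Lq_potential_le _ p0 (mhm m))).
    exact: (dom_potential (or_introl erefl) (mulr_ge0 K0 B0) r0 (mhm m) (dom_h2 r0)).
  rewrite !muleA -!EFinM; apply: lee_wpmul2r => //.
  by rewrite lee_fin; apply: eqW; ring.
have mTh' := measurable_funTS (D := E r) mTh.
have n1 : measurable_fun (E r) (fun x => `|(b x - m) * Tf x| + `|c0 * ((b x - m) * Pf x)|).
  by apply: measurable_funD; exact: measurableT_comp.
have n2 : measurable_fun (E r) (fun x => `|Th x| + `|c0 * Ph x|).
  by apply: measurable_funD; exact: measurableT_comp.
have normD (x y : R) : `| `|x| + `|y| | = `|x| + `|y| by rewrite ger0_norm// addr_ge0.
apply: (le_trans (Lq_ae_le_add (mell x0 r) (measurable_funTS measurable_commutator) n1 n2 _)).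
  by apply: filterS ae_le => x hx /hx; rewrite !normD.
have JE : J r \is a fin_num by rewrite ge0_fin_numE// Jfin.
rewrite /commutator_const (mulrDl _ _ B) (mulrDl _ _ (r `^ D)) EFinD muleDl//.
apply: leeD.
  rewrite (mulrDl _ _ B) (mulrDl _ _ (r `^ D)) EFinD muleDl//.
  apply: (le_trans (Lq_ae_le_add (mell x0 r) n1 mg1 mg2 _)); last exact: leeD.
  by apply: aeW => x _; rewrite normD.
rewrite (mulrDl _ _ B) (mulrDl _ _ (r `^ D)) EFinD muleDl//.
apply: (le_trans (Lq_ae_le_add (mell x0 r) n2 mTh' mg4 _)); last exact: leeD.
by apply: aeW => x _; rewrite normD.
Unshelve. all: by end_near. Qed.

Lemma commutator_estimate : [/\ truncations_cvg rho T f,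
  truncations_cvg rho T (fun y => b y * f y),
  Lploc p (commutator rho T b f) &
  forall r, 0 < r -> (Lq mu p (E r) (commutator rho T b f) <=
    (commutator_const * B * r `^ (gamma / p - delta))%:E * J r)%E].
Proof.
split; [exact: truncations_cvg_f|by rewrite bfE| |exact: commutator_le].
apply: Lploc_fin => // t t0; apply: (le_lt_trans (commutator_le t0)).
apply: lte_mul_pinfty => //; last exact: Jfin.
by rewrite lee_fin !mulr_ge0 ?powR_ge0// commutator_const_ge0.
Qed.

End data.
Lemma commutator_bounded (phi1 phi2 : 'rV[R]_n -> R -> R) (Cphi : R) :
  (forall x r, 0 < r -> 0 < phi1 x r) -> (forall x r, 0 < r -> 0 < phi2 x r) ->
  0 <= Cphi ->
  (forall r, 0 < r -> (morrey_integral phi1 x0 (gamma / p1) c r <=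
    (Cphi * phi2 x0 r * r `^ delta)%:E)%E) ->
  exists2 C : R, 0 < C & forall b f,
    LC rho p2 lambda x0 b -> LM rho p1 phi1 x0 f ->
    [/\ truncations_cvg rho T f, truncations_cvg rho T (fun y => b y * f y),
      LM rho p phi2 x0 (commutator rho T b f) &
      (LM_norm rho p phi2 x0 (commutator rho T b f) <=
       C%:E * LC_norm rho p2 lambda x0 b * LM_norm rho p1 phi1 x0 f)%E].
Proof.
move=> phi10 phi20 Cphi0 hphi.
pose C := commutator_const * v `^ p1^-1 * Cphi / v `^ p^-1.
have C0 : 0 <= C.
  by rewrite divr_ge0 ?powR_ge0// !mulr_ge0 ?powR_ge0// commutator_const_ge0.
(* [C] may be 0, and a positive constant is required. *)
exists (C + 1); first by rewrite ltr_wpDl.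
move=> b f [hb boo] [hf foo].
have b0 : (0 <= LC_norm rho p2 lambda x0 b)%E by exact: LC_norm_ge0.
have f0 : (0 <= LM_norm rho p1 phi1 x0 f)%E by exact: (LM_norm_ge0 _ _ _ phi10).
have bE : LC_norm rho p2 lambda x0 b \is a fin_num by rewrite ge0_fin_numE.
have fE : LM_norm rho p1 phi1 x0 f \is a fin_num by rewrite ge0_fin_numE.
set B := fine (LC_norm rho p2 lambda x0 b).
set M := fine (LM_norm rho p1 phi1 x0 f).
have B0 : 0 <= B by exact: fine_ge0.
have M0 : 0 <= M by exact: fine_ge0.
have J_le r : 0 < r -> (\int[leb]_(t in `]r, +oo[)
    ((log_weight c r t)%:E * Lq mu p1 (E t) f) <=
    (M * v `^ p1^-1 * (Cphi * phi2 x0 r * r `^ delta))%:E)%E.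
  move=> r0; apply: (le_trans (log_tail_le hrho v0 volE hp1 phi10 c hf.1 foo r0)).
  rewrite [leRHS]EFinM; apply: lee_wpmul2l; last exact: hphi.
  by rewrite lee_fin mulr_ge0// powR_ge0.
have Jfin r : 0 < r -> (\int[leb]_(t in `]r, +oo[)
    ((log_weight c r t)%:E * Lq mu p1 (E t) f) < +oo)%E.
  by move=> r0; exact: le_lt_trans (J_le _ r0) (ltry _).
have [cvf cvbf lF F_le] :=
  commutator_estimate hf hb B0 (LC_normP v0 volE p20 boo) Jfin.
have nF : (LM_norm rho p phi2 x0 (commutator rho T b f) <= (C * B * M)%:E)%E.
  rewrite (_ : C * B * M = commutator_const * B * (M * v `^ p1^-1 * Cphi) / v `^ p^-1).
    apply: (LM_norm_le v0 volE hp phi20).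
      by rewrite !mulr_ge0 ?powR_ge0// commutator_const_ge0.
    move=> r r0; apply: (le_trans (F_le r r0)).
    apply: (@le_trans _ _ ((commutator_const * B * r `^ (gamma / p - delta))%:E *
      (M * v `^ p1^-1 * (Cphi * phi2 x0 r * r `^ delta))%:E)%E).
      apply: lee_wpmul2l; last exact: J_le.
      by rewrite lee_fin !mulr_ge0 ?powR_ge0// commutator_const_ge0.
    have -> : r `^ (gamma / p) = r `^ (gamma / p - delta) * r `^ delta.
      by rewrite -powRD ?subrK// (gt_eqF r0) implybT.
    by rewrite -EFinM lee_fin; apply: eqW; ring.
  by rewrite /C; ring.
split=> //; first by split=> //; exact: le_lt_trans nF (ltry _).
apply: (le_trans nF); rewrite -(fineK bE) -(fineK fE) -!EFinM lee_fin -/B -/M.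
by apply: ler_wpM2r => //; apply: ler_wpM2r => //; rewrite lerDl.
Qed.

End commutator_estimate.

(** * Reduction of the two cases to the common estimate *)

Lemma sphere_measure_fin (R : realType) (n : nat) :
  @sphere_measure R n [set: 'rV[R]_n] \is a fin_num.
Proof.
rewrite ge0_fin_numE// /sphere_measure /mscale/= /mimage /pushforward /mrestr.
rewrite preimage_setT setTI; apply: lte_mul_pinfty => //.
  by rewrite lee_fin invr_ge0 fine_ge0.
apply: (@le_lt_trans _ _ (lebesgue_rV (ball (0 : 'rV[R]_n) 2))).
  apply: le_measure; rewrite ?inE.
  - exact: measurable_eball.
  - exact: measurable_rV_ball.
  - move=> x; rewrite /eball/= rV_ballE// => x1 i; rewrite mxE sub0r normrN.
    by rewrite (le_lt_trans (coord_le_enorm _ _))// (le_lt_trans x1)// ltr1n.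
by rewrite lebesgue_rV_ball// ltry.
Qed.

Lemma kernel_integral_le (R : realType) (n : nat) (P : 'M[R]_n)
    (rho Omega : 'rV[R]_n -> R) (q : R) : quasi_distance P rho ->
  measurable_fun [set: 'rV[R]_n] Omega -> homogeneous0 P Omega -> 1 < q ->
  Omega \in Lfun (@sphere_measure R n) q%:E ->
  exists2 C : R, 0 <= C & forall t, 0 < t ->
    (\int[@lebesgue_rV R n]_(x in ellipsoid rho 0 t) (`|Omega x| `^ q)%:E <=
     (C * t `^ (\tr P))%:E)%E.
Proof.
move=> hrho mOmega hOmega q1 Oq; have q0 : 0 < q by exact: lt_trans q1.
have /(LfunTP _ _ q0)[_ Ofin] := Oq.
apply: (@homogeneous_integral_le _ _ _ _ hrho (fun x => (`|Omega x| `^ q)%:E)).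
- apply/measurable_EFinP; apply: (measurableT_comp (measurable_powR q)).
  exact: measurableT_comp.
- by move=> x; rewrite lee_fin powR_ge0.
- by move=> t x t0; rewrite hOmega.
- rewrite -(Lq_powR _ setT Omega (lt0r_neq0 q0)); exact: poweR_lty.
Qed.

Theorem theorem12 (R : realType) (n : nat) (hn : (2 <= n)%N)
  (P : 'M[R]_n) (hP : positive_spectrum P)
  (gamma : R) (hgamma : gamma = \tr P)
  (rho rhostar : 'rV[R]_n -> R)
  (hrho : quasi_distance P rho) (hrhostar : quasi_distance P^T rhostar)
  (x0 : 'rV[R]_n) (p p1 p2 : R) (hp : 1 < p) (hp1 : 1 < p1) (hp2 : 1 < p2)
  (hpp : p^-1 = p1^-1 + p2^-1)
  (s : \bar R) (hs : (1 < s)%E)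
  (Omega : 'rV[R]_n -> R)
  (mOmega : measurable_fun [set: 'rV[R]_n] Omega)
  (hOmega0 : homogeneous0 P Omega)
  (hOmegas : Omega \in Lfun (@sphere_measure R n) s)
  (T : ('rV[R]_n -> R) -> 'rV[R]_n -> R)
  (Tlin : linear_ae T)
  (Tsize : size_condition T gamma rho Omega)
  (Tbounded : forall q : R, 1 < q -> Lq_bounded T q)
  (lambda : R) (hlambda : 0 <= lambda < gamma^-1)
  (phi1 phi2 : 'rV[R]_n -> R -> R)
  (hphi1 : morrey_weight phi1) (hphi2 : morrey_weight phi2)
  (hphi :
    ((hoelder_conjugate s <= p%:E)%E /\
     exists C : R, forall r : R, 0 < r ->
       (morrey_integral phi1 x0 (gamma / p1)
          (gamma / p1 + 1 - gamma * lambda) r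
        <= (C * phi2 x0 r)%:E)%E)
    \/
    ((p1%:E < s)%E /\
     exists C : R, forall r : R, 0 < r ->
       (morrey_integral phi1 x0 (gamma / p1)
          (gamma / p1 - gamma * fine (s^-1)%E + 1 - gamma * lambda) r
        <= (C * phi2 x0 r * r `^ (gamma * fine (s^-1)%E))%:E)%E)) :
  exists2 C : R, 0 < C &
    forall b f : 'rV[R]_n -> R,
      LC rho p2 lambda x0 b -> LM rho p1 phi1 x0 f ->
      [/\ truncations_cvg rho T f,
          truncations_cvg rho T (fun y => b y * f y),
          LM rho p phi2 x0 (commutator rho T b f) &
          (LM_norm rho p phi2 x0 (commutator rho T b f) <=
           C%:E * LC_norm rho p2 lambda x0 b * LM_norm rho p1 phi1 x0 f)%E].
Proof.
subst gamma.
have [_ [v v0 volE]] := radial_mass_fin hrho.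
have [k k1 tri] := qd_triangle hrho.
have [c0 Tsize0] := Tsize.
have {}Tsize0 : forall f, f \in Lfun (@lebesgue_rV R n) 1%E -> compact (supp f) ->
  forall x, ~ supp f x ->
    (`|T f x|%:E <= `|c0|%:E * \int[@lebesgue_rV R n]_y
      (`|Omega (x - y)| / rho (x - y) `^ \tr P * `|f y|)%:E)%E.
  move=> f f1 cf x xf; apply: (le_trans (Tsize0 f f1 cf x xf)).
  apply: lee_wpmul2r; last by rewrite lee_fin ler_norm.
  apply: integral_ge0 => y _.
  by rewrite lee_fin mulr_ge0// divr_ge0// powR_ge0.
have /andP[lambda0 lambda1] := hlambda.
(* 0 <= lambda < 1 / gamma forces 1 / gamma, hence gamma, to be positive. *)
have gamma0 : 0 < \tr P by rewrite -invr_gt0; exact: le_lt_trans lambda1.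
have gl1 : \tr P * lambda < 1 by rewrite mulrC -ltr_pdivlMr// mul1r.
have p0 : 0 < p by exact: lt_trans hp.
have p10 : 0 < p1 by exact: lt_trans hp1.
have p20 : 0 < p2 by exact: lt_trans hp2.
have pp1 : p < p1.
  by rewrite -ltf_pV2 ?posrE// hpp ltrDl invr_gt0.
have [CT CT0 T_le] : exists2 CT : R, 0 <= CT & forall q, q = p \/ q = p1 ->
    forall h, h \in Lfun (@lebesgue_rV R n) q%:E ->
    (Lnorm (@lebesgue_rV R n) q%:E (EFin \o T h) <=
     CT%:E * Lnorm (@lebesgue_rV R n) q%:E (EFin \o h))%E.
  have [Cp hCp] := Tbounded p hp; have [Cp1 hCp1] := Tbounded p1 hp1.
  exists (`|Cp| + `|Cp1|) => [|q qE h hq]; first exact: addr_ge0.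
  case: qE hq => -> hq.
    apply: (le_trans (hCp h hq).2); apply: lee_wpmul2r; first exact: Lnorm_ge0.
    by rewrite lee_fin (le_trans (ler_norm _))// lerDl.
  apply: (le_trans (hCp1 h hq).2); apply: lee_wpmul2r; first exact: Lnorm_ge0.
  by rewrite lee_fin (le_trans (ler_norm _))// lerDr.
pose pot_bound delta CU := forall q, q = p \/ q = p1 -> forall h r,
  measurable_fun [set: 'rV[R]_n] h -> 0 < r ->
  ((\int[@lebesgue_rV R n]_(x in ellipsoid rho x0 r)
      (potential P rho k x0 Omega r h x `^ q)) `^ q^-1 <=
   (CU * r `^ (\tr P / q - delta))%:E *
   tail_integral rho x0 (delta - \tr P / p) p r h)%E.
pose weight_bound delta C := forall r, 0 < r ->
  (morrey_integral phi1 x0 (\tr P / p1)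
     (\tr P / p1 - delta + 1 - \tr P * lambda) r <=
   (C * phi2 x0 r * r `^ delta)%:E)%E.
(* [delta] will be 0 in case (a), and also in case (b) when s is infinite; it is gamma / s when s is
   finite in case (b). *)
suff [delta [CU [Cphi [dle CU0 pot hphi']]]] : exists delta CU Cphi,
    [/\ delta <= \tr P / p1, 0 <= CU, pot_bound delta CU & weight_bound delta Cphi].
  apply: (commutator_bounded hrho gamma0 v0 k1 volE tri mOmega (normr_ge0 c0)
    Tlin Tsize0 Tbounded hp hp1 hp2 hpp lambda0 gl1 dle CU0 pot CT0 T_le
    hphi1.2 hphi2.2 (normr_ge0 Cphi)) => r r0.
  apply: (le_trans (hphi' r r0)); rewrite lee_fin; apply: ler_wpM2r.
    exact: powR_ge0.
  by apply: ler_wpM2r; [exact/ltW/hphi2.2|exact: ler_norm].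
have p'0 : 0 < p - 1 by rewrite subr_gt0.
have p'1 : 1 < p / (p - 1) by rewrite ltr_pdivlMr// mul1r ltrBlDr ltrDl.
(* The pointwise bound needs [Omega] only in L_p', with p' = p / (p - 1) in the role of s. *)
have sup_bound : ((p / (p - 1))%:E <= s)%E -> exists2 CU, 0 <= CU & pot_bound 0 CU.
  (* L_s is contained in L_p' because the sphere has finite measure. *)
  move=> ps; have Omega_p : Omega \in Lfun (@sphere_measure R n) (p / (p - 1))%:E.
    apply: (Lfun_subset _ (ltW hs) (sphere_measure_fin R n) ps) => //.
    by rewrite lee_fin ltW.
  have [KO KO0 hKO] := kernel_integral_le hrho mOmega hOmega0 p'1 Omega_p.
  have conj : (p / (p - 1))^-1 + p^-1 = 1.
    by rewrite invf_div mulrBl mul1r divff ?gt_eqF// subrK.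
  have [C C0 hC] := potential_le_sup_mean hrho gamma0 v0 k1 volE tri x0 mOmega p'1 KO0 hKO
    p0 p0 conj.
  have [C1 C10 hC1] := potential_le_sup_mean hrho gamma0 v0 k1 volE tri x0 mOmega p'1 KO0 hKO
    p0 p10 conj.
  exists (C + C1); first exact: addr_ge0.
  move=> q qE h r mh r0; rewrite subr0 sub0r.
  have tl0 : (0 <= tail_integral rho x0 (- (\tr P / p)) p r h)%E.
    by apply: integral_ge0 => t _; rewrite mule_ge0 ?Lq_ge0// lee_fin powR_ge0.
  case: qE => ->.
    apply: (le_trans (hC h r mh r0)); apply: lee_wpmul2r => //.
    by rewrite lee_fin ler_wpM2r ?powR_ge0// lerDl.
  apply: (le_trans (hC1 h r mh r0)); apply: lee_wpmul2r => //.
  by rewrite lee_fin ler_wpM2r ?powR_ge0// lerDr.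
case: hphi => [[sp [Cphi hphi']]|[ps [Cphi hphi']]].
  have [|CU CU0 pot] := sup_bound.
    (* The condition s' <= p is turned into p' <= s. *)
    case: s hs sp {hOmegas sup_bound} => [s| |]//; last by move=> *; exact: leey.
    rewrite lte_fin => s1; have s'0 : 0 < s - 1 by rewrite subr_gt0.
    rewrite /hoelder_conjugate/= eqe (gt_eqF (lt_trans _ s1))//.
    rewrite -EFinB inver (gt_eqF s'0) -EFinM !lee_fin !ler_pdivrMr// => h.
    by rewrite mulrBr mulr1; move: h; rewrite mulrBr mulr1 mulrC; lra.
  exists 0, CU, Cphi; split => //; first by rewrite divr_ge0// ltW.
  by move=> r r0; rewrite subr0 powRr0 mulr1; exact: hphi'.
move: (hs) ps hphi'; case: s hOmegas sup_bound {hs} => [s| |]//; last first.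
  (* For infinite s the exponent gamma / s is 0 and p' <= s holds, so case (b) becomes the estimate
     with [delta] = 0. *)
  move=> _ sup_bound _ _ hphi'; have [|CU CU0 pot] := sup_bound; first exact: leey.
  exists 0, CU, Cphi; split => //; first by rewrite divr_ge0// ltW.
  by move=> r r0; have := hphi' r r0; rewrite /= mulr0.
move=> hOmegas _; rewrite !lte_fin => s1 ps hphi'.
have s0 : 0 < s by exact: lt_trans s1.
have [KO KO0 hKO] := kernel_integral_le hrho mOmega hOmega0 s1 hOmegas.
(* Since p < p1 < s, the averaged bound is available for both exponents. *)
have [C C0 hC] := potential_le_mean hrho gamma0 v0 k1 volE tri x0 mOmega s1 KO0 hKO
  hp hp (lt_trans pp1 ps).
have [C1 C10 hC1] := potential_le_mean hrho gamma0 v0 k1 volE tri x0 mOmega s1 KO0 hKO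
  hp hp1 ps.
exists (\tr P / s), (C + C1), Cphi; split.
- by rewrite ler_pM2l// lef_pV2 ?posrE// ltW.
- exact: addr_ge0.
- move=> q qE h r mh r0.
  have tl0 : (0 <= tail_integral rho x0 (\tr P / s - \tr P / p) p r h)%E.
    by apply: integral_ge0 => t _; rewrite mule_ge0 ?Lq_ge0// lee_fin powR_ge0.
  case: qE => ->.
    apply: (le_trans (hC h r mh r0)); apply: lee_wpmul2r => //.
    by rewrite lee_fin ler_wpM2r ?powR_ge0// lerDl.
  apply: (le_trans (hC1 h r mh r0)); apply: lee_wpmul2r => //.
  by rewrite lee_fin ler_wpM2r ?powR_ge0// lerDr.
- by move=> r r0; have := hphi' r r0; rewrite inver gt_eqF.
Qed.
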